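(* Let $S$ be a sigmoidal nonlinearity. The static behavior $$-y+S(y+u+\beta y)=0$$ of the feedback loop around $S$ with input $u$, output $y$ and parameter $\beta\in\mathbb{R}$ is a universal unfolding of the hysteresis singularity, with $\beta$ as unfolding parameter. Its persistent static behaviors are given by the persistent bifurcation diagrams of the hysteresis, i.e. (up to equivalence of bifurcation diagrams) by the persistent bifurcation diagrams of the normal form $G_{hy}(y,u;\beta)=-y^3-u+\beta y$.
   Context: Notation: $S^{(n)}$ denotes the $n$-th derivative of a smooth function $S$ of one real variable; subscripts denote partial derivatives. A static behavior (bifurcation diagram) is the set of pairs $(y,u)\in\mathbb{R}\times\mathbb{R}$ satisfying $g(y,u)=0$ for a smooth function $g$; it is identified with the mapping $g$. The variable $y$ is the output and $u$ is the input (bifurcation parameter). All statements are local near the origin. Sigmoidal nonlinearity: a smooth function $S:\mathbb{R}\to\mathbb{R}$ (with associated sigmoidal static behavior $-y+S(u)=0$) such that (a) $S(-u)=-S(u)$ for all $u\in\mathbb{R}$; (b) $S^{(1)}(u)>0$ for all $u\in\mathbb{R}$; (c) $\lim_{u\to\pm\infty}S^{(1)}(u)=0$; (d) for all $n\in\mathbb{N}$, $S^{(2n+1)}(0)\neq 0$, with $S^{(1)}(0)=1$; (e) for all $n\in\mathbb{N}$, $\mathrm{sgn}(S^{(2n)}(u))=-\mathrm{sgn}(u)$ for all $u\neq 0$. Equivalence: two smooth mappings $h,g:\mathbb{R}\times\mathbb{R}\to\mathbb{R}$ are equivalent near the origin if there exist smooth functions $Y(y,u)$, $U(u)$, $Q(y,u)$,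 with $Y(0,0)=U(0)=0$ and $Y_y>0$, $U_u>0$, $Q>0$, such that $h(y,u)=Q(y,u)\,g(Y(y,u),U(u))$ near the origin. They are strongly equivalent if this holds with $U(u)=u$. Hysteresis singularity: the codimension-$1$ singularity with normal form $g_{hy}(y,u)=-y^3-u$; the normal form of its universal unfolding is $G_{hy}(y,u;\beta)=-y^3-u+\beta y$. Universal unfolding: given a smooth mapping $g(y,u)$ possessing a codimension-$k$ singularity at the origin, a universal unfolding of $g$ is a $k$-parameter family of smooth mappings $G(\cdot,\cdot;\alpha)$, $\alpha\in\mathbb{R}^k$, such that (a) $G(y,u;0)=g(y,u)$; (b) for all smooth functions $p(y,u)$ and sufficiently small $c>0$, there exist smooth mappings $Q,Y,U,A$ such that $$g(y,u)+c\,p(y,u)=Q(y,u,c)\,G\big(Y(y,u,c),U(u,c);A(c)\big),$$ where $Q(y,u,0)\equiv 1$, $Y(y,u,0)\equiv y$, $U(u,0)\equiv u$, $A(0)=0$. The components of $\alpha$ are the unfolding parameters. A family is said to be a universal unfolding of the hysteresis singularity if its member at zero parameter value is strongly equivalent near the origin to $g_{hy}$ and the family is a universal unfolding (with $k=1$) of that member. Persistent diagrams: for an unfolding $G(y,u;\alpha)$, considered for $(y,u,\alpha)$ near the origin, the transition variety is the set of $\alpha$ for which at least one of the following occurs: there is $(y,u)$ with $G=G_y=G_u=0$; there is $(y,u)$ with $G=G_y=G_{yy}=0$; there are $u$ and $y_1\neq y_2$ with $G=G_y=0$ at both $(y_1,u)$ and $(y_2,u)$. The diagram $G(\cdot,\cdot;\alpha)=0$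 is persistent if $\alpha$ (near $0$) is not in the transition variety. Diagrams are compared up to the equivalence of bifurcation diagrams: multiplication by a positive smooth function and a smooth change of coordinates $(y,u)\mapsto(Y(y,u),U(u))$ with $Y_y>0$, $U_u>0$ between neighborhoods of the origin (not required to fix the origin).
   Formalization: No S satisfies (e) for all n together with (a)-(d), so (e) is assumed only for n=1; and since the loop has u-derivative S'(0)=1>0 at the origin, the normal forms are taken with the input reversed: -y^3+u and -y^3+u+βy instead of -y^3-u and -y^3-u+βy. *)

(* Defs.v *)
(* MathComp-Analysis *)
From HB Require Import structures.
From mathcomp Require Import all_boot all_order all_algebra.
From mathcomp Require Import all_classical all_reals all_analysis.
Set Implicit Arguments.
Unset Strict Implicit.
Unset Printing Implicit Defensive.
Import Order.TTheory GRing.Theory Num.Theory.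
Import numFieldNormedType.Exports.
Local Open Scope ring_scope.
Local Open Scope classical_set_scope.

(* In ring_scope these denote derivatives of polynomials. *)
Local Notation "f ^` ()" := (derive1 f) : ring_scope.
Local Notation "f ^` ( n )" := (derive1n n f) : ring_scope.

Section Smoothness.
Context {R : realType} {V : normedModType R}.

Definition iter_derive (f : V -> R) (vs : seq V) : V -> R :=
  foldr (fun v g => 'D_v g) f vs.

(* For finite-dimensional V and open W this is C^oo on W. *)
Definition smooth_on (W : set V) (f : V -> R) : Prop :=
  forall (vs : seq V) (x : V), W x ->
    {for x, continuous (iter_derive f vs)} /\
    (forall v : V, derivable (iter_derive f vs) x v).

Definition smooth_near (x : V) (f : V -> R) : Prop :=
  exists2 W : set V, open_nbhs x W & smooth_on W f.

End Smoothness.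

Section Sigmoid.
Context {R : realType}.
Implicit Type S : R -> R.

Definition even_derivative_sign S (n : nat) : Prop :=
  forall u : R, u != 0 -> Num.sg (S^`(n.*2) u) = - Num.sg u.

Definition sigmoid_base S : Prop :=
  [/\ smooth_on setT S,
      (forall u, S (- u) = - S u),
      (forall u, 0 < S^`() u),
      S^`() u @[u --> +oo] --> (0 : R) /\ S^`() u @[u --> -oo] --> (0 : R) &
      (forall n, S^`(n.*2.+1) 0 != 0) /\ S^`() 0 = 1].

(* The sign condition cannot hold for n = 0, as S is increasing and S 0 = 0.
   Even with 0 < n no function qualifies: n = 1 and S^`(3) 0 != 0 give
   S^`(3) 0 < 0; by n = 2, S^`(3) decreases on [0, +oo[; hence
   S^`(3) <= S^`(3) 0 < 0 there, and S^`() tends to -oo, against 0 < S^`(). *)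
Definition sigmoidal S : Prop :=
  sigmoid_base S /\ (forall n, (0 < n)%N -> even_derivative_sign S n).

(* Sign condition on the second derivative only; satisfied by tanh. *)
Definition sigmoidal2 S : Prop :=
  sigmoid_base S /\ even_derivative_sign S 1.

(* Feedback loop around S, as a family in beta of mappings of (y, u). *)
Definition feedback_loop S (y u beta : R) : R := - y + S (y + u + beta * y).

End Sigmoid.

Section Hysteresis.
Context {R : realType}.

Definition g_hy (y u : R) : R := - y ^+ 3 - u.
Definition G_hy (y u beta : R) : R := - y ^+ 3 - u + beta * y.

(* The same singularity with the input reversed: - y^3 + u (+ beta y).
   Strong equivalence preserves the sign of the u-derivative at a singular
   point, so - y^3 - u and - y^3 + u are not strongly equivalent; the loop
   around S has u-derivative S^`() 0 = 1 > 0 at the origin. *)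
Definition g_hy_rev (y u : R) : R := g_hy y (- u).
Definition G_hy_rev (y u beta : R) : R := G_hy y (- u) beta.

End Hysteresis.

Section Unfoldings.
Context {R : realType}.
Implicit Types (g h : R -> R -> R) (G H : R -> R -> R -> R).

Definition strongly_equivalent h g : Prop :=
  exists Y Q : R -> R -> R,
    [/\ smooth_near (0 : R * R) (fun z => Y z.1 z.2),
        smooth_near (0 : R * R) (fun z => Q z.1 z.2),
        Y 0 0 = 0 &
        \forall z \near (0 : R * R),
          [/\ 0 < (Y ^~ z.2)^`() z.1, 0 < Q z.1 z.2 &
              h z.1 z.2 = Q z.1 z.2 * g (Y z.1 z.2) z.2]].

(* One-parameter (k = 1) universal unfoldings; the coordinates of
   R * R * R are ((y, u), c). *)
Definition universal_unfolding g G : Prop :=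
  [/\ smooth_near (0 : R * R * R) (fun w => G w.1.1 w.1.2 w.2),
      (\forall z \near (0 : R * R), G z.1 z.2 0 = g z.1 z.2) &
      forall p : R -> R -> R,
        smooth_near (0 : R * R) (fun z => p z.1 z.2) ->
        exists (Q Y : R -> R -> R -> R) (U : R -> R -> R) (A : R -> R),
          [/\ [/\ smooth_near (0 : R * R * R) (fun w => Q w.1.1 w.1.2 w.2),
                  smooth_near (0 : R * R * R) (fun w => Y w.1.1 w.1.2 w.2),
                  smooth_near (0 : R * R) (fun z => U z.1 z.2) &
                  smooth_near (0 : R) A],
              (\forall z \near (0 : R * R),
                 Q z.1 z.2 0 = 1 /\ Y z.1 z.2 0 = z.1),
              (\forall u \near (0 : R), U u 0 = u),
              A 0 = 0 &
              \forall w \near (0 : R * R * R),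
                let y := w.1.1 in let u := w.1.2 in let c := w.2 in
                0 < c ->
                g y u + c * p y u = Q y u c * G (Y y u c) (U u c) (A c)]].

Definition universal_unfolding_of_singularity g0 G : Prop :=
  strongly_equivalent (fun y u => G y u 0) g0 /\
  universal_unfolding (fun y u => G y u 0) G.

(* Transition variety of G for (y, u) restricted to a neighborhood W of the
   origin. *)
Definition transition_variety (W : set (R * R)) G : set R :=
  [set a |
    (exists y u, [/\ W (y, u), G y u a = 0,
       (fun y' => G y' u a)^`() y = 0 & (fun u' => G y u' a)^`() u = 0]) \/
    (exists y u, [/\ W (y, u), G y u a = 0,
       (fun y' => G y' u a)^`() y = 0 & (fun y' => G y' u a)^`(2) y = 0]) \/
    (exists y1 y2 u, [/\ y1 != y2, W (y1, u), W (y2, u),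
       G y1 u a = 0 /\ (fun y' => G y' u a)^`() y1 = 0 &
       G y2 u a = 0 /\ (fun y' => G y' u a)^`() y2 = 0])].

(* Equivalence of the diagrams of h on N1 and of g on N2. The inverse of the
   change of coordinates is smooth because its Jacobian is Y_y * U_u > 0. *)
Definition diagram_equivalent (N1 N2 : set (R * R)) h g : Prop :=
  exists (Y Q : R -> R -> R) (U : R -> R),
    [/\ smooth_on N1 (fun z => Y z.1 z.2) /\ smooth_on N1 (fun z => Q z.1 z.2),
        smooth_on [set u | exists y, N1 (y, u)] U,
        set_bij N1 N2 (fun z => (Y z.1 z.2, U z.2)) &
        forall y u, N1 (y, u) ->
          [/\ 0 < (Y ^~ u)^`() y, 0 < U^`() u, 0 < Q y u &
              h y u = Q y u * g (Y y u) (U u)]].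

(* Near the origin, every persistent diagram of G is equivalent to a
   persistent diagram of H. The neighborhoods N1 and N2 may depend on the
   parameter a, but contain a ball of radius r independent of a: without this
   uniformity N1 could shrink with a and miss the features of the diagram. *)
Definition persistent_diagrams_among G H : Prop :=
  \forall rho \near (0 : R)^'+,
    exists2 r : R, 0 < r &
      \forall a \near (0 : R),
        ~ transition_variety (ball (0 : R * R) rho) G a ->
        exists b : R,
          [/\ `|b| < rho,
              ~ transition_variety (ball (0 : R * R) rho) H b &
              exists N1 N2 : set (R * R),
                [/\ open N1 /\ open N2,
                    ball (0 : R * R) r `<=` N1 /\ N1 `<=` ball (0 : R * R) rho,
                    ball (0 : R * R) r `<=` N2 /\ N2 `<=` ball (0 : R * R) rho &
                    diagram_equivalent N1 N2
                      (fun y u => G y u a) (fun y u => H y u b)]].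

Definition same_persistent_diagrams G H : Prop :=
  persistent_diagrams_among G H /\ persistent_diagrams_among H G.

End Unfoldings.

(* Main.v *)
Require Import Defs.
From HB Require Import structures.
From mathcomp Require Import all_boot all_order all_algebra.
From mathcomp Require Import all_classical all_reals all_analysis.
From mathcomp Require Import ring lra.
Set Implicit Arguments.
Unset Strict Implicit.
Unset Printing Implicit Defensive.
Import Order.TTheory GRing.Theory Num.Theory.
Import numFieldNormedType.Exports.
Local Open Scope ring_scope.
Local Open Scope classical_set_scope.

(** No function is [sigmoidal]. For [sigmoidal2], let T be the local inverse of S and
  f y = T y - y, so that f, f' and f'' vanish at 0 and f''' > 0 there. The loop is
  m(y,u,a) (u - (f y - a y)) with m > 0, so everything reduces to the function
  f y - a y of y, and, for the universality, to functions phi(y,c) - a y, where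
  u = phi(y,c) solves the perturbed equation.

  The main point is that, for suitable smooth e, h, k > 0 and z,
    phi(y,c) - (a - e(c)) y = h(a,c) + k(a,c) (z^3/3 - a z),  z = z(y,a,c),
  that is, the unfolding by a y of a cubic critical point is the versal one. To see it,
  take a coordinate s with phi_y = s^2 - e(c), and let Om = (y phi_y - phi)/2, so that
  Om_s = s y and the left-hand side is (s^2 - a) y - 2 Om. By Whitney's
  theorem with parameters, Om is a smooth combination of 1 and s with coefficients
  depending on s^2 and c; Taylor expansion of the coefficients at s^2 = a gives the
  right-hand side with z = s, up to a multiple of (s^2 - a)^2, which a change of
  coordinate z = s + (s^2 - a) zeta absorbs.

  Whitney's theorem for a function even in s requires an extension of v (sqrt t) to
  t < 0; it is Seeley's, after multiplication by a flat cut-off.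

  Given this, comparing the slices c and 0 yields the universal unfolding, and
  b = 3 a, Y = z, U = 3 (u - h)/k yields the equivalence with - y^3 + u + b y. *)

(** * Smooth maps between normed spaces *)

(** A general unfolding of a cubic calls for the Malgrange preparation theorem. The Legendre
    transform lowers the degree: the critical points of phi(y,c) - (a - e(c)) y are given by s^2 =
    a, so only the fold s |-> s^2 has to be prepared, and for a fold it is enough to split a
    function into even and odd parts. The final displacement is possible because s^3/3 - a s has
    derivative s^2 - a: moving s by (s^2 - a) zeta changes the cubic by (s^2 - a)^2 times a quantity
    that is invertible in zeta.

    The sign of f''' comes from f'''(0) = - S'''(0), with S'''(0) nonzero and S'' negative to the
    right of 0. In the universal unfolding A(c) = e(c), and the slices c and 0 are compared at the
    same a = e(c). The factors 3 turn z^3/3 - a z into z^3 - 3 a z.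

    Division and extension follow one scheme: the differential is an explicit combination of
    functions of the same class, over a parameter space enlarged by the direction of
    differentiation, and smoothness follows by induction on the order. This is why the parameters
    range over arbitrary normed spaces. *)

Section Differentials.
Context {R : realType}.
Implicit Types U V W : normedModType R.

Lemma diff_eps V W (f : V -> W) (x : V) : differentiable f x ->
  forall e : R, 0 < e ->
    \forall h \near (0 : V), `|f (h + x) - f x - 'd f x h| <= e * `|h|.
Proof.
move=> /diff_locally /eqaddoP fx e /fx; apply: filterS => h.
by rewrite /= opprD addrA.
Qed.

Lemma is_diff_eps V W (f df : V -> W) (x : V) : linear df -> continuous df ->
  (forall e : R, 0 < e ->
    \forall h \near (0 : V), `|f (h + x) - f x - df h| <= e * `|h|) ->
  is_diff x f df.
Proof.
move=> dfl dfc fe.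
pose dfM := GRing.isLinear.Build _ _ _ _ _ dfl.
pose dfL : {linear V -> W} := HB.pack df dfM.
have fo : f \o shift x = cst (f x) + dfL +o_ 0 id.
  by apply/eqaddoP => e /fe; apply: filterS => h; rewrite /= opprD addrA.
have dE : 'd f x = dfL :> (V -> W) by exact: diff_unique.
by apply: DiffDef => //; apply/diff_locallyP; rewrite dE.
Qed.

Lemma near_is_diff V W (f g df : V -> W) (x : V) :
  (\forall z \near x, f z = g z) -> is_diff x f df -> is_diff x g df.
Proof.
move=> fg [fx dE]; rewrite -dE.
apply: is_diff_eps => [||e e0]; [exact: linearP|exact: diff_continuous|].
have := diff_eps fx e0; move: (fg); rewrite (near_shift 0 x).
apply: filterS2 => h; rewrite /= subr0 => <-.
by rewrite (nbhs_singleton fg).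
Qed.

End Differentials.

(** * Maps of class C^n by iterated tangent maps *)

Section Ck.
Context {R : realType}.
Implicit Types U V W : normedModType R.

Definition tangent V W (f : V -> W) (p : V * V) : W := 'd f (p.1) p.2.

(* Differentiating the tangent map instead of the directional derivatives makes
   the chain rule uniform in the normed spaces. *)
Fixpoint Ck (n : nat) : forall V W, set V -> (V -> W) -> Prop :=
  match n with
  | 0 => fun V W D f => forall x, D x -> {for x, continuous f}
  | m.+1 => fun V W D f =>
      (forall x, D x -> differentiable f x) /\ Ck m (D `*` setT) (tangent f)
  end.

Lemma Ck_sub n V W (D E : set V) (f : V -> W) :
  D `<=` E -> Ck n E f -> Ck n D f.
Proof.
elim: n V W D E f => [|n IH] V W D E f DE /=; first by move=> + x /DE; exact.
case=> fd ft; split=> [x /DE|]; first exact: fd.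
by apply: IH ft => -[x v] [/= /DE].
Qed.

Lemma Ck_le n V W (D : set V) (f : V -> W) : Ck n.+1 D f -> Ck n D f.
Proof.
elim: n V W D f => [|n IH] V W D f.
  by move=> [fd _] x /fd /differentiable_continuous.
by move=> [fd ft]; split=> //; exact: IH.
Qed.

Lemma openX_setT V W (D : set V) : open D -> open (D `*` [set: W]).
Proof.
rewrite !openE => oD [x v] [/= /oD Dx _].
by exists (D, setT) => //; split=> //; exact: filterT.
Qed.

Lemma Ck_eq n V W (D : set V) (f g : V -> W) : open D ->
  (forall x, D x -> f x = g x) -> Ck n D f -> Ck n D g.
Proof.
elim: n V W D f g => [|n IH] V W D f g oD fg /=.
  move=> fc x Dx; rewrite /prop_for /continuous_at -(fg _ Dx).
  apply: cvg_trans (fc x Dx); apply: near_eq_cvg.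
  by near=> y; rewrite fg//; near: y; exact: open_nbhs_nbhs.
have dfg x : D x -> differentiable f x -> is_diff x g ('d f x).
  move=> Dx fx; apply: near_is_diff; last exact: differentiableP.
  by near=> y; rewrite fg//; near: y; exact: open_nbhs_nbhs.
case=> fd ft; split=> [x Dx|].
  by have [] := dfg x Dx (fd _ Dx).
apply: IH ft; first exact: openX_setT.
by move=> [x v] [/= Dx _]; rewrite /tangent /=; have [_ ->] := dfg x Dx (fd _ Dx).
Unshelve. all: by end_near. Qed.

Lemma Ck_linear n V W (D : set V) (f : {linear V -> W}) :
  continuous f -> Ck n D f.
Proof.
elim: n V W D f => [|n IH] V W D f fc /=; first by move=> x _; exact: fc.
split=> [x _|]; first exact: linear_differentiable.
rewrite (_ : tangent f = f \o snd).
  by apply: IH => z; apply: continuous_comp; [exact: cvg_snd|exact: fc].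
by apply/funext => -[x v]; rewrite /tangent /= diff_lin.
Qed.

Lemma Ck_cst n V W (D : set V) (a : W) : Ck n D (fun=> a).
Proof.
elim: n V W D a => [|n IH] V W D a /=; first by move=> x _; exact: cvg_cst.
split=> [x _|]; first exact: differentiable_cst.
rewrite (_ : tangent _ = fun=> 0); first exact: IH.
by apply/funext => -[x v]; rewrite /tangent /= diff_cst.
Qed.

Lemma Ck_pair n V W1 W2 (D : set V) (f : V -> W1) (g : V -> W2) :
  Ck n D f -> Ck n D g -> open D -> Ck n D (fun x => (f x, g x)).
Proof.
elim: n V W1 W2 D f g => [|n IH] V W1 W2 D f g /=.
  by move=> fc gc _ x Dx; apply: cvg_pair; [exact: fc|exact: gc].
move=> [fd ft] [gd gt] oD; split=> [x Dx|].
  by apply: differentiable_pair; [exact: fd|exact: gd].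
apply: (Ck_eq (openX_setT oD)) (IH _ _ _ _ _ _ ft gt (openX_setT oD)).
move=> [x v] [/= Dx _]; rewrite /tangent /= diff_pair//; [exact: fd|exact: gd].
Qed.

Lemma Ck_fst n V W (D : set (V * W)) : Ck n D fst.
Proof. by apply: Ck_linear => x; exact: cvg_fst. Qed.

Lemma Ck_snd n V W (D : set (V * W)) : Ck n D snd.
Proof. by apply: Ck_linear => x; exact: cvg_snd. Qed.

(** The tangent of a composition is the tangent of [g] after (f, tangent f), again a composition,
    now over the squares of the spaces; the induction therefore ranges over all spaces. *)
Lemma Ck_comp n U V W (D : set U) (E : set V) (f : U -> V) (g : V -> W) :
  open D -> (forall x, D x -> E (f x)) ->
  Ck n D f -> Ck n E g -> Ck n D (g \o f).
Proof.
elim: n U V W D E f g => [|n IH] U V W D E f g oD DE /=.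
  by move=> fc gc x Dx; apply: continuous_comp; [exact: fc|exact/gc/DE].
move=> [fd ft] [gd gt]; split=> [x Dx|].
  by apply: differentiable_comp; [exact: fd|exact/gd/DE].
have oD' : open (D `*` [set: U]) by exact: openX_setT.
have : Ck n (D `*` setT) (tangent g \o (fun p => (f p.1, tangent f p))).
  apply: (IH _ _ _ _ _ _ _ _ _ _ gt) => //=; first by move=> [x v] [Dx _]; split=> //; exact: DE Dx.
  apply: Ck_pair => //.
  apply: (IH _ _ _ _ D fst f oD'); [by move=> x []|exact: Ck_fst|].
  by apply: Ck_le; split; [exact: fd|exact: ft].
apply: Ck_eq => // -[x v] [/= Dx _].
have fx := fd x Dx; have gx := gd _ (DE _ Dx).
by rewrite /tangent /= (diff_comp fx gx).
Qed.

(** The tangent of the product is a sum of two products of coordinates, so order n for products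
    gives order n.+1. *)
Lemma Ck_mul n (D : set (R * R)) : open D -> Ck n D (fun p => p.1 * p.2).
Proof.
elim: n D => [|n IH] D oD /=.
  by move=> x _; apply: cvgM; [exact: cvg_fst|exact: cvg_snd].
split=> [x _|]; first exact: (@ex_diff _ _ _ _ _ _ _ (is_diff_mulr x)).
have oD' : open (D `*` [set: (R * R)%type]) by exact: openX_setT.
have oT := @openT (R * R)%type.
have CT := IH _ oT.
rewrite (_ : tangent _ = (fun q : R * R => q.1 + q.2) \o
   (fun q : (R * R) * (R * R) => (q.1.1 * q.2.2, q.2.1 * q.1.2))); last first.
  apply/funext => -[[a b] [c d]].
  by rewrite /tangent /= diff_val /= addrC mulrC.
apply: (@Ck_comp n _ _ _ _ setT) => //; last first.
  apply: (@Ck_linear _ _ _ _ ((fst : {linear _ -> _}) \+ snd)).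
  by move=> x; apply: cvgD; [exact: cvg_fst|exact: cvg_snd].
have F1 : Ck n (D `*` [set: R * R]) fst by exact: Ck_fst.
have F2 : Ck n (D `*` [set: R * R]) snd by exact: Ck_snd.
have pr11 : Ck n (D `*` [set: R * R]) (fst \o fst).
  by apply: (@Ck_comp n _ _ _ _ setT) => //; exact: Ck_fst.
have pr12 : Ck n (D `*` [set: R * R]) (snd \o fst).
  by apply: (@Ck_comp n _ _ _ _ setT) => //; exact: Ck_snd.
have pr21 : Ck n (D `*` [set: R * R]) (fst \o snd).
  by apply: (@Ck_comp n _ _ _ _ setT) => //; exact: Ck_fst.
have pr22 : Ck n (D `*` [set: R * R]) (snd \o snd).
  by apply: (@Ck_comp n _ _ _ _ setT) => //; exact: Ck_snd.
by apply: Ck_pair => //;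
  [ exact: (@Ck_comp n _ _ _ _ setT (fun q => ((fst \o fst) q, (snd \o snd) q))
       _ oD' (fun _ _ => I) (Ck_pair pr11 pr22 oD') CT)
  | exact: (@Ck_comp n _ _ _ _ setT (fun q => ((fst \o snd) q, (snd \o fst) q))
       _ oD' (fun _ _ => I) (Ck_pair pr21 pr12 oD') CT)].
Qed.

End Ck.

Section CkArith.
Context {R : realType}.
Implicit Types U V W : normedModType R.

Lemma Ck_compT n U V W (D : set U) (f : U -> V) (g : V -> W) : open D ->
  Ck n D f -> Ck n setT g -> Ck n D (fun z => g (f z)).
Proof. by move=> oD fc gc; apply: (@Ck_comp _ n _ _ _ D setT f g). Qed.

Lemma Ck_addf n V W (D : set V) (f g : V -> W) : open D ->
  Ck n D f -> Ck n D g -> Ck n D (fun z => f z + g z).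
Proof.
move=> oD fc gc.
apply: (@Ck_compT n _ _ _ D (fun z => (f z, g z)) (fun q : W * W => q.1 + q.2)) => //.
  exact: Ck_pair.
pose L : {linear (W * W)%type -> W} := (fst : {linear _ -> W}) \+ snd.
have Lc : continuous L by move=> x; apply: cvgD; [exact: cvg_fst|exact: cvg_snd].
exact: (Ck_linear n setT Lc).
Qed.

Lemma Ck_mulf n V (D : set V) (f g : V -> R) : open D ->
  Ck n D f -> Ck n D g -> Ck n D (fun z => f z * g z).
Proof.
move=> oD fc gc.
apply: (@Ck_compT n _ _ _ D (fun z => (f z, g z)) (fun q : R * R => q.1 * q.2)) => //.
  exact: Ck_pair.
exact/Ck_mul/openT.
Qed.

Lemma Ck_oppf n V (D : set V) (f : V -> R) : open D ->
  Ck n D f -> Ck n D (fun z => - f z).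
Proof.
move=> oD fc; rewrite (_ : (fun z => _) = fun z => -1 * f z).
  by apply: Ck_mulf => //; exact: Ck_cst.
by apply/funext => z; rewrite mulN1r.
Qed.

Lemma Ck_is_derive n (D : set R) (f df : R -> R) : open D ->
  (forall x, D x -> is_derive x 1 f (df x)) -> Ck n D df -> Ck n.+1 D f.
Proof.
move=> oD fE dfc; have fd x : D x -> differentiable f x.
  by move=> /fE [fd _]; apply/derivable1_diffP.
split=> //.
have oD' : open (D `*` [set: R]) by exact: openX_setT.
have : Ck n (D `*` [set: R]) (fun p : R * R => df p.1 * p.2).
  apply: Ck_mulf => //; last exact: Ck_snd.
  apply: (@Ck_comp _ n _ _ _ _ D fst df) => //; last exact: Ck_fst.
  by move=> x [].
apply: Ck_eq => // -[x v] [/= Dx _].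
have [fx dE] := fE x Dx.
by rewrite /tangent /= deriv1E// derive1E dE [RHS]mulrC.
Qed.

(** The derivative is a polynomial in the function itself, so one order of smoothness yields the
    next. *)
Lemma Ck_inv n : Ck n [set x : R | x != 0] GRing.inv.
Proof.
have oD : open [set x : R | x != 0] by exact: open_neq.
elim: n => [x /= x0|n IH]; first exact: inv_continuous.
apply: (@Ck_is_derive _ _ _ (fun x => - (x^-1 * x^-1))) => //.
  move=> x /= x0; have := is_deriveV x0 (is_derive_id x (1 : R)).
  by rewrite [_ *: _]mulr1 expr2 invfM.
by apply: Ck_oppf => //; exact: Ck_mulf.
Qed.

Lemma Ck_sqrt n : Ck n [set x : R | 0 < x] Num.sqrt.
Proof.
have oD : open [set x : R | 0 < x] by exact: open_gt.
elim: n => [x /= x0|n IH]; first exact: sqrt_continuous.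
apply: (@Ck_is_derive _ _ _ (fun x => (2 * Num.sqrt x)^-1)) => //.
apply: (@Ck_comp _ n _ _ _ _ [set x : R | x != 0] (fun x => 2 * Num.sqrt x) GRing.inv) => //.
- by move=> x /= x0; rewrite mulf_neq0// gt_eqF// sqrtr_gt0.
- by apply: Ck_mulf => //; exact: Ck_cst.
- exact: Ck_inv.
Qed.

End CkArith.

Section DirectionalDerivatives.
Context {R : realType}.
Implicit Types U V W : normedModType R.

Lemma is_derive_line V (f : V -> R) (z v : V) (t df : R) :
  is_derive (z + t *: v) v f df -> is_derive t 1 (fun s => f (z + s *: v)) df.
Proof.
have E : (fun h : R => h^-1 *: (f (z + (h *: (1 : R) + t) *: v) - f (z + t *: v)))
    = (fun h : R => h^-1 *: (f (h *: v + (z + t *: v)) - f (z + t *: v))).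
  by apply/funext => h; rewrite [h *: 1]mulr1 scalerDl addrCA.
by move=> [fd fE]; split; rewrite /derivable ?/derive/= E.
Qed.

(** Mean value inequality against a fixed slope [l], for [h] of either sign. It is the one-variable
    estimate behind partial derivatives, the symmetry of mixed derivatives and Taylor expansion. *)
Lemma mvt_bound (g dg : R -> R) (h e l : R) :
  (forall t : R, `|t| <= `|h| -> is_derive t 1 g (dg t) /\ `|dg t - l| <= e) ->
  `|g h - g 0 - l * h| <= e * `|h|.
Proof.
move=> gE; have gc t : `|t| <= `|h| -> {for t, continuous g}.
  by move=> /gE [[gd _] _]; apply/differentiable_continuous/derivable1_diffP.
have [h0|h0|<-] := ltgtP 0 h; last by rewrite subrr mulr0 subr0 normr0 mulr0.
- have H t : t \in `[0, h]%R -> `|t| <= `|h|.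
    by rewrite in_itv /= => /andP[t0 th]; rewrite !ger0_norm// ltW.
  have [t /subset_itv_oo_cc/H tI ->] : exists2 c, c \in `]0, h[%R & g h - g 0 = dg c * (h - 0).
    apply: MVT => // [t /subset_itv_oo_cc/H/gE[]//|].
    by apply: continuous_in_subspaceT => t /set_mem/H/gc.
  by rewrite subr0 -mulrBl normrM ler_wpM2r//; have [] := gE _ tI.
- have H t : t \in `[h, 0]%R -> `|t| <= `|h|.
    by rewrite in_itv /= => /andP[t0 th]; rewrite !ler0_norm ?lerN2// ltW.
  have [t /subset_itv_oo_cc/H tI gh] : exists2 c, c \in `]h, 0[%R & g 0 - g h = dg c * (0 - h).
    apply: MVT => // [t /subset_itv_oo_cc/H/gE[]//|].
    by apply: continuous_in_subspaceT => t /set_mem/H/gc.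
  rewrite (_ : g h - g 0 - l * h = (dg t - l) * h); last by rewrite -[g h - g 0]opprB gh; ring.
  by rewrite normrM ler_wpM2r//; have [] := gE _ tI.
Qed.

Lemma near_norm V (x : V) (P : V -> Prop) :
  (\forall z \near x, P z) <-> exists2 r : R, 0 < r & forall z, `|z - x| < r -> P z.
Proof.
split=> [/nbhs_normP[r /= r0 rP]|[r r0 rP]].
  by exists r => // z zx; apply: rP; rewrite /ball_ /= distrC.
by apply/nbhs_normP; exists r => // z zx; apply: rP; rewrite distrC.
Qed.

Lemma near_and V (x : V) (P Q : V -> Prop) :
  (\forall z \near x, P z) -> (\forall z \near x, Q z) ->
  \forall z \near x, P z /\ Q z.
Proof. exact: filterI. Qed.

(** The increment is made along the second axis and then along the first; the mean value inequality
    bounds each leg with error e / 2, as the partial derivatives near [x] are close to their values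
    at [x]. *)
Lemma is_diff_partial (f : R * R -> R) (x : R * R) :
  (\forall z \near x, derivable f z (1, 0)) ->
  (\forall z \near x, derivable f z (0, 1)) ->
  {for x, continuous ('D_(1, 0) f)} -> {for x, continuous ('D_(0, 1) f)} ->
  is_diff x f (fun h => h.1 * 'D_(1, 0) f x + h.2 * 'D_(0, 1) f x).
Proof.
move=> d1 d2 c1 c2; apply: is_diff_eps.
- move=> a [u1 u2] [v1 v2] /=; rewrite !mulrDl -!scalerAl scalerDr.
  exact: addrACA.
- by move=> z; apply: cvgD; apply: cvgM; [exact: cvg_fst|exact: cvg_cst|exact: cvg_snd|exact: cvg_cst].
move=> e e0; have e20 : 0 < e / 2 by rewrite divr_gt0.
have [r r0 Hr] : exists2 r, 0 < r & forall z, `|z - x| < r ->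
    (derivable f z (1, 0) /\ derivable f z (0, 1)) /\
    (`|'D_(1, 0) f x - 'D_(1, 0) f z| <= e / 2 /\
     `|'D_(0, 1) f x - 'D_(0, 1) f z| <= e / 2).
  move/cvgrPdist_le : c1 => /(_ _ e20) c1; move/cvgrPdist_le : c2 => /(_ _ e20) c2.
  exact/near_norm/(near_and (near_and d1 d2))/(near_and c1 c2).
apply/near_norm; exists r => // h; rewrite subr0 => hr.
case: x Hr {d1 d2 c1 c2} => x1 x2 Hr; case: h hr => h1 h2 /=.
rewrite num_gt_max /= => /andP[h1r h2r].
have := @mvt_bound (fun t => f ((x1, x2 + h2) + t *: (1, 0)))
  (fun t => 'D_(1, 0) f ((x1, x2 + h2) + t *: (1, 0))) h1 (e / 2) ('D_(1, 0) f (x1, x2)).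
have := @mvt_bound (fun t => f ((x1, x2) + t *: (0, 1)))
  (fun t => 'D_(0, 1) f ((x1, x2) + t *: (0, 1))) h2 (e / 2) ('D_(0, 1) f (x1, x2)).
have E1 (a b t : R) : (a, b) + t *: (1, 0) = (a + t, b).
  by rewrite -[LHS]/(a + t * 1, b + t * 0) mulr1 mulr0 addr0.
have E2 (a b t : R) : (a, b) + t *: (0, 1) = (a, b + t).
  by rewrite -[LHS]/(a + t * 0, b + t * 1) mulr1 mulr0 addr0.
cbv beta; rewrite !(E1, E2) !addr0 => H2 H1.
have {}H2 : `|f (x1, x2 + h2) - f (x1, x2) - 'D_(0, 1) f (x1, x2) * h2| <= e / 2 * `|h2|.
  apply: H2 => t th; rewrite E2.
  have [] := Hr (x1, x2 + t); last first.
    move=> [_ D2] [_ B2]; split; last by rewrite distrC.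
    by apply: is_derive_line; rewrite ?E1 ?E2; exact: derivableP.
  rewrite -[_ - _]/(x1 - x1, x2 + t - x2) num_gt_max /= subrr normr0 r0.
  by rewrite addrAC subrr add0r; exact: le_lt_trans h2r.
have {}H1 : `|f (x1 + h1, x2 + h2) - f (x1, x2 + h2) - 'D_(1, 0) f (x1, x2) * h1| <= e / 2 * `|h1|.
  apply: H1 => t th; rewrite E1.
  have [] := Hr (x1 + t, x2 + h2); last first.
    move=> [D1 _] [B1 _]; split; last by rewrite distrC.
    by apply: is_derive_line; rewrite ?E1 ?E2; exact: derivableP.
  rewrite -[_ - _]/(x1 + t - x1, x2 + h2 - x2) num_gt_max /=.
  rewrite ![_ + _ - _]addrAC !subrr !add0r h2r andbT; exact: le_lt_trans h1r.
rewrite [_ + (x1, _)]addrC -[_ + (h1, _)]/(x1 + h1, x2 + h2).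
rewrite (_ : _ - _ = (f (x1 + h1, x2 + h2) - f (x1, x2 + h2) - 'D_(1, 0) f (x1, x2) * h1)
  + (f (x1, x2 + h2) - f (x1, x2) - 'D_(0, 1) f (x1, x2) * h2)); last by ring.
apply: (le_trans (ler_normD _ _)); apply: (le_trans (lerD H1 H2)).
rewrite -mulrDr (_ : e * `|(h1, h2)| = e / 2 * (`|(h1, h2)| + `|(h1, h2)|)).
  by apply: ler_wpM2l; [exact: ltW|apply: lerD; rewrite num_le_max lexx ?orbT].
by field.
Qed.

End DirectionalDerivatives.

(** * Germs of smooth maps *)

Section Germs.
Context {R : realType}.
Implicit Types U V W : normedModType R.

(* Smooth map germ: [f] is C^oo on a neighborhood of [x]. *)
Definition smg V W (x : V) (f : V -> W) : Prop :=
  exists2 D : set V, open_nbhs x D & forall n, Ck n D f.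

Lemma smg_near V W (x : V) (f : V -> W) :
  smg x f -> \forall z \near x, smg z f.
Proof.
move=> [D [oD Dx] Df]; near=> z; exists D => //; split=> //; near: z.
exact: open_nbhs_nbhs.
Unshelve. all: by end_near. Qed.

Lemma smg_eq V W (x : V) (f g : V -> W) :
  (\forall z \near x, f z = g z) -> smg x f -> smg x g.
Proof.
move=> fg [D [oD Dx] Df]; exists (D `&` [set z | f z = g z]^°).
  by split; [apply: openI => //; exact: open_interior|split].
move=> n; have oI : open (D `&` [set z | f z = g z]^°).
  by apply: openI => //; exact: open_interior.
apply: (@Ck_eq _ n _ _ _ f g oI); first by move=> y [_ /interior_subset].
by apply: Ck_sub (Df n) => y [].
Qed.

Lemma smg_continuous V W (x : V) (f : V -> W) :
  smg x f -> {for x, continuous f}.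
Proof. by move=> [D [_ Dx] Df]; exact: (Df 0%N). Qed.

Lemma smg_differentiable V W (x : V) (f : V -> W) :
  smg x f -> differentiable f x.
Proof. by move=> [D [_ Dx] Df]; have [fd _] := Df 1%N; exact: fd. Qed.

Lemma smg_derivable V W (x v : V) (f : V -> W) : smg x f -> derivable f x v.
Proof. by move=> /smg_differentiable/diff_derivable. Qed.

Lemma smg_cst V W (x : V) (a : W) : smg x (fun=> a).
Proof. by exists setT => [|n]; [split=> //; exact: openT|exact: Ck_cst]. Qed.

Lemma smg_linear V W (x : V) (f : {linear V -> W}) : continuous f -> smg x f.
Proof. by exists setT => [|n]; [split=> //; exact: openT|exact: Ck_linear]. Qed.

Lemma smg_id V (x : V) : smg x (fun z => z).
Proof. by apply: (@smg_linear _ _ x idfun) => z; exact: cvg_id. Qed.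

Lemma smg_pair V W1 W2 (x : V) (f : V -> W1) (g : V -> W2) :
  smg x f -> smg x g -> smg x (fun z => (f z, g z)).
Proof.
move=> [D [oD Dx] Df] [E [oE Ex] Eg]; exists (D `&` E).
  by split; [exact: openI|].
move=> n; apply: Ck_pair; last exact: openI.
  by apply: Ck_sub (Df n) => z [].
by apply: Ck_sub (Eg n) => z [].
Qed.

Lemma smg_comp U V W (x : U) (y : V) (f : U -> V) (g : V -> W) :
  f x = y -> smg x f -> smg y g -> smg x (fun z => g (f z)).
Proof.
move=> <- sf [E [oE Ex] Eg]; have fc := smg_continuous sf.
have Hx : \forall z \near x, E (f z).
  by apply: fc; exact: open_nbhs_nbhs.
have [D [oD Dx] Df] := sf.
have oI : open (D `&` [set z | E (f z)]^°).
  by apply: openI => //; exact: open_interior.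
exists (D `&` [set z | E (f z)]^°); first by split.
move=> n; apply: (@Ck_comp _ n _ _ _ _ E f g) => //.
  by move=> z [_ /interior_subset].
by apply: Ck_sub (Df n) => z [].
Qed.

Lemma smg_fst V W1 W2 (x : V) (f : V -> W1 * W2) : smg x f -> smg x (fun z => (f z).1).
Proof.
move=> sf; apply: (smg_comp erefl sf).
by apply: smg_linear => z; exact: cvg_fst.
Qed.

Lemma smg_snd V W1 W2 (x : V) (f : V -> W1 * W2) : smg x f -> smg x (fun z => (f z).2).
Proof.
move=> sf; apply: (smg_comp erefl sf).
by apply: smg_linear => z; exact: cvg_snd.
Qed.

Lemma smg_add V W (x : V) (f g : V -> W) :
  smg x f -> smg x g -> smg x (fun z => f z + g z).
Proof.
move=> [D [oD Dx] Df] [E [oE Ex] Eg]; exists (D `&` E).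
  by split; [exact: openI|].
move=> n; apply: Ck_addf; first exact: openI.
  by apply: Ck_sub (Df n) => z [].
by apply: Ck_sub (Eg n) => z [].
Qed.

Lemma smg_mul V (x : V) (f g : V -> R) :
  smg x f -> smg x g -> smg x (fun z => f z * g z).
Proof.
move=> [D [oD Dx] Df] [E [oE Ex] Eg]; exists (D `&` E).
  by split; [exact: openI|].
move=> n; apply: Ck_mulf; first exact: openI.
  by apply: Ck_sub (Df n) => z [].
by apply: Ck_sub (Eg n) => z [].
Qed.

Lemma smg_opp V (x : V) (f : V -> R) : smg x f -> smg x (fun z => - f z).
Proof. by move=> [D [oD Dx] Df]; exists D => // n; apply: Ck_oppf. Qed.

Lemma smg_sub V (x : V) (f g : V -> R) :
  smg x f -> smg x g -> smg x (fun z => f z - g z).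
Proof. by move=> sf /smg_opp; exact: smg_add. Qed.

Lemma smg_exp V (x : V) (f : V -> R) n : smg x f -> smg x (fun z => f z ^+ n).
Proof.
move=> sf; elim: n => [|n IH]; first exact: smg_cst.
rewrite (_ : (fun z => _) = fun z => f z * f z ^+ n); first exact: smg_mul.
by apply/funext => z; rewrite exprS.
Qed.

Lemma smg_inv V (x : V) (f : V -> R) :
  f x != 0 -> smg x f -> smg x (fun z => (f z)^-1).
Proof.
move=> fx0 sf; apply: (smg_comp erefl sf).
by exists [set z : R | z != 0]; [split=> //; exact: open_neq|exact: Ck_inv].
Qed.

Lemma smg_sqrt (x : R) : 0 < x -> @smg R R x Num.sqrt.
Proof.
by exists [set z : R | 0 < z]; [split=> //; exact: open_gt|exact: Ck_sqrt].
Qed.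

Lemma smg_tangent V W (x v : V) (f : V -> W) : smg x f -> smg (x, v) (tangent f).
Proof.
move=> [D [oD Dx] Df]; exists (D `*` [set: V]).
  by split=> //; exact: openX_setT.
by move=> n; have [] := Df n.+1.
Qed.

Lemma smg_derive V W (x v : V) (f : V -> W) : smg x f -> smg x ('D_v f).
Proof.
move=> sf; have : smg x (fun z => tangent f (z, v)).
  apply: (@smg_comp _ _ _ _ (x, v)) => //; last exact: smg_tangent.
  by apply: smg_pair; [exact: smg_id|exact: smg_cst].
apply: smg_eq; near=> z; rewrite deriveE//; apply: smg_differentiable.
by near: z; exact: smg_near.
Unshelve. all: by end_near. Qed.

Lemma smg_smooth_near V (x : V) (f : V -> R) : smg x f -> smooth_near x f.
Proof.
move=> [D [oD Dx] Df]; exists D => // vs.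
have {}Df : forall z, D z -> smg z f by move=> z Dz; exists D.
suff H z : D z -> smg z (iter_derive f vs).
  move=> x0 Dx0; have sf := H x0 Dx0.
  by split=> [|v]; [exact: smg_continuous|exact: smg_derivable].
by elim: vs z => [|v vs IH] z Dz /=; [exact: Df|exact/smg_derive/IH].
Qed.

Lemma smooth_on_derive V (D : set V) (f : V -> R) (v : V) :
  smooth_on D f -> smooth_on D ('D_v f).
Proof.
move=> fs vs x Dx; have := fs (rcons vs v) x Dx.
by rewrite /iter_derive foldr_rcons.
Qed.

Lemma smooth_on_Ck (D : set R) (f : R -> R) : open D -> smooth_on D f ->
  forall n, Ck n D f.
Proof.
move=> oD fs n; elim: n f fs => [|n IH] f fs; first by move=> x Dx; have [] := fs [::] x Dx.
apply: (@Ck_is_derive _ n D f ('D_1 f) oD); last exact/IH/smooth_on_derive.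
by move=> x Dx; apply: derivableP; have [_] := fs [::] x Dx; exact.
Qed.

(** Continuous partial derivatives give differentiability, and the tangent is then a combination of
    the partials, to which the induction hypothesis applies. The plane suffices: the only smooth
    function of several variables given from outside is the perturbation p. *)
Lemma smooth_on_Ck2 (D : set (R * R)) (f : R * R -> R) :
  open D -> smooth_on D f -> forall n, Ck n D f.
Proof.
move=> oD fs n; elim: n f fs => [|n IH] f fs; first by move=> x Dx; have [] := fs [::] x Dx.
have fd x : D x -> is_diff x f (fun h => h.1 * 'D_(1, 0) f x + h.2 * 'D_(0, 1) f x).
  move=> Dx; have nD : \forall z \near x, D z by exact: open_nbhs_nbhs.
  apply: is_diff_partial.
  - by apply: filterS nD => z Dz; have [_] := fs [::] z Dz; exact.
  - by apply: filterS nD => z Dz; have [_] := fs [::] z Dz; exact.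
  - by have [] := fs [:: (1, 0)] x Dx.
  - by have [] := fs [:: (0, 1)] x Dx.
split=> [x /fd[]//|].
have oD' : open (D `*` [set: (R * R)%type]) by exact: openX_setT.
have Cv i : Ck n (D `*` [set: (R * R)%type]) (fun p : (R * R) * (R * R) => 'D_i f p.1).
  apply: (@Ck_comp _ n _ _ _ _ D fst ('D_i f)) => //; first by move=> x [].
    exact: Ck_fst.
  exact/IH/smooth_on_derive.
have C1 : Ck n (D `*` [set: (R * R)%type]) (fun p : (R * R) * (R * R) => p.2.1).
  exact: (Ck_compT oD' (Ck_snd n _) (Ck_fst n _)).
have C2 : Ck n (D `*` [set: (R * R)%type]) (fun p : (R * R) * (R * R) => p.2.2).
  exact: (Ck_compT oD' (Ck_snd n _) (Ck_snd n _)).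
apply: (Ck_eq oD' _ (Ck_addf oD' (Ck_mulf oD' C1 (Cv _)) (Ck_mulf oD' C2 (Cv _)))).
by move=> [x v] [Dx _]; rewrite /tangent; have [_ ->] := fd x Dx.
Qed.

Lemma smooth_near_smg2 (x : R * R) (f : R * R -> R) : smooth_near x f -> smg x f.
Proof. by move=> [D [oD Dx] fs]; exists D => //; exact: smooth_on_Ck2. Qed.

End Germs.

Ltac smg := repeat first
  [ eassumption | exact: smg_cst | exact: smg_id | apply: smg_add | apply: smg_opp | apply: smg_mul
  | apply: smg_exp | apply: smg_pair | apply: smg_fst | apply: smg_snd ].

(** * Symmetry of mixed derivatives *)

Section Schwarz.
Context {R : realType}.
Implicit Types U V W : normedModType R.

Lemma smg_Ck V W (D : set V) (f : V -> W) :
  (forall x, D x -> smg x f) -> forall n, Ck n D f.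
Proof.
move=> fs n; elim: n V W D f fs => [|n IH] V W D f fs /=.
  by move=> x /fs; exact: smg_continuous.
split=> [x /fs|]; first exact: smg_differentiable.
by apply: IH => -[x v] [/= /fs fx _]; exact: smg_tangent.
Qed.

(** The mean value inequality is used twice: along [v] for ['D_u f], and then along [u] for the
    increment of [f] in the direction [v]. *)
Lemma mixed_difference V (f : V -> R) (x u v : V) : smg x f ->
  forall e : R, 0 < e -> exists2 r : R, 0 < r & forall a b : R,
    `|a| < r -> `|b| < r ->
    `|f (x + a *: u + b *: v) - f (x + a *: u) - (f (x + b *: v) - f x)
      - 'D_v ('D_u f) x * (a * b)| <= e * `|a * b|.
Proof.
move=> fx e e0.
have fuv : {for x, continuous ('D_v ('D_u f))}.
  by apply: smg_continuous; apply: smg_derive; exact: smg_derive.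
have /near_norm[d d0 Hd] : \forall z \near x, smg z f /\
    `|'D_v ('D_u f) x - 'D_v ('D_u f) z| <= e.
  apply: near_and; first exact: smg_near.
  by move/cvgrPdist_le : fuv => /(_ _ e0).
have K0 : 0 < `|u| + `|v| + 1 by rewrite ltr_wpDl// addr_ge0.
have Kn0 : `|u| + `|v| + 1 != 0 by rewrite gt_eqF.
have rp : 0 < d / (`|u| + `|v| + 1) by rewrite divr_gt0.
exists (d / (`|u| + `|v| + 1)) => //.
move=> a b ar br.
have Hin (s t : R) : `|s| <= `|a| -> `|t| <= `|b| ->
    `|(x + s *: u + t *: v) - x| < d.
  move=> sa tb; rewrite -[x + _ + _]addrA [x + _]addrC addrK.
  apply: (le_lt_trans (ler_normD _ _)); rewrite !normrZ.
  apply: (@le_lt_trans _ _ (d / (`|u| + `|v| + 1) * `|u| + d / (`|u| + `|v| + 1) * `|v|)).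
    by apply: lerD; apply: ler_wpM2r => //; apply: ltW;
      [exact: le_lt_trans ar|exact: le_lt_trans br].
  rewrite -mulrDr -[ltRHS](divfK Kn0) ltr_pM2l//.
  by rewrite ltrDl.
have key s : `|s| <= `|a| ->
    `|'D_u f (x + s *: u + b *: v) - 'D_u f (x + s *: u) - 'D_v ('D_u f) x * b| <= e * `|b|.
  move=> sa.
  have := @mvt_bound R (fun t => 'D_u f (x + s *: u + t *: v))
    (fun t => 'D_v ('D_u f) (x + s *: u + t *: v)) b e ('D_v ('D_u f) x).
  cbv beta; rewrite scale0r addr0; apply=> t tb.
  have [sz ez] := Hd _ (Hin _ _ sa tb).
  split; last by rewrite distrC.
  apply: (@is_derive_line _ V ('D_u f) (x + s *: u) v t).
  by apply: derivableP; apply: smg_derivable; exact: smg_derive.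
have := @mvt_bound R (fun s => f (x + s *: u + b *: v) - f (x + s *: u))
    (fun s => 'D_u f (x + s *: u + b *: v) - 'D_u f (x + s *: u)) a (e * `|b|)
    ('D_v ('D_u f) x * b).
cbv beta; rewrite scale0r addr0 -!mulrA [b * a]mulrC -normrM [b * a]mulrC.
apply=> s sa; split; last by exact: key.
apply: is_deriveB.
  have E (w : V) : x + w + b *: v = x + b *: v + w by rewrite addrAC.
  rewrite (_ : (fun s0 => _) = (fun s0 => f (x + b *: v + s0 *: u))); last first.
    by apply/funext => s0; rewrite E.
  rewrite E; apply: (@is_derive_line _ V f (x + b *: v) u s).
  apply: derivableP; apply: smg_derivable.
  by rewrite -E; have [] := Hd _ (Hin _ _ sa (lexx _)).
apply: (@is_derive_line _ V f x u s); apply: derivableP; apply: smg_derivable.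
have := Hin s 0 sa; rewrite scale0r addr0 normr0 => /(_ (normr_ge0 _)).
by move=> /Hd[].
Qed.

(** The second difference is symmetric in the two directions, so at equal steps a both mixed
    derivatives, multiplied by a^2, are within (e / 2) a^2 of the same number. *)
Lemma schwarz V (f : V -> R) (x u v : V) : smg x f ->
  'D_v ('D_u f) x = 'D_u ('D_v f) x.
Proof.
move=> fx; apply/eqP; rewrite -subr_eq0 -normr_le0; apply/ler_addgt0Pl => e e0.
rewrite addr0; have e2 : 0 < e / 2 by rewrite divr_gt0.
have [r r0 Hr] := mixed_difference u v fx e2.
have [r' r'0 Hr'] := mixed_difference v u fx e2.
pose a := Num.min r r' / 2.
have a0 : 0 < a by rewrite divr_gt0// lt_min r0.
have ar : `|a| < r /\ `|a| < r'.
  by rewrite gtr0_norm// /a; split; rewrite ltr_pdivrMr// gt_min;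
    [rewrite (_ : r < r * 2)|rewrite (_ : r' < r' * 2) ?orbT]; rewrite ?ltr_pMr ?ltr1n.
have := Hr a a ar.1 ar.1; have := Hr' a a ar.2 ar.2.
rewrite [x + a *: v + _]addrAC.
move: ('D_u ('D_v f) x) ('D_v ('D_u f) x) => P Q.
move: (f _) (f _) (f _) (f x) => A B C F H1 H2.
have aa : 0 < a * a by exact: mulr_gt0.
rewrite -(ler_pM2r aa) -{1}(gtr0_norm aa) -normrM.
rewrite (_ : (Q - P) * (a * a) = (C - B - (A - F) - P * (a * a))
  - (C - A - (B - F) - Q * (a * a))); last by ring.
rewrite (le_trans (ler_normB _ _))// (le_trans (lerD H1 H2))//.
by rewrite gtr0_norm// -mulrDl -splitr.
Qed.

End Schwarz.

(** * Division by the first coordinate *)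

Section Taylor.
Context {R : realType}.
Implicit Types U V W : normedModType R.

Lemma is_derive_monomial (a : R) n (t : R) :
  is_derive t (1 : R) (fun s : R => a * s ^+ n.+1 / n.+1`!%:R) (a * t ^+ n / n`!%:R).
Proof.
have H : is_derive t (1 : R) (fun s : R => s ^+ n.+1) (n.+1%:R * t ^+ n).
  by split; [exact: exprn_derivable|rewrite exp_derive /= [_ *: 1]mulr1].
have := is_deriveZ (a / n.+1`!%:R) H.
rewrite (_ : _ \*: _ = fun s : R => a * s ^+ n.+1 / n.+1`!%:R); last first.
  by apply/funext => s /=; rewrite [LHS]mulrAC.
move=> {}H; apply: is_derive_eq H _.
rewrite -[_ *: _]/((a / n.+1`!%:R) * (n.+1%:R * t ^+ n)) factS natrM.
have n0 : n.+1%:R != 0 :> R by rewrite pnatr_eq0.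
have f0 : n`!%:R != 0 :> R by rewrite pnatr_eq0 -lt0n fact_gt0.
by move: (n.+1%:R : R) (n`!%:R : R) n0 f0 => u w u0 w0; field; rewrite u0 w0.
Qed.

(** Descent from the n-th derivative, one mean value inequality per order. The case m = 0, l = 0
    serves the continuity of quotients by a power, the case m = 1 their differentiability. *)
Lemma taylor_bound n m (g : nat -> R -> R) (s a l e : R) : 0 <= e ->
  (forall j (t : R), (j < n)%N -> `|t| <= `|s| -> is_derive t (1 : R) (g j) (g j.+1 t)) ->
  (forall j, (j < n)%N -> g j 0 = 0) ->
  (forall t, `|t| <= `|s| -> `|g n t - a - l * t| <= e * `|t| ^+ m) ->
  `|g 0%N s - a * s ^+ n / n`!%:R - l * s ^+ n.+1 / n.+1`!%:R| <= e * `|s| ^+ (n + m).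
Proof.
move=> e0; elim: n g s => [|n IH] g s gd g0 gn.
  by rewrite !fact0 expr0 expr1 !divr1 mulr1 add0n; exact: gn.
have key t : `|t| <= `|s| ->
    `|g 1%N t - a * t ^+ n / n`!%:R - l * t ^+ n.+1 / n.+1`!%:R| <= e * `|s| ^+ (n + m).
  move=> ts; apply: (@le_trans _ _ (e * `|t| ^+ (n + m))).
    apply: (IH (fun j => g j.+1)) => [j u jn ut|j jn|u ut].
    - by apply: gd => //; exact: le_trans ts.
    - exact: g0.
    - by apply: gn; exact: le_trans ts.
  by rewrite ler_wpM2l// lerXn2r.
have := @mvt_bound R
  (fun t => g 0%N t - a * t ^+ n.+1 / n.+1`!%:R - l * t ^+ n.+2 / n.+2`!%:R)
  (fun t => g 1%N t - a * t ^+ n / n`!%:R - l * t ^+ n.+1 / n.+1`!%:R)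
  s (e * `|s| ^+ (n + m)) 0.
cbv beta; rewrite g0// ![0 ^+ _.+1]expr0n /= !mulr0 !mul0r !subr0.
rewrite (_ : e * `|s| ^+ (n + m) * `|s| = e * `|s| ^+ (n.+1 + m)); last first.
  by rewrite addSn exprS mulrAC mulrA.
apply=> t ts.
split; last by rewrite subr0; exact: key.
apply: is_deriveB; last exact: is_derive_monomial.
apply: is_deriveB; last exact: is_derive_monomial.
exact: gd.
Qed.

End Taylor.

Section DivisionDefs.
Context {R : realType}.
Implicit Types U V W : normedModType R.

Definition slab V (r : R) (E : set V) : set (R * V) :=
  [set p | `|p.1| < r /\ E p.2].

Definition ds V (h : R * V -> R) : R * V -> R := 'D_((1 : R), (0 : V)) h.

Definition vanish V n (E : set V) (h : R * V -> R) : Prop :=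
  forall j x, (j < n)%N -> E x -> iter j (@ds V) h (0, x) = 0.

(* [h p / p.1 ^+ n], continued to [p.1 = 0] by the Taylor coefficient. *)
Definition tquot V n (h : R * V -> R) (p : R * V) : R :=
  if p.1 == 0 then iter n (@ds V) h (0, p.2) / n`!%:R else h p / p.1 ^+ n.

(* The direction of differentiation is kept as a second parameter, so that an
   induction on the order stays within functions on [R * _]. *)
Definition dlift V (h : R * V -> R) (q : R * (V * V)) : R :=
  'D_((0 : R), q.2.2) h (q.1, q.2.1).

(* The first derivative of [tquot n h] is [tquot n.+1 (euler n h)]. *)
Definition euler V n (h : R * V -> R) (p : R * V) : R :=
  p.1 * ds h p - n%:R * h p.

End DivisionDefs.

Section Slabs.
Context {R : realType}.
Implicit Types U V W : normedModType R.
Variable r : R.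
Hypothesis r0 : 0 < r.

Lemma open_slab V (E : set V) : open E -> open (slab r E).
Proof.
rewrite !openE => oE [s x] [/= sr /oE Ex].
have oB : open [set t : R | `|t| < r].
  rewrite (_ : [set t : R | `|t| < r] = ball (0 : R) r); first exact: ball_open.
  by apply/seteqP; split => t; rewrite -ball_normE /= sub0r normrN.
by exists ([set t : R | `|t| < r], E) => //; split=> //; exact: open_nbhs_nbhs.
Qed.

Lemma near_slab V (E : set V) (p : R * V) : open E -> slab r E p ->
  \forall q \near p, slab r E q.
Proof. by move=> oE Dp; apply: open_nbhs_nbhs; split=> //; exact: open_slab. Qed.

Lemma slab0 V (E : set V) (x : V) : E x -> slab r E (0, x).
Proof. by move=> Ex; split => //=; rewrite normr0. Qed.

Lemma is_derive_ds V (f : R * V -> R) (s : R) (x : V) : smg (s, x) f ->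
  is_derive s (1 : R) (fun t : R => f (t, x)) (ds f (s, x)).
Proof.
move=> fs; have E (t : R) : (t, x) = (0, x) + t *: ((1 : R), (0 : V)).
  by rewrite -[RHS]/(0 + t * 1, x + t *: (0 : V)) mulr1 add0r scaler0 addr0.
rewrite (_ : (fun t => _) = fun t => f ((0, x) + t *: ((1 : R), (0 : V)))); last first.
  by apply/funext => t; rewrite E.
apply: (@is_derive_line _ (R * V)%type f (0, x)); rewrite -E.
by apply: derivableP; exact: smg_derivable.
Qed.

Lemma is_derive_fst V (p v : R * V) : is_derive p v (fst : R * V -> R) v.1.
Proof.
have fc : continuous (fst : R * V -> R) by move=> q; exact: cvg_fst.
have fd : differentiable (fst : R * V -> R) p by exact: linear_differentiable.
split; first exact: diff_derivable.
by rewrite deriveE// diff_lin.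
Qed.

Lemma ds_eq V (D : set (R * V)) (f g : R * V -> R) : open D ->
  (forall p, D p -> f p = g p) -> forall p, D p -> ds f p = ds g p.
Proof.
move=> oD fg p Dp; apply: near_eq_derive.
have : \forall z \near p, D z by exact: open_nbhs_nbhs.
by apply: filterS => z /fg.
Qed.

Lemma smg_iter_ds V (D : set (R * V)) (h : R * V -> R) j :
  (forall p, D p -> smg p h) -> forall p, D p -> smg p (iter j (@ds R V) h).
Proof. by move=> hs p Dp; elim: j => [|j IH] /=; [exact: hs|exact: smg_derive]. Qed.

Lemma iter_ds_euler V (D : set (R * V)) (h : R * V -> R) n j : open D ->
  (forall p, D p -> smg p h) -> forall p, D p ->
  iter j (@ds R V) (euler n h) p =
  p.1 * iter j.+1 (@ds R V) h p + (j%:R - n%:R) * iter j (@ds R V) h p.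
Proof.
move=> oD hs; elim: j => [|j IH] p Dp; first by rewrite /= /euler sub0r mulNr.
rewrite -[LHS]/(ds (iter j (@ds R V) (euler n h)) p) (ds_eq oD IH)//.
have H1 : is_derive p ((1 : R), (0 : V)) (iter j.+1 (@ds R V) h) (iter j.+2 (@ds R V) h p).
  by apply: derivableP; apply: smg_derivable; exact: smg_iter_ds Dp.
have H0 : is_derive p ((1 : R), (0 : V)) (iter j (@ds R V) h) (iter j.+1 (@ds R V) h p).
  by apply: derivableP; apply: smg_derivable; exact: smg_iter_ds Dp.
have F := is_derive_fst p ((1 : R), (0 : V)).
have Fs := is_deriveM F H1.
have Hs := is_deriveD Fs (is_deriveZ (j%:R - n%:R) H0).
have -> : ds (fun q => q.1 * iter j.+1 (@ds R V) h q
    + (j%:R - n%:R) * iter j (@ds R V) h q) p = _ := @derive_val _ _ _ _ _ _ _ Hs.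
rewrite -[_ *: _ + _ *: _]/(p.1 * iter j.+2 (@ds R V) h p + iter j.+1 (@ds R V) h p * 1).
rewrite -[_ *: _]/((j%:R - n%:R) * iter j.+1 (@ds R V) h p) -natr1.
move: (iter j.+1 _ h p) (iter j.+2 _ h p) => A B; ring.
Qed.

End Slabs.

Section Vanishing.
Context {R : realType}.
Implicit Types U V W : normedModType R.
Variable r : R.
Hypothesis r0 : 0 < r.

Lemma smg_dlift V (h : R * V -> R) (q : R * (V * V)) :
  smg (q.1, q.2.1) h -> smg q (dlift h).
Proof.
case: q => s [x xi] /= hs.
have Hc : smg (s, (x, xi)) (fun q : R * (V * V) => (q.1, q.2.1)).
  apply: smg_pair; first by smg.
  by smg.
have : smg (s, (x, xi)) (fun q : R * (V * V) =>
    tangent h ((q.1, q.2.1), ((0 : R), q.2.2))).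
  apply: (@smg_comp _ _ _ _ _ ((s, x), ((0 : R), xi))) => //.
    apply: smg_pair => //; apply: smg_pair; first exact: smg_cst.
    by smg.
  exact: smg_tangent.
apply: smg_eq; have /near_norm[d d0 Hd] := smg_near hs.
apply/near_norm; exists d => // -[t [y eta]]; rewrite num_gt_max /=.
move=> /andP[ts]; rewrite num_gt_max /= => /andP[yx _].
rewrite /tangent /dlift /= deriveE//; apply: smg_differentiable; apply: Hd.
by rewrite num_gt_max /= ts.
Qed.

Lemma ds_dlift V (h : R * V -> R) (s : R) (x xi : V) : smg (s, x) h ->
  ds (dlift h) (s, (x, xi)) = dlift (ds h) (s, (x, xi)).
Proof.
move=> hs; rewrite -[RHS]/('D_((0 : R), xi) ('D_((1 : R), (0 : V)) h) (s, x)).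
rewrite (schwarz _ _ hs).
have E (t : R) : t^-1 *: ((dlift h \o shift (s, (x, xi))) (t *: ((1 : R), ((0 : V), (0 : V)))) - dlift h (s, (x, xi)))
    = t^-1 *: (('D_((0 : R), xi) h \o shift (s, x)) (t *: ((1 : R), (0 : V))) - 'D_((0 : R), xi) h (s, x)).
  rewrite /= -[_ *: (1, (0, 0)) + _]/(t * 1 + s, (t *: (0 : V) + x, t *: (0 : V) + xi)).
  rewrite -[_ *: (1, 0) + _]/(t * 1 + s, (t *: (0 : V) + x)).
  by rewrite /dlift /= scaler0 !add0r.
by rewrite /ds /derive (funext E).
Qed.

Lemma iter_ds_dlift V (E : set V) (h : R * V -> R) j : open E ->
  (forall p, slab r E p -> smg p h) -> forall q, slab r (E `*` setT) q ->
  iter j (@ds R (V * V)%type) (dlift h) q = dlift (iter j (@ds R V) h) q.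
Proof.
move=> oE hs; have oE' : open (E `*` [set: V]) by exact: openX_setT.
elim: j => [//|j IH] q Dq.
rewrite -[LHS]/(ds (iter j (@ds R (V * V)%type) (dlift h)) q).
have oD := @open_slab R r (V * V)%type (E `*` setT) oE'.
rewrite (@ds_eq R (V * V)%type _ _ _ oD IH q Dq).
case: q Dq => s [x xi] [/= sr [/= Ex _]].
by apply: ds_dlift; apply: (smg_iter_ds _ hs).
Qed.

(** Derivatives in the first coordinate commute with those along [V], and the former vanish
    identically on the slice over the open set [E]. *)
Lemma vanish_dlift V (E : set V) (h : R * V -> R) n : open E ->
  (forall p, slab r E p -> smg p h) ->
  vanish n E h -> vanish n (E `*` [set: V]) (dlift h).
Proof.
move=> oE hs h0 j [x xi] jn [/= Ex _].
rewrite (iter_ds_dlift _ oE hs); last by split; [rewrite /= normr0|].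
rewrite /dlift /=; have Hj := smg_iter_ds j hs (slab0 r0 Ex).
have : \forall t \near (0 : R), E (x + t *: xi).
  have c : {for (0 : R), continuous (fun t : R => x + t *: xi)}.
    by apply: cvgD; [exact: cvg_cst|apply: cvgZr_tmp; exact: cvg_id].
  by apply: c; rewrite scale0r addr0; exact: open_nbhs_nbhs.
move=> nE.
have H : is_derive (0 : R) (1 : R) (fun t : R => iter j (@ds R V) h ((0, x) + t *: ((0 : R), xi)))
    ('D_(0, xi) (iter j (@ds R V) h) (0, x)).
  apply: is_derive_line; rewrite scale0r addr0.
  by apply: derivableP; exact: smg_derivable.
have H0 : is_derive (0 : R) (1 : R) (fun t : R => iter j (@ds R V) h ((0, x) + t *: ((0 : R), xi))) 0.
  apply: near_eq_is_derive (is_derive_cst (0 : R) (0 : R) (1 : R)).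
  apply: filterS nE => t Et.
  rewrite -[_ + _]/(0 + t * 0, x + t *: xi) mulr0 addr0; apply/esym.
  exact: h0.
by case: H => _ <-; case: H0.
Qed.

Lemma smg_euler V (h : R * V -> R) n p : smg p h -> smg p (euler n h).
Proof.
move=> hs; apply: smg_sub; apply: smg_mul => //.
- by smg.
- exact: smg_derive.
- exact: smg_cst.
Qed.

(** On the slice the j-th derivative of [euler n h] is (j - n) times that of [h]: the hypothesis
    disposes of j < n, the factor of j = n. *)
Lemma vanish_euler V (E : set V) (h : R * V -> R) n : open E ->
  (forall p, slab r E p -> smg p h) ->
  vanish n E h -> vanish n.+1 E (euler n h).
Proof.
move=> oE hs h0 j x; rewrite ltnS leq_eqVlt => jn Ex.
rewrite (iter_ds_euler _ _ (open_slab (r:=r) oE) hs); last exact: slab0.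
rewrite mul0r add0r; case/predU1P : jn => [->|jn]; first by rewrite subrr mul0r.
by rewrite h0// mulr0.
Qed.

Lemma smg_tquot V (h : R * V -> R) n p : p.1 != 0 -> smg p h -> smg p (tquot n h).
Proof.
move=> p0 hs.
have : smg p (fun q => h q * (q.1 ^+ n)^-1).
  apply: smg_mul => //; apply: smg_inv; first by rewrite expf_neq0.
  by apply: smg_exp; smg.
apply: smg_eq; have c : {for p, continuous (fst : R * V -> R)} by exact: cvg_fst.
have : \forall q \near p, q.1 != 0.
  by apply: (c [set s : R | s != 0]); apply: open_nbhs_nbhs; split=> //; exact: open_neq.
by apply: filterS => q /negPf q0; rewrite /tquot q0.
Qed.

Lemma near_slab_ds V (E : set V) (h : R * V -> R) n x1 : open E -> E x1 ->
  (forall p, slab r E p -> smg p h) -> forall e : R, 0 < e ->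
  exists2 d : R, 0 < d & forall s x, `|s| < d -> `|x - x1| < d ->
    slab r E (s, x) /\
    `|iter n (@ds R V) h (s, x) - iter n (@ds R V) h (0, x1)| <= e.
Proof.
move=> oE Ex1 hs e e0; have D0 := slab0 r0 Ex1.
have /cvgrPdist_le/(_ _ e0) c := smg_continuous (smg_iter_ds n hs D0).
have /near_norm[d d0 Hd] := near_and (near_slab oE D0) c.
exists d => // s x sd xd; have [] := Hd (s, x).
  by rewrite num_gt_max /= subr0 sd.
by move=> ? ?; split=> //; rewrite distrC.
Qed.

Lemma tquot_bound V (E : set V) (h : R * V -> R) n x1 : open E -> E x1 ->
  (forall p, slab r E p -> smg p h) -> vanish n E h ->
  forall e : R, 0 < e -> \forall p \near ((0 : R), x1),
    `|tquot n h p - iter n (@ds R V) h (0, x1) / n`!%:R| <= e.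
Proof.
move=> oE Ex1 hs h0 e e0; have [d d0 Hd] := near_slab_ds n oE Ex1 hs e0.
apply/near_norm; exists d => // -[s x]; rewrite num_gt_max /= subr0 => /andP[sd xd].
have d0' : `|0 : R| < d by rewrite normr0.
have f0 : 0 < n`!%:R :> R by rewrite ltr0n fact_gt0.
have f1 : 1 <= n`!%:R :> R by rewrite ler1n fact_gt0.
rewrite /tquot /=; have [_|s0] := eqVneq s 0.
  rewrite -mulrBl normrM normfV (gtr0_norm f0) ler_pdivrMr//.
  have [_ H] := Hd 0 x d0' xd.
  by apply: (le_trans H); rewrite ler_peMr// ltW.
have H : `|h (s, x) - iter n (@ds R V) h (0, x1) * s ^+ n / n`!%:R
    - 0 * s ^+ n.+1 / n.+1`!%:R| <= e * `|s| ^+ (n + 0).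
  have e0' := ltW e0.
  apply: (taylor_bound (g := fun j t => iter j (@ds R V) h (t, x))) => //.
  - move=> j t jn ts; apply: is_derive_ds; apply: (smg_iter_ds _ hs).
    by have [] := Hd t x (le_lt_trans ts sd) xd.
  - move=> j jn; apply: h0 => //.
    by have [[]] := Hd 0 x d0' xd.
  - move=> t ts; rewrite mul0r subr0 expr0 mulr1.
    by have [] := Hd t x (le_lt_trans ts sd) xd.
have sn0 : 0 < `|s| ^+ n by rewrite exprn_gt0// normr_gt0.
move: H; rewrite !mul0r subr0 addn0 -ler_pdivrMr// -normrX -normf_div.
congr (`|_| <= _); rewrite mulrBl; congr (_ - _).
have := expf_neq0 n s0; move: (s ^+ n) f0 => u /lt0r_neq0 w0 u0.
by field; rewrite u0 w0.
Qed.

(** The expansion starts from the moving point (0, p.2), so only the increment in the first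
    coordinate is estimated; the increment along [V] is that of the smooth function
    [iter n (@ds R V) h]. *)
Lemma tquot_bound1 V (E : set V) (h : R * V -> R) n x1 : open E -> E x1 ->
  (forall p, slab r E p -> smg p h) -> vanish n E h ->
  forall e : R, 0 < e -> \forall p \near ((0 : R), x1),
    `|tquot n h p - iter n (@ds R V) h (0, p.2) / n`!%:R
      - p.1 * (iter n.+1 (@ds R V) h (0, x1) / n.+1`!%:R)| <= e * `|p.1|.
Proof.
move=> oE Ex1 hs h0 e e0; have [d d0 Hd] := near_slab_ds n.+1 oE Ex1 hs e0.
apply/near_norm; exists d => // -[s x]; rewrite num_gt_max /= subr0 => /andP[sd xd].
have d0' : `|0 : R| < d by rewrite normr0.
have f0 : n`!%:R != 0 :> R by rewrite pnatr_eq0 -lt0n fact_gt0.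
rewrite /tquot /=; have [->|s0] := eqVneq s 0.
  by rewrite subrr mul0r subr0 normr0 mulr0.
have H : `|h (s, x) - iter n (@ds R V) h (0, x) * s ^+ n / n`!%:R
    - ds (iter n (@ds R V) h) (0, x1) * s ^+ n.+1 / n.+1`!%:R| <= e * `|s| ^+ (n + 1).
  have e0' := ltW e0.
  apply: (taylor_bound (g := fun j t => iter j (@ds R V) h (t, x))) => //.
  - move=> j t jn ts; apply: is_derive_ds; apply: (smg_iter_ds _ hs).
    by have [] := Hd t x (le_lt_trans ts sd) xd.
  - move=> j jn; apply: h0 => //.
    by have [[]] := Hd 0 x d0' xd.
  - move=> t ts; rewrite expr1.
    apply: (mvt_bound (g := fun t => iter n (@ds R V) h (t, x))
       (dg := fun t => ds (iter n (@ds R V) h) (t, x))) => t' t't.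
    have [D1 D2] := Hd t' x (le_lt_trans (le_trans t't ts) sd) xd.
    by split=> //; apply: is_derive_ds; exact: (smg_iter_ds _ hs).
have sn0 : 0 < `|s| ^+ n by rewrite exprn_gt0// normr_gt0.
have eE : e * `|s| ^+ (n + 1) = e * `|s| * `|s| ^+ n by rewrite addn1 exprS mulrA.
move: H; rewrite eE -ler_pdivrMr// -normrX -normf_div.
congr (`|_| <= _); rewrite !mulrBl exprSr.
have F0 : n.+1`!%:R != 0 :> R by rewrite pnatr_eq0 -lt0n fact_gt0.
have := expf_neq0 n s0; move: (h _) (s ^+ n) f0 F0 => hh u f0 F0 u0.
move: (iter _ _ _ _) (ds _ _) (n`!%:R : R) (n.+1`!%:R : R) f0 F0 => A B F G F0 G0.
by field; rewrite u0 F0 G0.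
Qed.

Lemma tquot_continuous V (E : set V) (h : R * V -> R) n : open E ->
  (forall p, slab r E p -> smg p h) -> vanish n E h ->
  forall p, slab r E p -> {for p, continuous (tquot n h)}.
Proof.
move=> oE hs h0 [s x] Dp; have [s0|s0] := eqVneq s 0; last first.
  by apply: smg_continuous; apply: smg_tquot => //; exact: hs.
subst s; apply/cvgrPdist_le => e e0; case: Dp => /= _ Ex.
have := tquot_bound oE Ex hs h0 e0; apply: filterS => p; rewrite distrC.
by rewrite {2}/tquot /= eqxx.
Qed.

End Vanishing.

Section Quotients.
Context {R : realType}.
Implicit Types U V W : normedModType R.
Variable r : R.
Hypothesis r0 : 0 < r.

Lemma derive_split V (h : R * V -> R) (p v : R * V) : differentiable h p ->
  'D_v h p = v.1 * ds h p + 'D_((0 : R), v.2) h p.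
Proof.
move=> hd; rewrite /ds !deriveE//.
rewrite -[v.1 * _]/(v.1 *: _) -linearZ -linearD; congr ('d h p _).
case: v => s x; rewrite -[RHS]/(s * 1 + 0, s *: (0 : V) + x).
by rewrite mulr1 scaler0 addr0 add0r.
Qed.

Lemma tquot_derive V (h : R * V -> R) n (p v : R * V) : p.1 != 0 -> smg p h ->
  'D_v (tquot n h) p =
  v.1 * tquot n.+1 (euler n h) p + tquot n (dlift h) (p.1, (p.2, v.2)).
Proof.
case: p v => s x [t y] /= s0 hs.
have c : {for (s, x), continuous (fst : R * V -> R)} by exact: cvg_fst.
have nq : \forall q \near (s, x), q.1 != 0.
  by apply: (c [set s : R | s != 0]); apply: open_nbhs_nbhs; split=> //; exact: open_neq.
have Fd := is_derive_fst (s, x) (t, y).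
have Xd : is_derive (s, x) (t, y) (fun q : R * V => q.1 ^+ n) (n%:R * s ^+ n.-1 * t).
  have [Xd XE] := is_deriveX n Fd.
  rewrite (_ : (fun q => _) = (fst : R * V -> R) ^+ n); first by split.
  by apply/funext => q; rewrite fctE.
have s0n := expf_neq0 n s0.
have Vd : is_derive (s, x) (t, y) (fun q : R * V => (q.1 ^+ n)^-1)
    (- (s ^+ n) ^- 2 * (n%:R * s ^+ n.-1 * t)).
  by case: Xd => Xd XE; split; [exact: derivableV|rewrite deriveV// XE].
have Hd : is_derive (s, x) (t, y) h ('D_(t, y) h (s, x)).
  by apply: derivableP; exact: smg_derivable.
have [_ ME] := is_deriveM Hd Vd.
rewrite -(near_eq_derive _ (f := h * (fun q => (q.1 ^+ n)^-1))); last first.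
  by apply: filterS nq => q /negPf q0; rewrite /tquot q0.
rewrite ME derive_split; last exact: smg_differentiable.
rewrite /tquot /= (negPf s0) /euler /dlift /=.
rewrite -![_ *: _]/(_ * _).
move: (h _) (ds _ _) ('D_(_) h _) => A B C.
case: n s0n {nq Xd Vd ME} => [|n] s0n.
  by rewrite /= expr0 expr1; field.
rewrite /= !exprS; rewrite exprS in s0n.
have := expf_neq0 n s0; move: (s ^+ n) (n.+1%:R : R) => u m u0.
by field; rewrite u0 s0.
Qed.

(** Off the slice this is the quotient rule. On it, [tquot_bound1] is combined with the differential
    of the Taylor coefficient. The functions [euler n h] and [dlift h] whose quotients appear
    satisfy hypotheses of the same kind as [h]. *)
Lemma tquot_is_diff V (E : set V) (h : R * V -> R) n p : open E ->
  (forall p, slab r E p -> smg p h) -> vanish n E h -> slab r E p ->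
  is_diff p (tquot n h)
   (fun v => v.1 * tquot n.+1 (euler n h) p + tquot n (dlift h) (p.1, (p.2, v.2))).
Proof.
move=> oE hs h0 Dp; have [s0|s0] := eqVneq p.1 0; last first.
  have qs := smg_tquot n s0 (hs _ Dp).
  apply: DiffDef; first exact: smg_differentiable.
  apply/funext => v; rewrite -deriveE; last exact: smg_differentiable.
  by apply: tquot_derive => //; exact: hs.
case: p s0 Dp => s x /= -> [_ /= Ex] {s}.
have D0 := slab0 r0 Ex.
pose hn := iter n (@ds R V) h.
have hns : smg (0, x) hn by exact: (smg_iter_ds _ hs).
have dfE (v : R * V) : v.1 * tquot n.+1 (euler n h) (0, x) + tquot n (dlift h) (0, (x, v.2))
   = v.1 * (ds hn (0, x) / n.+1`!%:R) + 'd hn (0, x) ((0 : R), v.2) / n`!%:R.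
  rewrite /tquot /= eqxx -[ds _ _]/(iter n.+1 (@ds R V) (euler n h) (0, x)).
  rewrite (iter_ds_euler _ _ (open_slab (r:=r) oE) hs D0) mul0r add0r.
  rewrite -natr1 addrAC subrr add0r mul1r.
  rewrite (iter_ds_dlift _ oE hs); last by split; [rewrite /= normr0|].
  by rewrite /dlift /= deriveE//; exact: smg_differentiable.
rewrite (funext dfE).
apply: is_diff_eps.
- move=> a [s1 x1] [s2 x2] /=.
  have -> : 'd hn (0, x) ((0 : R), a *: x1 + x2)
      = a * 'd hn (0, x) (0, x1) + 'd hn (0, x) (0, x2).
    rewrite -[a * _]/(a *: _) -linearZ -linearD; congr ('d hn _ _).
    by rewrite -[RHS]/(a * 0 + 0, a *: x1 + x2) mulr0 addr0.
  rewrite -![_ *: _]/(_ * _); ring.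
- move=> v; apply: smg_continuous; apply: smg_add; apply: smg_mul.
  + by smg.
  + exact: smg_cst.
  + apply: (@smg_comp _ _ _ _ _ _ (fun w : R * V => ((0 : R), w.2)) ('d hn (0, x)) erefl).
      by apply: smg_pair; [exact: smg_cst|smg].
    by apply: smg_linear; apply: diff_continuous; exact: smg_differentiable.
  + exact: smg_cst.
move=> e e0; have e2 : 0 < e / 2 by rewrite divr_gt0.
have /near_norm[d d0 Hd] := tquot_bound1 r0 oE Ex hs h0 e2.
have /near_norm[d' d'0 Hd'] := diff_eps (smg_differentiable hns) e2.
apply/near_norm; exists (Num.min d d'); first by rewrite lt_min d0.
move=> [t y]; rewrite subr0 lt_min => /andP[tyd tyd'] /=.
have d2 : `|(t, x + y) - (0, x)| < d.
  by rewrite -[_ - _]/(t - 0, x + y - x) subr0 [x + y]addrC addrK.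
have d1 : `|((0 : R), y) - 0| < d'.
  apply: le_lt_trans tyd'; rewrite subr0 !prod_normE /= normr0.
  by rewrite ge_max le_max normr_ge0 le_max lexx orbT.
have := Hd _ d2; have := Hd' _ d1.
rewrite -[(0, y) + _]/(0 + 0, y + x) -[(t, y) + _]/(t + 0, y + x) !addr0 /=.
rewrite [x + y]addrC.
have -> : tquot n h (0, x) = hn (0, x) / n`!%:R by rewrite /tquot eqxx.
have fn : 1 <= n`!%:R :> R by rewrite ler1n fact_gt0.
have fn0 : 0 < n`!%:R :> R by rewrite ltr0n fact_gt0.
move=> B1 B2.
have nt : `|t| <= `|(t, y)| by rewrite prod_normE le_max lexx.
have ny : `|((0 : R), y)| <= `|(t, y)|.
  by rewrite !prod_normE /= normr0 ge_max le_max normr_ge0 le_max lexx orbT.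
(* The error splits into that of the expansion in the first coordinate and that of the Taylor
   coefficient along [V], each taking half of e. *)
rewrite (_ : _ - _ = (tquot n h (t, y + x) - hn (0, y + x) / n`!%:R
    - t * (ds hn (0, x) / n.+1`!%:R))
  + (hn (0, y + x) - hn (0, x) - 'd hn (0, x) (0, y)) / n`!%:R); last first.
  move: (tquot _ _ _) (hn _) (hn _) (ds _ _) ('d hn _ _) => A B C D E0; ring.
apply: (le_trans (ler_normD _ _)).
have -> : e * `|(t, y)| = e / 2 * `|(t, y)| + e / 2 * `|(t, y)|.
  by rewrite -mulrDl -splitr.
apply: lerD.
  by apply: (le_trans B2); rewrite ler_wpM2l// ltW.
rewrite normrM normfV (gtr0_norm fn0) ler_pdivrMr//.
apply: (le_trans B1); rewrite -[leRHS]mulrA ler_wpM2l//; first exact: ltW.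
by apply: (le_trans ny); rewrite ler_peMr.
Qed.

(** The tangent of a quotient is made of two quotients, one over [V] with n.+1 and one over [V * V]
    with n; hence the induction on k for all [V], [h] and n at once. *)
Lemma tquot_Ck k V (E : set V) (h : R * V -> R) n : open E ->
  (forall p, slab r E p -> smg p h) -> vanish n E h ->
  Ck k (slab r E) (tquot n h).
Proof.
elim: k V E h n => [|k IH] V E h n oE hs h0.
  exact: (tquot_continuous r0 oE hs h0).
have dq p Dp := @tquot_is_diff V E h n p oE hs h0 Dp.
split=> [p /dq[]//|].
have oD := @open_slab R r _ _ oE.
have oE' : open (E `*` [set: V]) by exact: openX_setT.
have oD' : open (slab r E `*` [set: (R * V)%type]) by exact: openX_setT.
have C1 : Ck k (slab r E `*` [set: (R * V)%type])
    (fun q : (R * V) * (R * V) => tquot n.+1 (euler n h) q.1).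
  apply: (@Ck_comp _ k _ _ _ _ (slab r E) fst (tquot n.+1 (euler n h))) => //.
  - by move=> q [].
  - exact: Ck_fst.
  - apply: IH => //; last exact: (vanish_euler r0).
    by move=> p Dp; apply: smg_euler; exact: hs.
have C2 : Ck k (slab r E `*` [set: (R * V)%type])
    (fun q : (R * V) * (R * V) => tquot n (dlift h) (q.1.1, (q.1.2, q.2.2))).
  apply: (@Ck_comp _ k _ _ _ _ (slab r (E `*` [set: V]))
     (fun q : (R * V) * (R * V) => (q.1.1, (q.1.2, q.2.2))) (tquot n (dlift h))) => //.
  - by move=> [[s x] [t y]] [[/= sr Ex] _].
  - have F := Ck_fst k (slab r E `*` [set: (R * V)%type]).
    have S := Ck_snd k (slab r E `*` [set: (R * V)%type]).
    apply: Ck_pair => //; first exact: (Ck_compT oD' F (Ck_fst k _)).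
    apply: Ck_pair => //; first exact: (Ck_compT oD' F (Ck_snd k _)).
    exact: (Ck_compT oD' S (Ck_snd k _)).
  - apply: IH => //; last exact: (vanish_dlift r0).
    by move=> q [? [? ?]]; apply: smg_dlift; exact: hs.
have C3 : Ck k (slab r E `*` [set: (R * V)%type])
    (fun q : (R * V) * (R * V) => q.2.1).
  exact: (Ck_compT oD' (Ck_snd k _) (Ck_fst k _)).
apply: (Ck_eq oD' _ (Ck_addf oD' (Ck_mulf oD' C3 C1) C2)).
by move=> [p v] [Dp _]; rewrite /tangent; have [_ ->] := dq p Dp.
Qed.

End Quotients.

Section DivisionGerm.
Context {R : realType}.
Implicit Types U V W : normedModType R.

(** Hadamard's lemma with parameters in an arbitrary normed space. *)
Lemma smg_division V (h : R * V -> R) (x0 : V) : smg (0, x0) h ->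
  (\forall x \near x0, h (0, x) = 0) ->
  exists q : R * V -> R, [/\ smg (0, x0) q,
    (\forall p \near ((0 : R), x0), h p = p.1 * q p) &
    (\forall x \near x0, q (0, x) = ds h (0, x))].
Proof.
move=> hs h0; have /near_norm[r r0 Hr] := smg_near hs.
have /near_norm[r' r'0 Hr'] := h0.
pose E := [set x : V | `|x - x0| < Num.min r r'].
have m0 : 0 < Num.min r r' by rewrite lt_min r0.
have oE : open E.
  rewrite (_ : E = ball x0 (Num.min r r')); first exact: ball_open.
  by apply/seteqP; split=> x; rewrite -ball_normE /E /= distrC.
have Ex0 : E x0 by rewrite /E /= subrr normr0.
have hs' p : slab r E p -> smg p h.
  case: p => s x [/= sr]; rewrite /E /= lt_min => /andP[xr _].
  by apply: Hr; rewrite num_gt_max /= subr0 sr.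
have v1 : vanish 1 E h.
  move=> [|//] x _; rewrite /E /= lt_min => /andP[_ xr]; exact: Hr'.
exists (tquot 1 h); split.
- exists (slab r E); last by move=> n; exact: (tquot_Ck r0).
  by split; [exact: open_slab|exact: slab0].
- have := near_slab oE (slab0 r0 Ex0); apply: filterS => -[s x] [/= sr Ex].
  rewrite /tquot /=; have [->|s0] := eqVneq s 0; last by rewrite expr1 mulrC divfK.
  by rewrite mul0r; exact: (v1 0%N x isT Ex).
- have : \forall x \near x0, E x by exact: open_nbhs_nbhs.
  by apply: filterS => x Ex; rewrite /tquot eqxx /= divr1.
Qed.

End DivisionGerm.

(** * Even functions are smooth functions of the square *)

Section Flat.
Context {R : realType}.

Lemma is_derive_eps (f : R -> R) (x d : R) :
  (forall e : R, 0 < e ->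
    \forall h \near (0 : R), `|f (h + x) - f x - d * h| <= e * `|h|) ->
  is_derive x (1 : R) f d.
Proof.
move=> H; have [fd fE] : is_diff x f (fun h : R => d * h).
  apply: is_diff_eps => //.
  - by move=> a u v /=; rewrite mulrDr -[a *: _]/(a * _) mulrCA.
  - by move=> z; apply: cvgM; [exact: cvg_cst|exact: cvg_id].
split; first exact: diff_derivable.
by rewrite deriveE// fE mulr1.
Qed.

(* [eflat 0] is exp(-1/x); the factors x^-m arise in its derivatives. *)
Definition eflat m (x : R) : R := if 0 < x then x^-1 ^+ m * expR (- x^-1) else 0.

(** For y = 1/x > 0 the exponential of y dominates its Taylor term y^(m+1) / (m+1)!. *)
Lemma eflat_le m (x : R) : `|eflat m x| <= m.+1`!%:R * `|x|.
Proof.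
rewrite /eflat; case: ifPn => x0; last by rewrite normr0 mulr_ge0.
have y0 : 0 < x^-1 by rewrite invr_gt0.
rewrite !gtr0_norm//; last by rewrite mulr_gt0// ?exprn_gt0// expR_gt0.
rewrite expRN ler_pdivrMr ?expR_gt0//.
have F0 : m.+1`!%:R != 0 :> R by rewrite pnatr_eq0 -lt0n fact_gt0.
have -> : x^-1 ^+ m = m.+1`!%:R * x * (x^-1 ^+ m.+1 / m.+1`!%:R).
  rewrite exprS; move: (x^-1 ^+ m) (m.+1`!%:R : R) F0 => u F F0.
  by field; rewrite F0 gt_eqF.
apply: ler_wpM2l; first by rewrite mulr_ge0// ltW.
by apply: le_trans (expR_ge1Dxn m (ltW y0)); rewrite lerDr.
Qed.

Lemma eflatS m (x : R) : eflat m x = x * eflat m.+1 x.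
Proof.
rewrite /eflat; case: ifPn => x0; last by rewrite mulr0.
by rewrite exprS mulrA mulrA divff ?mul1r// gt_eqF.
Qed.

(** At 0 the shift [eflatS] turns the linear bound [eflat_le] into a quadratic one, so the
    derivative is 0; elsewhere this is calculus. *)
Lemma is_derive_eflat m (x : R) :
  is_derive x (1 : R) (eflat m) (eflat m.+2 x - m%:R * eflat m.+1 x).
Proof.
have [x0|x0|x0] := ltgtP x 0.
- rewrite /eflat ltNge (ltW x0) /= mulr0 subr0.
  apply: near_eq_is_derive (is_derive_cst (0 : R) x (1 : R)).
  have : \forall y \near x, y < 0 by apply: open_nbhs_nbhs; split=> //; exact: open_lt.
  by apply: filterS => y y0; rewrite ltNge (ltW y0).
- have Id : is_derive x (1 : R) (fun y : R => y^-1) (- (x^-1 * x^-1)).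
    have := is_deriveV (lt0r_neq0 x0) (is_derive_id x (1 : R)).
    by rewrite [_ *: _]mulr1 expr2 invfM.
  have Xd : is_derive x (1 : R) (fun y : R => y^-1 ^+ m) (m%:R * x^-1 ^+ m.-1 * - (x^-1 * x^-1)).
    have [Xd XE] := is_deriveX m Id.
    rewrite (_ : (fun y : R => _) = (fun y : R => y^-1) ^+ m) //.
    by apply/funext => y; rewrite fctE.
  have Ed : is_derive x (1 : R) (fun y : R => expR (- y^-1)) ((x^-1 * x^-1) * expR (- x^-1)).
    have Nd : is_derive x (1 : R) (fun y : R => - y^-1) (x^-1 * x^-1).
      by have := is_deriveN Id; rewrite opprK.
    have [D1 D2] := @is_derive1_comp _ expR (fun y : R => - y^-1) x _ _ (is_derive_expR (- x^-1)) Nd.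
    split => //; rewrite [LHS]D2 mulrC //.
  have [Md ME] := is_deriveM Xd Ed.
  have : is_derive x (1 : R) (fun y : R => y^-1 ^+ m * expR (- y^-1))
      (eflat m.+2 x - m%:R * eflat m.+1 x).
    split => //; rewrite [LHS]ME /eflat x0 -![_ *: _]/(_ * _).
    case: m {Xd Md ME} => [|m] /=; first by rewrite expr0 expr2 expr1; ring.
    rewrite !exprS; move: (x^-1 ^+ m) (x^-1) (expR _) => u y e; ring.
  apply: near_eq_is_derive.
  have : \forall y \near x, 0 < y by apply: open_nbhs_nbhs; split=> //; exact: open_gt.
  by apply: filterS => y y0; rewrite /eflat y0.
- rewrite x0 /eflat ltxx mulr0 subr0; apply: is_derive_eps => e e0.
  have C0 : 0 < m.+2`!%:R :> R by rewrite ltr0n fact_gt0.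
  apply/near_norm; exists (e / m.+2`!%:R); first by rewrite divr_gt0.
  move=> h; rewrite subr0 addr0 mul0r !subr0 => he.
  rewrite ltxx subr0; suff : `|eflat m h| <= e * `|h| by [].
  rewrite (eflatS m h) normrM mulrC ler_wpM2r//.
  apply: (le_trans (eflat_le _ _)); rewrite mulrC -ler_pdivlMr//; exact: ltW.
Qed.

Lemma eflat_Ck n m : Ck n setT (eflat m).
Proof.
elim: n m => [|n IH] m.
  move=> x _; apply/differentiable_continuous/derivable1_diffP.
  by have [] := is_derive_eflat m x.
apply: (Ck_is_derive openT (fun x _ => is_derive_eflat m x)).
apply: Ck_addf => //; first exact: openT.
apply: Ck_oppf; first exact: openT.
by apply: Ck_mulf => //; [exact: openT|exact: Ck_cst].
Qed.

Lemma smg_eflat m x : smg x (eflat m).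
Proof.
by exists setT => [|n]; [split=> //; exact: openT|exact: eflat_Ck].
Qed.

Lemma eflat_gt0 m x : 0 < x -> 0 < eflat m x.
Proof.
by move=> x0; rewrite /eflat x0 mulr_gt0// ?expR_gt0// exprn_gt0// invr_gt0.
Qed.

End Flat.

(** * Coefficients of Seeley's extension *)

Section SeeleyPoly.
Context {R : realType}.

Definition coef_norm (p : {poly R}) (z : R) : R := \sum_(k < size p) `|p`_k| * z ^+ k.

Lemma coef_normE (p : {poly R}) (z : R) N : (size p <= N)%N ->
  coef_norm p z = \sum_(k < N) `|p`_k| * z ^+ k.
Proof.
move=> pN; rewrite /coef_norm -(subnKC pN) big_split_ord /= [X in _ = _ + X]big1 ?addr0//.
by move=> i _; rewrite nth_default ?leq_addr// normr0 mul0r.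
Qed.

Lemma coef_norm_ge0 (p : {poly R}) z : 0 <= z -> 0 <= coef_norm p z.
Proof. by move=> z0; apply: sumr_ge0 => i _; rewrite mulr_ge0// exprn_ge0. Qed.

Lemma coef_norm_le (p : {poly R}) z z' : 0 <= z -> z <= z' ->
  coef_norm p z <= coef_norm p z'.
Proof.
move=> z0 zz; apply: ler_sum => i _; rewrite ler_wpM2l// lerXn2r//.
by rewrite nnegrE (le_trans z0).
Qed.

Lemma coef_norm_shift (c : R) (q : {poly R}) N z :
  coef_norm (c *: ('X^N * q)) z = `|c| * z ^+ N * coef_norm q z.
Proof.
rewrite (@coef_normE _ _ (N + size q)); last first.
  apply: (leq_trans (size_scale_leq _ _)); apply: (leq_trans (size_polyMleq _ _)).
  by rewrite size_polyXn.
rewrite big_split_ord /= big1 ?add0r; last first.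
  by move=> i _; rewrite coefZ coefXnM /= ltn_ord mulr0 normr0 mul0r.
rewrite /coef_norm mulr_sumr; apply: eq_bigr => i _.
rewrite coefZ coefXnM /= ltnNge leq_addr /= addKn exprD normrM; ring.
Qed.

(** The product of the X - 4^j, j < m, vanishes at the earlier nodes. A further factor X^M clears
    the low coefficients and, once the value at 4^m is normalised to d, divides the weighted norms
    at the earlier nodes by at least 4^M, because 4^n / 4^m <= 1/4; a large M makes them as small as
    desired. *)
Lemma seeley_step (d : R) m : exists p : {poly R},
  [/\ p.[4 ^+ m] = d, (forall n, (n < m)%N -> p.[4 ^+ n] = 0),
      (forall k, (k < m)%N -> p`_k = 0) &
      (forall n, (n < m)%N -> coef_norm p (4 ^+ n) <= 2 ^- m)].
Proof.
pose q : {poly R} := \prod_(j < m) ('X - (4 ^+ j)%:P).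
have qE z : q.[z] = \prod_(j < m) (z - 4 ^+ j).
  by rewrite horner_prod; apply: eq_bigr => j _; rewrite hornerXsubC.
have q0 n : (n < m)%N -> q.[4 ^+ n] = 0.
  by move=> nm; rewrite qE (bigD1 (Ordinal nm)) //= subrr mul0r.
have qm : q.[4 ^+ m] != 0.
  rewrite qE; apply/prodf_neq0 => j _; rewrite subr_eq0 gt_eqF//.
  by rewrite ltr_eXn2l ?ltr1n.
pose K := `|d| / `|q.[4 ^+ m]| * coef_norm q (4 ^+ m).
have K0 : 0 <= K by rewrite mulr_ge0// ?divr_ge0// coef_norm_ge0// exprn_ge0.
(* The summand m makes the coefficients below m vanish; the other one ensures that 4^M is at least K
   2^m. *)
pose M := (m + Num.bound (K * 2 ^+ m))%N.
have KM : K * 2 ^+ m <= 4 ^+ M.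
  apply: (@le_trans _ _ ((Num.bound (K * 2 ^+ m))%:R)).
    by apply/ltW/archi_boundP; rewrite mulr_ge0// exprn_ge0.
  apply: (@le_trans _ _ (4 ^+ (Num.bound (K * 2 ^+ m)))).
    by move: (Num.bound _) => N; rewrite -[4 ^+ N]natrX ler_nat ltnW// ltn_expl.
  by rewrite ler_eXn2l ?ltr1n// leq_addl.
have z0 : 0 < (4 ^+ m) ^+ M :> R by rewrite !exprn_gt0.
exists ((d / ((4 ^+ m) ^+ M * q.[4 ^+ m])) *: ('X^M * q)); split.
- rewrite hornerZ hornerM hornerXn divfK//.
  by rewrite mulf_neq0// gt_eqF.
- by move=> n nm; rewrite hornerZ hornerM (q0 n nm) mulr0 mulr0.
- by move=> k km; rewrite coefZ coefXnM (leq_trans km (leq_addr _ _)) mulr0.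
move=> n nm; rewrite coef_norm_shift normrM normfV normrM (gtr0_norm z0).
have w0 : 0 < `|q.[4 ^+ m]| by rewrite normr_gt0.
have B1 : (4 ^+ n) ^+ M * 4 ^+ M <= (4 ^+ m) ^+ M :> R.
  rewrite -exprMn -exprSr lerXn2r// ?nnegrE ?exprn_ge0//.
  by rewrite ler_eXn2l ?ltr1n.
have B2 : coef_norm q (4 ^+ n) <= coef_norm q (4 ^+ m).
  by rewrite coef_norm_le// ?exprn_ge0// ler_eXn2l ?ltr1n// ltnW.
have M0 : 0 < 4 ^+ M :> R by rewrite exprn_gt0.
have t0 : 0 < 2 ^+ m :> R by rewrite exprn_gt0.
apply: (@le_trans _ _ (K / 4 ^+ M)); last first.
  by rewrite ler_pdivrMr// mulrC ler_pdivlMr.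
rewrite /K ler_pdivlMr//.
have -> : `|d| / ((4 ^+ m) ^+ M * `|q.[4 ^+ m]|) * (4 ^+ n) ^+ M * coef_norm q (4 ^+ n) * 4 ^+ M
  = `|d| / `|q.[4 ^+ m]| * (coef_norm q (4 ^+ n) * ((4 ^+ n) ^+ M * 4 ^+ M / (4 ^+ m) ^+ M)).
  move: (coef_norm _ _) ((4 ^+ n) ^+ M) (4 ^+ M) ((4 ^+ m) ^+ M) z0 `|q.[_]| w0 `|d|.
  by move=> A B C D D0 F F0 G; field; rewrite !gt_eqF.
apply: ler_wpM2l; first by rewrite divr_ge0.
have B3 : (4 ^+ n) ^+ M * 4 ^+ M / (4 ^+ m) ^+ M <= 1 :> R.
  by rewrite ler_pdivrMr// mul1r.
apply: le_trans B2; rewrite -[leRHS]mulr1 ler_wpM2l//.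
by apply: coef_norm_ge0; rewrite exprn_ge0.
Qed.

(* Coefficients for Seeley's extension: the sums [\sum_k (s m)`_k * 4 ^ (n k)]
   equal (-1)^n for every n < m, while the sequence [s] converges absolutely even
   with the weights 4 ^ (n k). *)
Lemma seeley_poly : exists s : nat -> {poly R},
  (forall m n, (n < m)%N -> (s m).[4 ^+ n] = (-1) ^+ n) /\
  (forall m, (forall k, (k < m)%N -> (s m.+1 - s m)`_k = 0) /\
    (forall n, (n < m)%N -> coef_norm (s m.+1 - s m) (4 ^+ n) <= 2 ^- m)).
Proof.
have [f fP] := choice (fun dm : R * nat => seeley_step dm.1 dm.2).
pose s := fix s m := if m is k.+1 then s k + f ((-1) ^+ k - (s k).[4 ^+ k], k) else 0.
have sS m : s m.+1 - s m = f ((-1) ^+ m - (s m).[4 ^+ m], m).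
  by rewrite [s m.+1]/= addrC addKr.
exists s; split; last first.
  by move=> m; rewrite sS; have [_ _ ? ?] := fP ((-1) ^+ m - (s m).[4 ^+ m], m).
elim=> [//|m IH] n; rewrite ltnS leq_eqVlt => nm.
have [H1 H2 _ _] := fP ((-1) ^+ m - (s m).[4 ^+ m], m).
rewrite [s m.+1]/= hornerD; case/predU1P : nm => [->|nm].
  by rewrite H1 /= addrC subrK.
by rewrite H2// addr0 IH.
Qed.

End SeeleyPoly.

(** * Dilated sums and their limits *)

Section Dilation.
Context {R : realType}.
Implicit Types U V W : normedModType R.

(** Tube lemma over the compact segment [-K, K]: the bound is a second variable of the covering
    filter, tending to infinity, so compactness selects one bound together with one
    neighbourhood. *)
Lemma tube_bound V (f : R * V -> R) (x0 : V) (K : R) :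
  (forall s : R, `|s| <= K -> {for (s, x0), continuous f}) ->
  exists2 B : R, 0 <= B &
    \forall x \near x0, forall s : R, `|s| <= K -> `|f (s, x)| <= B.
Proof.
move=> fc; have /compact_near_coveringP cK := @segment_compact R (- K) K.
have [s Ks|[A C] [/= nA nC] AC] := cK (V * R)%type
    (filter_prod (nbhs x0) (pinfty_nbhs R)) (fun i s => `|f (s, i.1)| <= i.2) _.
  have {}Ks : `|s| <= K by move: Ks; rewrite /= in_itv /= -ler_norml.
  have /cvgrPdist_le/(_ _ ltr01)/near_norm[d d0 Hd] := fc s Ks.
  have nS : \forall s' \near s, `|s' - s| < d by apply/near_norm; exists d.
  have nX : \forall x \near x0, `|x - x0| < d by apply/near_norm; exists d.
  exists ([set s' : R | `|s' - s| < d], [set i : V * R | `|i.1 - x0| < d /\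
      `|f (s, x0)| + 1 <= i.2]) => /=.
    split; first exact: nS.
    exists ([set x : V | `|x - x0| < d], [set b : R | `|f (s, x0)| + 1 <= b]) => /=.
      by split; [exact: nX|exact: nbhs_pinfty_ge].
    by move=> [x b] [/= ? ?].
  move=> [s' [x b]] [/= sd [xd]]; apply: le_trans.
  rewrite -lerBlDl (le_trans (lerB_dist _ _))// distrC; apply: Hd.
  by rewrite num_gt_max /= sd.
have [B [BC B0]] : exists B, C B /\ 0 <= B.
  have nC0 : \forall B \near +oo, C B /\ 0 <= B.
    by apply: filterI; [exact: nC|exact: nbhs_pinfty_ge].
  by have [B ?] := filter_ex nC0; exists B.
exists B => //; apply: filterS nA => x Ax s Ks.
by apply: (AC (x, B)) => //=; rewrite in_itv /= -ler_norml.
Qed.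

(** As a function of t^2, the term v(2^k t, x) is dilated by 4^k; the weight (4^n)^k is the one
    acquired by its n-th derivative in t^2. *)
Definition dilop V (p : {poly R}) n (v : R * V -> R) (q : R * V) : R :=
  \sum_(k < size p) p`_k * (4 ^+ n) ^+ k * v (2 ^+ k * q.1, q.2).

Lemma dilopE V (p : {poly R}) n (v : R * V -> R) q N : (size p <= N)%N ->
  dilop p n v q = \sum_(k < N) p`_k * (4 ^+ n) ^+ k * v (2 ^+ k * q.1, q.2).
Proof.
move=> pN; rewrite /dilop -(subnKC pN) big_split_ord /= [X in _ = _ + X]big1 ?addr0//.
by move=> i _; rewrite nth_default ?leq_addr// !mul0r.
Qed.

Lemma dilopD V (p p' : {poly R}) n (v : R * V -> R) q :
  dilop (p + p') n v q = dilop p n v q + dilop p' n v q.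
Proof.
pose N := maxn (size (p + p')) (maxn (size p) (size p')).
rewrite !(@dilopE _ _ _ _ _ N) ?leq_max ?leqnn ?orbT// -big_split /=.
by apply: eq_bigr => i _; rewrite coefD !mulrDl.
Qed.

Lemma dilop_cst V (p : {poly R}) n (c : R) (q : R * V) :
  dilop p n (fun=> c) q = p.[4 ^+ n] * c.
Proof. by rewrite horner_coef mulr_suml. Qed.

Lemma dilop_bound V (p : {poly R}) n (v : R * V -> R) q B :
  (forall k, (k < size p)%N -> `|v (2 ^+ k * q.1, q.2)| <= B) ->
  `|dilop p n v q| <= coef_norm p (4 ^+ n) * B.
Proof.
move=> vB; rewrite /coef_norm mulr_suml; apply: le_trans (ler_norm_sum _ _ _) _.
apply: ler_sum => k _.
have z0 : 0 <= (4 ^+ n) ^+ k :> R by rewrite !exprn_ge0.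
by rewrite !normrM (ger0_norm z0) ler_wpM2l ?mulr_ge0// vB.
Qed.

(** One Taylor step at t = 0: the factor (2^k t)^2 = 4^k t^2 raises the weight from n to n.+1. *)
Lemma dilop_shift V (p : {poly R}) n (v u : R * V -> R) c q :
  (forall k, (k < size p)%N -> v (2 ^+ k * q.1, q.2) = c + (2 ^+ k * q.1) ^+ 2 * u (2 ^+ k * q.1, q.2)) ->
  dilop p n v q = p.[4 ^+ n] * c + q.1 ^+ 2 * dilop p n.+1 u q.
Proof.
move=> vE; rewrite -(dilop_cst p n c q) /dilop mulr_sumr -big_split /=.
apply: eq_bigr => k _; rewrite vE// mulrDr; congr (_ + _).
have E : (2 ^+ k) ^+ 2 = 4 ^+ k :> R by rewrite exprAC expr2 -natrM.
by rewrite [(2 ^+ k * _) ^+ 2]exprMn E [4 ^+ n.+1]exprS exprMn; ring.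
Qed.

End Dilation.

Section DilatedSums.
Context {R : realType}.
Implicit Types U V W : normedModType R.
Variable s : nat -> {poly R}.
Hypothesis s_val : forall m n, (n < m)%N -> (s m).[4 ^+ n] = (-1) ^+ n.
Hypothesis s_step : forall m, (forall k, (k < m)%N -> (s m.+1 - s m)`_k = 0) /\
    (forall n, (n < m)%N -> coef_norm (s m.+1 - s m) (4 ^+ n) <= 2 ^- m).
Variable K : R.
Hypothesis K0 : 0 < K.

(** Passing from [s j] to [s j.+1] changes the sum by at most B 2^-j; the bound is the geometric sum
    of these changes. *)
Lemma dilop_tail V n (v : R * V -> R) q B m0 m : (n < m0)%N -> (m0 <= m)%N ->
  0 <= B -> (forall t, `|v (t, q.2)| <= B) ->
  `|dilop (s m) n v q - dilop (s m0) n v q| <= B * 2 * (2 ^- m0 - 2 ^- m).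
Proof.
move=> nm0 /subnK <- B0 vB; elim: (m - m0)%N => [|j IH].
  by rewrite add0n !subrr normr0 mulr0.
rewrite addSn -[s _.+1](subrK (s (j + m0)%N)) dilopD -addrA.
apply: (le_trans (ler_normD _ _)).
have [_ /(_ n)] := s_step (j + m0); rewrite (leq_trans nm0 (leq_addl _ _)).
move=> /(_ isT) H.
have D : `|dilop (s (j + m0).+1 - s (j + m0)%N) n v q| <= 2 ^- (j + m0) * B.
  apply: le_trans (ler_wpM2r B0 H); apply: dilop_bound => k _; exact: vB.
apply: (le_trans (lerD D IH)).
have t0 : 2 ^+ (j + m0) != 0 :> R by rewrite expf_neq0.
rewrite exprS le_eqVlt; apply/orP; left; apply/eqP.
move: (2 ^+ (j + m0)) t0 (2 ^- m0) => u u0 w.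
by field.
Qed.

(** Beyond m0 the tail is uniformly small, as [v] is bounded on the whole line. What remains is a
    finite sum: for t near 0 all its arguments 2^k t are near 0, where [v] is close to v(0, x0), and
    the coefficients with weights (4^n)^k add up to (-1)^n. *)
Lemma dilop_cvg V n (v : R * V -> R) x0 B : 0 <= B ->
  (\forall x \near x0, forall t, `|v (t, x)| <= B) ->
  {for (0, x0), continuous v} ->
  forall e : R, 0 < e -> exists m0, \forall p \near ((0 : R), x0), forall m,
    (m0 <= m)%N -> `|(-1) ^+ n * dilop (s m) n v p - v (0, x0)| <= e.
Proof.
move=> B0 vB vc e e0; have e2 : 0 < e / 2 by rewrite divr_gt0.
(* m0 exceeds n, as the value of [s m0] at 4^n requires, and brings the tail bound 2 B 2^-m0 below e
   / 2, by 2^m0 >= m0. *)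
pose m0 := maxn n.+1 (Num.bound (2 * B * 2 / e)).
have nm0 : (n < m0)%N by rewrite leq_max leqnn.
have Bm0 : B * 2 * 2 ^- m0 <= e / 2.
  have b0 : 0 <= 2 * B * 2 / e by rewrite divr_ge0 ?mulr_ge0// ltW.
  rewrite ler_pdivrMr ?exprn_gt0// -ler_pdivrMl//.
  rewrite (_ : (e / 2)^-1 * (B * 2) = 2 * B * 2 / e); last by field; rewrite gt_eqF.
  apply: (le_trans (ltW (archi_boundP b0))).
  apply: (@le_trans _ _ (m0%:R)); first by rewrite ler_nat leq_maxr.
  by rewrite -[2 ^+ m0]natrX ler_nat ltnW// ltn_expl.
exists m0.
pose c := coef_norm (s m0) (4 ^+ n) + 1.
have c0 : 0 < c by rewrite ltr_wpDl// coef_norm_ge0// exprn_ge0.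
have e2c : 0 < e / 2 / c by rewrite divr_gt0.
move/cvgrPdist_le : vc => /(_ _ e2c)/near_norm[d d0 Hd].
move: vB => /near_norm[d' d'0 Hd'].
(* N bounds the dilation exponents of the finite sum, so |t| < d / 2^N keeps all its arguments
   within d. *)
pose N := size (s m0).
have N0 : 0 < 2 ^+ N :> R by rewrite exprn_gt0.
apply/near_norm; exists (Num.min d' (d / 2 ^+ N)).
  by rewrite lt_min d'0 divr_gt0.
move=> [t x] tx m m0m.
have [td xd] : `|t| < d / 2 ^+ N /\ `|x - x0| < Num.min d' (d / 2 ^+ N).
  by move: tx; rewrite num_gt_max /= subr0 lt_min => /andP[/andP[_ ->] ->].
have xd' : `|x - x0| < d' by apply: lt_le_trans xd _; rewrite ge_min lexx.
have xdd : `|x - x0| < d.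
  apply: lt_le_trans xd _; rewrite ge_min; apply/orP; right.
  by rewrite ler_pdivrMr// ler_peMr ?(ltW d0)// exprn_ege1// ler1n.
have H1 := @dilop_tail V n v (t, x) B m0 m nm0 m0m B0 (Hd' x xd').
have H2 : `|dilop (s m0) n (fun q => v q - v (0, x0)) (t, x)| <= coef_norm (s m0) (4 ^+ n) * (e / 2 / c).
  apply: dilop_bound => k kN; rewrite distrC; apply: Hd.
  rewrite num_gt_max /= subr0 xdd andbT normrM ger0_norm ?exprn_ge0//.
  apply: (@le_lt_trans _ _ (2 ^+ N * `|t|)).
    by rewrite ler_wpM2r// ler_eXn2l ?ltr1n// ltnW.
  by rewrite mulrC -ltr_pdivlMr.
have H3 : dilop (s m0) n (fun q => v q - v (0, x0)) (t, x) =
    dilop (s m0) n v (t, x) - (-1) ^+ n * v (0, x0).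
  rewrite -(s_val nm0) -(dilop_cst _ _ _ (t, x)) /dilop -sumrB.
  by apply: eq_bigr => k _; rewrite mulrBr.
have H4 : coef_norm (s m0) (4 ^+ n) * (e / 2 / c) <= e / 2.
  by rewrite mulrCA ler_piMr ?(ltW e2)// ler_pdivrMr// mul1r lerDl.
have -> : (-1) ^+ n * dilop (s m) n v (t, x) - v (0, x0) =
  (-1) ^+ n * ((dilop (s m) n v (t, x) - dilop (s m0) n v (t, x))
   + (dilop (s m0) n v (t, x) - (-1) ^+ n * v (0, x0))).
  rewrite [in RHS]addrA subrK mulrBr mulrA -exprMn mulrNN mulr1 expr1n mul1r //.
rewrite normrM normrX normrN1 expr1n mul1r [leRHS]splitr.
apply: (le_trans (ler_normD _ _)); apply: lerD; last by rewrite -H3 (le_trans H2).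
apply: (le_trans H1); apply: le_trans Bm0; rewrite ler_wpM2l ?mulr_ge0//.
by rewrite lerBlDr lerDl invr_ge0 exprn_ge0.
Qed.

End DilatedSums.

Section EvenDerivative.
Context {R : realType}.
Implicit Types U V W : normedModType R.

Lemma ds_even V (v : R * V -> R) (t : R) (x : V) : smg (t, x) v -> smg (- t, x) v ->
  (forall t, v (- t, x) = v (t, x)) -> ds v (- t, x) = - ds v (t, x).
Proof.
move=> s1 s2 ve; have [_ <-] := is_derive_ds s1.
have [_] := @is_derive1_comp _ (fun t => v (t, x)) (fun t => - t) t _ _
  (is_derive_ds s2) (is_deriveNid t 1).
rewrite (_ : _ \o _ = fun t => v (t, x)); last by apply/funext => u /=; rewrite ve.
by move=> ->; rewrite mulrN1 opprK.
Qed.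

Lemma derive_comp_fst V (v : R * V -> R) (h : R -> R) (dh t tau : R) (x xi : V) :
  is_derive t (1 : R) h dh -> smg (h t, x) v ->
  'D_(tau, xi) (fun p : R * V => v (h p.1, p.2)) (t, x) =
    tau * dh * ds v (h t, x) + dlift v (h t, (x, xi)).
Proof.
move=> [hd hE] vs; have vd := smg_differentiable vs.
have hd' : differentiable h t by apply/derivable1_diffP.
have fc : continuous (fst : R * V -> R) by move=> q; exact: cvg_fst.
have sc : continuous (snd : R * V -> V) by move=> q; exact: cvg_snd.
have fd : differentiable (fst : R * V -> R) (t, x) by exact: linear_differentiable.
have sd : differentiable (snd : R * V -> V) (t, x) by exact: linear_differentiable.
have h1d : differentiable (h \o (fst : R * V -> R)) (t, x) by exact: differentiable_comp.
have pd : differentiable (fun p : R * V => ((h \o fst) p, p.2)) (t, x).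
  exact: differentiable_pair.
have cd : differentiable (v \o (fun p : R * V => ((h \o fst) p, p.2))) (t, x).
  exact: differentiable_comp.
rewrite -[fun p => _]/(v \o (fun p : R * V => ((h \o fst) p, p.2))).
rewrite deriveE// (diff_comp pd vd) /= (diff_pair h1d sd) /= -deriveE//.
rewrite derive_split//= (diff_comp fd hd') /= !diff_lin//=.
by rewrite deriv1E//= derive1E hE.
Qed.

End EvenDerivative.

(** * Seeley's extension across zero *)

Section SeeleyExtension.
Context {R : realType}.
Implicit Types U V W : normedModType R.
Variable s : nat -> {poly R}.
Hypothesis s_val : forall m n, (n < m)%N -> (s m).[4 ^+ n] = (-1) ^+ n.
Hypothesis s_step : forall m, (forall k, (k < m)%N -> (s m.+1 - s m)`_k = 0) /\
    (forall n, (n < m)%N -> coef_norm (s m.+1 - s m) (4 ^+ n) <= 2 ^- m).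
Variable K : R.
Hypothesis K0 : 0 < K.

(** This class is stable under [half_quot] and [dlift], the two operations through which [wext] is
    differentiated. *)
Definition even_cutoff V (E : set V) (v : R * V -> R) : Prop :=
  [/\ (forall p, E p.2 -> smg p v), (forall p, E p.2 -> K < `|p.1| -> v p = 0) &
      (forall t x, E x -> v (- t, x) = v (t, x))].

(** The derivative of [v] with respect to the square of its first coordinate, continued to 0. *)
Definition half_quot V (v : R * V -> R) (p : R * V) : R := tquot 1 (ds v) p / 2.

(* For [v] even in its first coordinate, [wext 0 v (t, x)] extends v (sqrt t, x) to
   t < 0 by \sum_k s_k v (2^k sqrt (- t), x); the sum is finite because [v] vanishes
   beyond [K]. Differentiating n times in t multiplies the k-th term by (- 4^k)^n. *)
Definition wext V n (v : R * V -> R) (p : R * V) : R :=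
  if 0 <= p.1 then v (Num.sqrt p.1, p.2)
  else (-1) ^+ n * dilop (s (Num.bound (K / Num.sqrt (- p.1)))) n v (Num.sqrt (- p.1), p.2).

Lemma near_outside V (E : set V) (t : R) (x : V) : open E -> E x -> K < `|t| ->
  \forall p \near (t, x), E p.2 /\ K < `|p.1|.
Proof.
move=> oE Ex Kt; have /near_norm[d d0 Hd] : \forall y \near x, E y.
  exact: open_nbhs_nbhs.
apply/near_norm; exists (Num.min d (`|t| - K)); first by rewrite lt_min d0 subr_gt0.
move=> [t' x']; rewrite num_gt_max /= !lt_min => /andP[/andP[_ tt'] /andP[xx' _]].
split; first exact: Hd.
have := lerB_dist t t'; rewrite distrC; move: tt'; rewrite distrC.
move: `|t| `|t'| `|t - t'| => a b c; lra.
Qed.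

Lemma even_cutoff_ds0 V (E : set V) v x : even_cutoff E v -> E x -> ds v (0, x) = 0.
Proof.
move=> [vs _ ve] Ex; have v0 : smg (0, x) v by exact: vs.
have := @ds_even R V v 0 x v0; rewrite oppr0 => /(_ v0 (fun t => ve t x Ex)).
by move/eqP; rewrite -addr_eq0 -mulr2n mulrn_eq0 /= => /eqP.
Qed.

(** The derivative of an even function is odd, so it vanishes at t = 0 and its quotient by t is
    smooth and again even. *)
Lemma even_cutoff_half V (E : set V) v : open E -> even_cutoff E v ->
  even_cutoff E (half_quot v).
Proof.
move=> oE vc; have [vs v0 ve] := vc.
have dvs p : E p.2 -> smg p (ds v) by move=> /vs; exact: smg_derive.
split.
- move=> [t x] /= Ex; apply: smg_mul; last exact: smg_cst.
  have r0 : 0 < `|t| + 1 by rewrite ltr_wpDl.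
  exists (slab (`|t| + 1) E).
    by split; [exact: open_slab|split => //=; rewrite ltrDl].
  move=> n; apply: (tquot_Ck r0) => //; first by move=> p [_ /dvs].
  by move=> [|//] y _ Ey; exact: even_cutoff_ds0 vc Ey.
- move=> [t x] /= Ex Kt; rewrite /half_quot /tquot /=.
  have /negPf -> : t != 0 by rewrite -normr_gt0 (lt_trans K0).
  rewrite (_ : ds v (t, x) = 0) ?mul0r//.
  rewrite -[RHS](derive_cst (0 : R) (t, x) ((1 : R), (0 : V))).
  apply: near_eq_derive; have := near_outside oE Ex Kt.
  by apply: filterS => p [? ?]; exact: v0.
- move=> t x Ex; rewrite /half_quot /tquot /= oppr_eq0; case: eqP => // _.
  rewrite ds_even; [|exact: vs|exact: vs|by move=> u; exact: ve].
  by rewrite !expr1 invrN mulrNN.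
Qed.

Lemma even_cutoff_dlift V (E : set V) v : open E -> even_cutoff E v ->
  even_cutoff (E `*` [set: V]) (dlift v).
Proof.
move=> oE [vs v0 ve]; split.
- by move=> p [Ep _]; apply: smg_dlift; exact: vs.
- move=> [t [x xi]] [/= Ex _] Kt.
  rewrite -[RHS](derive_cst (0 : R) (t, x) ((0 : R), xi)).
  apply: near_eq_derive; have := near_outside oE Ex Kt.
  by apply: filterS => p [? ?]; exact: v0.
- move=> t [x xi] [/= Ex _]; rewrite /dlift /=.
  have H t' : is_derive (0 : R) (1 : R) (fun a : R => v ((t', x) + a *: ((0 : R), xi)))
      ('D_(0, xi) v (t', x)).
    apply: is_derive_line; rewrite scale0r addr0; apply: derivableP.
    by apply: smg_derivable; exact: vs.
  have [_ <-] := H (- t); have [_ <-] := H t; apply: near_eq_derive.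
  have c : {for (0 : R), continuous (fun a : R => x + a *: xi)}.
    by apply: cvgD; [exact: cvg_cst|apply: cvgZr_tmp; exact: cvg_id].
  have : \forall a \near (0 : R), E (x + a *: xi).
    by apply: c; rewrite scale0r addr0; exact: open_nbhs_nbhs.
  apply: filterS => a Ea.
  rewrite -[(t, x) + _]/(t + a * 0, x + a *: xi) -[(- t, x) + _]/(- t + a * 0, x + a *: xi).
  by rewrite mulr0 !addr0 ve.
Qed.

(** The two polynomials share their coefficients below m0; those from m0 on meet arguments beyond K,
    where [v] is zero. *)
Lemma dilop_stable V (E : set V) n v t x m0 m : even_cutoff E v -> E x ->
  (m0 <= m)%N -> K < 2 ^+ m0 * t -> dilop (s m) n v (t, x) = dilop (s m0) n v (t, x).
Proof.
move=> [_ v0 _] Ex /subnK <- Kt; elim: (m - m0)%N => [//|j IH].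
rewrite addSn -[s _.+1](subrK (s (j + m0)%N)) dilopD IH.
rewrite [X in X + _](_ : _ = 0) ?add0r//; apply: big1 => k _.
have [km|km] := ltnP k (j + m0); first by rewrite (s_step _).1// !mul0r.
rewrite v0 ?mulr0//=; apply: (lt_le_trans Kt); apply: le_trans (ler_norm _).
have t0 : 0 < t.
  by rewrite -(pmulr_rgt0 (x := 2 ^+ m0)) ?exprn_gt0// (lt_trans K0).
by rewrite ler_pM2r// ler_eXn2l ?ltr1n// (leq_trans (leq_addl _ _) km).
Qed.

Lemma bound_sqrt (t : R) : 0 < t -> K < 2 ^+ Num.bound (K / t) * t.
Proof.
move=> t0; rewrite -ltr_pdivrMr//.
have q0 : 0 <= K / t by rewrite divr_ge0// ltW.
apply: (lt_le_trans (archi_boundP q0)).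
by rewrite -[2 ^+ _]natrX ler_nat ltnW// ltn_expl.
Qed.

Lemma wext_neg V (E : set V) n v t x m : even_cutoff E v -> E x -> t < 0 ->
  K < 2 ^+ m * Num.sqrt (- t) ->
  wext n v (t, x) = (-1) ^+ n * dilop (s m) n v (Num.sqrt (- t), x).
Proof.
move=> vc Ex t0 Km; rewrite /wext /= leNgt t0 /=; congr (_ * _).
have s0 : 0 < Num.sqrt (- t) by rewrite sqrtr_gt0 oppr_gt0.
have Kb := bound_sqrt s0; move: (Num.bound _) Kb => b Kb.
have [mb|bm] := leqP m b; first exact: dilop_stable vc Ex mb Km.
by apply/esym; exact: dilop_stable vc Ex (ltnW bm) Kb.
Qed.

(* Since any sufficient m may replace the truncation chosen in [wext], one polynomial serves for all
   points near a given t < 0. *)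
End SeeleyExtension.

Section OneSidedDerivatives.
Context {R : realType}.
Implicit Types U V W : normedModType R.
Variable s : nat -> {poly R}.
Hypothesis s_val : forall m n, (n < m)%N -> (s m).[4 ^+ n] = (-1) ^+ n.
Hypothesis s_step : forall m, (forall k, (k < m)%N -> (s m.+1 - s m)`_k = 0) /\
    (forall n, (n < m)%N -> coef_norm (s m.+1 - s m) (4 ^+ n) <= 2 ^- m).
Variable K : R.
Hypothesis K0 : 0 < K.

Lemma smg_sum V (x : V) n (f : 'I_n -> V -> R) :
  (forall i, smg x (f i)) -> smg x (fun z => \sum_(i < n) f i z).
Proof.
elim: n f => [|n IH] f fs.
  rewrite (_ : (fun z => _) = fun=> 0); first exact: smg_cst.
  by apply/funext => z; rewrite big_ord0.
rewrite (_ : (fun z => _) =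
    fun z => f ord0 z + \sum_(i < n) f (lift ord0 i) z); last first.
  by apply/funext => z; rewrite big_ord_recl.
by apply: smg_add => //; exact: IH.
Qed.

Lemma half_quotE V (v : R * V -> R) (t : R) (x : V) : t != 0 ->
  ds v (t, x) = 2 * t * half_quot v (t, x).
Proof. by move=> t0; rewrite /half_quot /tquot /= (negPf t0) expr1; field. Qed.

Lemma wext_pos V (E : set V) n v (t : R) (x : V) : even_cutoff K E v -> open E ->
  E x -> 0 < t -> smg (t, x) (wext s K n v) /\
  forall w, 'D_w (wext s K n v) (t, x) = w.1 * wext s K n.+1 (half_quot v) (t, x)
     + wext s K n (dlift v) (t, (x, w.2)).
Proof.
move=> [vs _ _] oE Ex t0.
have np : \forall p \near (t, x), v (Num.sqrt p.1, p.2) = wext s K n v p.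
  have c : {for (t, x), continuous (fst : R * V -> R)} by exact: cvg_fst.
  have : \forall p \near (t, x), 0 < p.1.
    by apply: (c [set a : R | 0 < a]); apply: open_nbhs_nbhs; split=> //; exact: open_gt.
  by apply: filterS => p p0; rewrite /wext (ltW p0).
split.
  apply: smg_eq np _; apply: (@smg_comp _ _ _ _ _ (Num.sqrt t, x)
    (fun p : R * V => (Num.sqrt p.1, p.2)) v) => //; last exact: vs.
  apply: smg_pair; last by smg.
  apply: (@smg_comp _ _ _ _ _ t (fun p : R * V => p.1) Num.sqrt) => //.
    by smg.
  exact: smg_sqrt.
move=> [tau xi]; rewrite -(near_eq_derive _ np).
rewrite (derive_comp_fst _ _ (is_derive1_sqrt t0)); last exact: vs.
have s0 : Num.sqrt t != 0 by rewrite gt_eqF// sqrtr_gt0.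
rewrite half_quotE// /wext /= (ltW t0); congr (_ + _).
by rewrite mulrA; congr (_ * _); field; rewrite gt_eqF// sqrtr_gt0.
Qed.

(** Near t < 0 a single finite sum represents [wext]. Differentiating v(2^k sqrt(-t), x) in t gives
    - 4^k times [half_quot v] at the same point, which accounts for the extra sign and the weight
    n.+1. *)
Lemma wext_negd V (E : set V) n v (t : R) (x : V) : even_cutoff K E v -> open E ->
  E x -> t < 0 -> smg (t, x) (wext s K n v) /\
  forall w, 'D_w (wext s K n v) (t, x) = w.1 * wext s K n.+1 (half_quot v) (t, x)
     + wext s K n (dlift v) (t, (x, w.2)).
Proof.
move=> vc oE Ex t0; have [vs _ _] := vc.
have nt0 : 0 < - t by rewrite oppr_gt0.
have q0 : 0 < Num.sqrt (- t) by rewrite sqrtr_gt0.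
pose m := Num.bound (K / Num.sqrt (- t)).
have Km : K < 2 ^+ m * Num.sqrt (- t) by exact: bound_sqrt.
pose g (k : 'I_(size (s m))) (p : R * V) : R :=
  (-1) ^+ n * ((s m)`_k * (4 ^+ n) ^+ k) * v (2 ^+ k * Num.sqrt (- p.1), p.2).
have os : smg (t, x) (fun p : R * V => - p.1).
  by apply: smg_opp; smg.
have sqs : @smg R (R * V)%type R (t, x) (fun p : R * V => Num.sqrt (- p.1)).
  exact: (@smg_comp R _ R R (t, x) (- t) (fun p : R * V => - p.1) Num.sqrt erefl os (smg_sqrt nt0)).
have np : \forall p \near (t, x), \sum_k g k p = wext s K n v p.
  have c1 : {for (t, x), continuous (fst : R * V -> R)} by exact: cvg_fst.
  have c2 : {for (t, x), continuous (fun p : R * V => 2 ^+ m * Num.sqrt (- p.1))}.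
    by apply: smg_continuous; apply: smg_mul => //; exact: smg_cst.
  have c3 : {for (t, x), continuous (snd : R * V -> V)} by exact: cvg_snd.
  have n1 : \forall p \near (t, x), p.1 < 0.
    by apply: (c1 [set a : R | a < 0]); apply: open_nbhs_nbhs; split=> //; exact: open_lt.
  have n2 : \forall p \near (t, x), K < 2 ^+ m * Num.sqrt (- p.1).
    by apply: (c2 [set a : R | K < a]); apply: open_nbhs_nbhs; split=> //; exact: open_gt.
  have n3 : \forall p \near (t, x), E p.2.
    by apply: (c3 E); exact: open_nbhs_nbhs.
  have := near_and n1 (near_and n2 n3).
  apply: filterS => -[t' x'] [/= t'0 [K' Ex']].
  rewrite (wext_neg s_step K0 n vc Ex' t'0 K') /dilop mulr_sumr.
  by apply: eq_bigr => k _; rewrite /g -[LHS]mulrA.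
have gs k : smg (t, x) (g k).
  apply: smg_mul; first exact: smg_cst.
  apply: (@smg_comp _ _ _ _ _ (2 ^+ k * Num.sqrt (- t), x)
    (fun p : R * V => (2 ^+ k * Num.sqrt (- p.1), p.2)) v) => //; last exact: vs.
  apply: smg_pair; last by smg.
  by apply: smg_mul => //; exact: smg_cst.
split; first by apply: smg_eq np _; exact: smg_sum.
move=> [tau xi]; rewrite -(near_eq_derive _ np).
have -> : 'D_(tau, xi) (fun p => \sum_k g k p) (t, x) = \sum_k 'D_(tau, xi) (g k) (t, x).
  rewrite -derive_sum; last by move=> k; exact: smg_derivable.
  by congr ('D_(_) _ _); apply/funext => p; rewrite fct_sumE.
have hc := even_cutoff_half K0 oE vc.
have dc := even_cutoff_dlift oE vc.
rewrite (wext_neg s_step K0 n.+1 hc Ex t0 Km).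
rewrite (@wext_neg R s s_step K K0 _ _ n _ t (x, xi) m dc _ t0 Km)//.
rewrite /dilop !mulr_sumr -big_split /=; apply: eq_bigr => k _.
have hk : is_derive t (1 : R) (fun a : R => 2 ^+ k * Num.sqrt (- a))
    (2 ^+ k * - (2 * Num.sqrt (- t))^-1).
  have h1 := @is_derive1_comp _ Num.sqrt (fun a => - a) t _ _
     (is_derive1_sqrt nt0) (is_deriveNid t 1).
  have [h2 h3] := is_deriveZ (2 ^+ k) h1; split => //; rewrite [LHS]h3.
  by rewrite -[_ *: _]/(_ * _) mulrN1.
have vk : smg (2 ^+ k * Num.sqrt (- t), x) v by exact: vs.
have cs : smg (t, x) (fun p : R * V => v (2 ^+ k * Num.sqrt (- p.1), p.2)).
  apply: (@smg_comp _ _ _ _ _ (2 ^+ k * Num.sqrt (- t), x)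
    (fun p : R * V => (2 ^+ k * Num.sqrt (- p.1), p.2)) v) => //.
  apply: smg_pair; last by smg.
  by apply: smg_mul => //; exact: smg_cst.
have -> : 'D_(tau, xi) (g k) (t, x) = (-1) ^+ n * ((s m)`_k * (4 ^+ n) ^+ k) *
    'D_(tau, xi) (fun p : R * V => v (2 ^+ k * Num.sqrt (- p.1), p.2)) (t, x).
  by rewrite -[RHS]deriveZ//; exact: smg_derivable.
rewrite (derive_comp_fst tau xi hk vk) half_quotE; last first.
  by rewrite mulf_neq0// ?expf_neq0// gt_eqF.
have E4 : (2 ^+ k) * (2 ^+ k) = 4 ^+ k :> R by rewrite -exprMn -natrM.
rewrite [4 ^+ n.+1]exprS exprMn -E4 exprS mulN1r.
have u0 : Num.sqrt (- t) != 0 by rewrite gt_eqF.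
rewrite /=; set a := half_quot v _; set b := dlift v _; set c := (4 ^+ n) ^+ k.
set d := 2 ^+ k; set e := (-1) ^+ n; set u := Num.sqrt _ in u0 *.
move: a b c d e u u0 => a b c d e u u0.
by field; exact: u0.
Qed.

Definition zero_shift V (v : R * V -> R) (p : R * V) : R := v p - v (0, p.2).

Lemma smg_zero_shift V (E : set V) v p : even_cutoff K E v -> E p.2 ->
  smg p (zero_shift v).
Proof.
move=> [vs _ _] Ep; apply: smg_sub; first exact: vs.
apply: (@smg_comp _ _ _ _ p (0, p.2) (fun q : R * V => ((0 : R), q.2)) v) => //.
  by apply: smg_pair; [exact: smg_cst|smg].
exact: vs.
Qed.

Lemma ds_zero_shift V (E : set V) v p : even_cutoff K E v -> E p.2 ->
  ds (zero_shift v) p = ds v p.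
Proof.
move: p => [t x] vc Ex; have [vs _ _] := vc.
have [H1 <-] := is_derive_ds (smg_zero_shift (p := (t, x)) vc Ex).
have H2 := is_derive_ds (vs (t, x) Ex).
have [_ H3] := is_deriveB H2 (is_derive_cst (v (0, x)) t (1 : R)).
by rewrite subr0 in H3; rewrite -[RHS]H3.
Qed.

Lemma vanish_zero_shift V (E : set V) v : even_cutoff K E v ->
  vanish 2 E (zero_shift v).
Proof.
move=> vc [|[|//]] x _ Ex /=; first by rewrite /zero_shift subrr.
by rewrite (ds_zero_shift (p := (0, x)) vc Ex); exact: even_cutoff_ds0 vc Ex.
Qed.

(** Both sides are half the second derivative of [v] in its first coordinate. *)
Lemma zero_shift_quot0 V (E : set V) v x : open E -> even_cutoff K E v -> E x ->
  tquot 2 (zero_shift v) (0, x) = half_quot v (0, x).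
Proof.
move=> oE vc Ex.
have H : ds (ds (zero_shift v)) (0, x) = ds (ds v) (0, x).
  apply: (@ds_eq _ _ (slab 1 E) (ds (zero_shift v)) (ds v)); first exact: open_slab.
    by move=> p [_ Ep]; exact: ds_zero_shift vc Ep.
  exact: slab0.
have F1 : 1`!%:R = 1 :> R by [].
have F2 : 2`!%:R = 2 :> R by [].
have E1 : tquot 2 (zero_shift v) (0, x) = ds (ds (zero_shift v)) (0, x) / 2.
  by rewrite /tquot eqxx F2.
have E2 : tquot 1 (ds v) (0, x) = ds (ds v) (0, x).
  by rewrite /tquot eqxx F1; exact: divr1.
by rewrite E1 H -E2.
Qed.

Lemma zero_shift_quot V (E : set V) v t x : even_cutoff K E v -> E x ->
  v (t, x) = v (0, x) + t ^+ 2 * tquot 2 (zero_shift v) (t, x).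
Proof.
move=> vc Ex; rewrite /tquot /=; have [->|t0] := eqVneq t 0.
  by rewrite expr0n mul0r addr0.
by rewrite [_ ^+ 2 * _]mulrC divfK ?expf_neq0// /zero_shift addrC subrK.
Qed.

Lemma zero_shift_continuous V (E : set V) v p : open E -> even_cutoff K E v ->
  E p.2 -> {for p, continuous (tquot 2 (zero_shift v))}.
Proof.
move=> oE vc Ep; have r0 : 0 < `|p.1| + 1 by rewrite ltr_wpDl.
apply: (tquot_continuous r0 oE); last by split => //=; rewrite ltrDl.
  by move=> q [_ Eq]; exact: smg_zero_shift vc Eq.
exact: vanish_zero_shift.
Qed.

(** Let v(t, x) = v(0, x) + t^2 u(t, x). For t > 0 the extension is v(0, x) + t u(sqrt t, x); for t
    < 0 it is, by [dilop_shift], v(0, x) + t w, where w is the signed dilated sum of u with weight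
    n.+1. Both cofactors of t tend to u(0, x0), which is the value of [half_quot v] there. *)
Lemma wext_bound V (E : set V) n v x0 : open E -> even_cutoff K E v -> E x0 ->
  forall e : R, 0 < e -> \forall p \near ((0 : R), x0),
    `|wext s K n v p - v (0, p.2) - p.1 * half_quot v (0, x0)| <= e * `|p.1|.
Proof.
move=> oE vc Ex0 e e0; have [vs vK ve] := vc.
pose u := tquot 2 (zero_shift v).
(* A bound for u on the whole line: by compactness on [-K, K], and beyond K, where [v] vanishes,
   from u = - v(0, x) / t^2. *)
have [B B0 uB] : exists2 B : R, 0 <= B &
    \forall x \near x0, forall t, `|u (t, x)| <= B.
  have [B1 B10 nB1] := @tube_bound R V u x0 K
    (fun t _ => zero_shift_continuous (p := (t, x0)) oE vc Ex0).
  have [B2 B20 nB2] := @tube_bound R V v x0 K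
    (fun t _ => smg_continuous (vs (t, x0) Ex0)).
  exists (B1 + B2 / K ^+ 2); first by rewrite addr_ge0// divr_ge0// exprn_ge0// ltW.
  have nE : \forall x \near x0, E x by exact: open_nbhs_nbhs.
  have := near_and nE (near_and nB1 nB2); apply: filterS => x [Ex [H1 H2]] t.
  have [tK|Kt] := leP `|t| K.
    by apply: (le_trans (H1 t tK)); rewrite lerDl divr_ge0// exprn_ge0// ltW.
  have t0 : t != 0 by rewrite -normr_gt0 (lt_trans K0).
  rewrite /u /tquot /= (negPf t0) /zero_shift vK// sub0r normrM normrN normfV normrX.
  rewrite (@le_trans _ _ (B2 / K ^+ 2))// ?lerDr//.
  have k0 : 0 <= K by exact: ltW.
  have H3 : `|v (0, x)| <= B2 by apply: H2; rewrite normr0.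
  have H4 : (`|t| ^+ 2)^-1 <= (K ^+ 2)^-1.
    rewrite lef_pV2 ?posrE ?exprn_gt0//; last exact: lt_trans Kt.
    by rewrite lerXn2r ?nnegrE// ltW.
  by apply: ler_pM; [exact: normr_ge0|rewrite invr_ge0 exprn_ge0|exact: H3|exact: H4].
have uc := zero_shift_continuous (p := (0, x0)) oE vc Ex0.
have [m0 /near_norm[d d0 Hd]] := dilop_cvg s_val s_step n.+1 B0 uB uc e0.
have /cvgrPdist_le/(_ _ e0)/near_norm[d' d'0 Hd'] := uc.
have /near_norm[d2 d20 Hd2] : \forall x \near x0, E x by exact: open_nbhs_nbhs.
pose r := Num.min d d'.
have r0 : 0 < r by rewrite lt_min d0.
apply/near_norm; exists (Num.min d2 (Num.min r (r ^+ 2))).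
  by rewrite !lt_min d20 d0 d'0 exprn_gt0.
move=> [t x]; rewrite num_gt_max /= subr0 => /andP[td].
rewrite lt_min => /andP[/Hd2 Ex]; rewrite lt_min => /andP[xr _].
have tr : `|t| < r ^+ 2 by move: td; rewrite !lt_min => /andP[_ /andP[_]].
have sq a : 0 <= a -> a < r ^+ 2 -> `|Num.sqrt a| < r.
  move=> a0 ar; rewrite ger0_norm ?sqrtr_ge0//.
  by rewrite -(@ltr_pXn2r _ 2) ?nnegrE ?sqrtr_ge0// ?(ltW r0)// sqr_sqrtr.
have inr a : 0 <= a -> a < r ^+ 2 -> `|(Num.sqrt a, x) - (0, x0)| < d /\
   `|(Num.sqrt a, x) - (0, x0)| < d'.
  move=> a0 ar; have := sq a a0 ar; rewrite /r lt_min => /andP[ad ad'].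
  move: xr; rewrite /r lt_min => /andP[xd xd'].
  by rewrite !num_gt_max /= subr0 ad ad' xd xd'.
rewrite -(zero_shift_quot0 oE vc Ex0) -/u.
have [t0|t0|t0] := ltgtP t 0; last first.
- by rewrite t0 /wext /= lexx sqrtr0 subrr mul0r subr0 normr0 mulr0.
- rewrite /wext /= (ltW t0) (zero_shift_quot _ vc Ex) sqr_sqrtr ?(ltW t0)// -/u.
  rewrite [X in X - _ - _]addrC addrK -mulrBr normrM mulrC ler_wpM2r//.
  rewrite distrC; apply: Hd'; have := inr t (ltW t0).
  by rewrite -(gtr0_norm t0) tr => /(_ isT)[_]; rewrite gtr0_norm.
have nt0 : 0 < - t by rewrite oppr_gt0.
have q0 : 0 < Num.sqrt (- t) by rewrite sqrtr_gt0.
pose b := Num.bound (K / Num.sqrt (- t)).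
(* m is above n for the value of [s m] at 4^n, at least m0 for the limit, and at least b for the
   truncation. *)
pose m := maxn n.+1 (maxn m0 b).
have Km : K < 2 ^+ m * Num.sqrt (- t).
  apply: (lt_le_trans (bound_sqrt K0 q0)); rewrite ler_pM2r// ler_eXn2l ?ltr1n//.
  by rewrite !leq_max leqnn !orbT.
rewrite (wext_neg s_step K0 n vc Ex t0 Km).
rewrite (@dilop_shift R V (s m) n v u (v (0, x)) (Num.sqrt (- t), x)); last first.
  by move=> k _; exact: zero_shift_quot vc Ex.
rewrite s_val; last by rewrite leq_max leqnn.
rewrite /= sqr_sqrtr ?(ltW nt0)//.
have H : `|(-1) ^+ n.+1 * dilop (s m) n.+1 u (Num.sqrt (- t), x) - u (0, x0)| <= e.
  apply: Hd; last by rewrite !leq_max leqnn orbT.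
  by have [] := inr (- t) (ltW nt0) _; rewrite -(ltr0_norm t0).
rewrite (_ : _ - _ = t * ((-1) ^+ n.+1 * dilop (s m) n.+1 u (Num.sqrt (- t), x) - u (0, x0))).
  by rewrite normrM mulrC ler_wpM2r.
have e1 : (-1) ^+ n * (-1) ^+ n = 1 :> R by rewrite -exprMn mulrNN mulr1 expr1n.
rewrite mulrDr [in LHS]mulrA e1 exprS mulN1r mul1r.
set a := dilop _ _ _ _; set c := v _; set w := u _; set f := (-1) ^+ n.
by move: a c w f {e1} => a c w f; ring.
Qed.

End OneSidedDerivatives.

Section SmoothExtension.
Context {R : realType}.
Implicit Types U V W : normedModType R.
Variable s : nat -> {poly R}.
Hypothesis s_val : forall m n, (n < m)%N -> (s m).[4 ^+ n] = (-1) ^+ n.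
Hypothesis s_step : forall m, (forall k, (k < m)%N -> (s m.+1 - s m)`_k = 0) /\
    (forall n, (n < m)%N -> coef_norm (s m.+1 - s m) (4 ^+ n) <= 2 ^- m).
Variable K : R.
Hypothesis K0 : 0 < K.

(** Off t = 0 this is the chain rule; at t = 0 [wext_bound] handles the first coordinate, and the
    differential of v(0, .) handles the parameters. *)
Lemma wext_is_diff V (E : set V) n v p : open E -> even_cutoff K E v -> E p.2 ->
  is_diff p (wext s K n v)
   (fun w => w.1 * wext s K n.+1 (half_quot v) p + wext s K n (dlift v) (p.1, (p.2, w.2))).
Proof.
case: p => t x oE vc Ex; have [vs _ _] := vc.
have off : smg (t, x) (wext s K n v) /\
  (forall w, 'D_w (wext s K n v) (t, x) = w.1 * wext s K n.+1 (half_quot v) (t, x)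
     + wext s K n (dlift v) (t, (x, w.2))) -> is_diff (t, x) (wext s K n v)
   (fun w => w.1 * wext s K n.+1 (half_quot v) (t, x) + wext s K n (dlift v) (t, (x, w.2))).
  move=> [qs qD]; apply: DiffDef; first exact: smg_differentiable.
  apply/funext => w; rewrite -deriveE; last exact: smg_differentiable.
  exact: qD.
have [t0|t0|t0] := ltgtP t 0.
- by apply: off; exact: (wext_negd s_step K0 n vc oE Ex t0).
- by apply: off; exact: (wext_pos s n vc oE Ex t0).
move=> {off}; rewrite t0 in Ex *.
have vs0 : smg (0, x) v by exact: vs.
have dfE (w : R * V) : w.1 * wext s K n.+1 (half_quot v) (0, x) + wext s K n (dlift v) (0, (x, w.2))
   = w.1 * half_quot v (0, x) + 'd v (0, x) ((0 : R), w.2).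
  rewrite /wext lexx sqrtr0 /dlift deriveE//; exact: smg_differentiable.
rewrite (funext dfE).
apply: is_diff_eps.
- move=> a [s1 x1] [s2 x2] /=.
  have -> : 'd v (0, x) ((0 : R), a *: x1 + x2)
      = a * 'd v (0, x) (0, x1) + 'd v (0, x) (0, x2).
    rewrite -[a * _]/(a *: _) -linearZ -linearD; congr ('d v _ _).
    by rewrite -[RHS]/(a * 0 + 0, a *: x1 + x2) mulr0 addr0.
  rewrite -![_ *: _]/(_ * _); ring.
- move=> w; apply: smg_continuous; apply: smg_add; first apply: smg_mul.
  + by smg.
  + exact: smg_cst.
  + apply: (@smg_comp _ _ _ _ _ _ (fun w : R * V => ((0 : R), w.2)) ('d v (0, x)) erefl).
      by apply: smg_pair; [exact: smg_cst|smg].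
    by apply: smg_linear; apply: diff_continuous; exact: smg_differentiable.
move=> e e0; have e2 : 0 < e / 2 by rewrite divr_gt0.
have /near_norm[d d0 Hd] := wext_bound s_val s_step K0 n oE vc Ex e2.
have /near_norm[d' d'0 Hd'] := diff_eps (smg_differentiable vs0) e2.
apply/near_norm; exists (Num.min d d'); first by rewrite lt_min d0.
move=> [a y]; rewrite subr0 lt_min => /andP[tyd tyd'] /=.
have d2 : `|(a, x + y) - (0, x)| < d.
  by rewrite -[_ - _]/(a - 0, x + y - x) subr0 [x + y]addrC addrK.
have d1 : `|((0 : R), y) - 0| < d'.
  apply: le_lt_trans tyd'; rewrite subr0 !prod_normE /= normr0.
  by rewrite ge_max le_max normr_ge0 le_max lexx orbT.
have := Hd _ d2; have := Hd' _ d1.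
rewrite -[(0, y) + _]/(0 + 0, y + x) -[(a, y) + _]/(a + 0, y + x) !addr0 /=.
rewrite [x + y]addrC.
have -> : wext s K n v (0, x) = v (0, x) by rewrite /wext lexx sqrtr0.
move=> B1 B2.
have nt : `|a| <= `|(a, y)| by rewrite prod_normE le_max lexx.
have ny : `|((0 : R), y)| <= `|(a, y)|.
  by rewrite !prod_normE /= normr0 ge_max le_max normr_ge0 le_max lexx orbT.
set w1 := wext _ _ _ _ _; set w2 := v (0, x) in B1 *; set w3 := half_quot v _ in B2 *.
set w4 := 'd v _ _ in B1 *; set w5 := v (0, y + x) in B1 B2.
rewrite (_ : w1 - w2 - _ = (w1 - w5 - a * w3) + (w5 - w2 - w4)); last first.
  by move: w1 w2 w3 w4 w5 {B1 B2} => w1 w2 w3 w4 w5; ring.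
apply: (le_trans (ler_normD _ _)).
have -> : e * `|(a, y)| = e / 2 * `|(a, y)| + e / 2 * `|(a, y)|.
  by rewrite -mulrDl -splitr.
apply: lerD.
  by apply: (le_trans B2); rewrite ler_wpM2l// ltW.
by apply: (le_trans B1); rewrite ler_wpM2l// ltW.
Qed.

(** The induction is the one for quotients: the differential is made of the extensions of
    [half_quot v] and [dlift v]. *)
Lemma wext_Ck k V (E : set V) n v : open E -> even_cutoff K E v ->
  Ck k (setT `*` E) (wext s K n v).
Proof.
elim: k V E n v => [|k IH] V E n v oE vc.
  move=> p [_ Ep]; apply: differentiable_continuous.
  by have [] := wext_is_diff n oE vc Ep.
have oD : open ([set: R] `*` E).
  rewrite !openE => -[t x] [_ /= Ex].
  exists (setT, E) => //; split; first exact: filterT.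
  exact: open_nbhs_nbhs.
split=> [p [_ Ep]|]; first by have [] := wext_is_diff n oE vc Ep.
have oE' : open (E `*` [set: V]) by exact: openX_setT.
have oD' : open (([set: R] `*` E) `*` [set: (R * V)%type]) by exact: openX_setT.
set D := ([set: R] `*` E) `*` [set: (R * V)%type] in oD' *.
have C1 : Ck k D (fun q : (R * V) * (R * V) => wext s K n.+1 (half_quot v) q.1).
  apply: (@Ck_comp _ k _ _ _ _ ([set: R] `*` E) fst (wext s K n.+1 (half_quot v))) => //.
  - by move=> q [].
  - exact: Ck_fst.
  - by apply: IH => //; exact: even_cutoff_half.
have C2 : Ck k D (fun q : (R * V) * (R * V) => wext s K n (dlift v) (q.1.1, (q.1.2, q.2.2))).
  apply: (@Ck_comp _ k _ _ _ _ ([set: R] `*` (E `*` [set: V]))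
     (fun q : (R * V) * (R * V) => (q.1.1, (q.1.2, q.2.2))) (wext s K n (dlift v))) => //.
  - by move=> [[a x] [b y]] [[/= _ Ex] _].
  - have F := Ck_fst k D.
    have S := Ck_snd k D.
    apply: Ck_pair => //; first exact: (Ck_compT oD' F (Ck_fst k _)).
    apply: Ck_pair => //; first exact: (Ck_compT oD' F (Ck_snd k _)).
    exact: (Ck_compT oD' S (Ck_snd k _)).
  - by apply: IH => //; exact: even_cutoff_dlift.
have C3 : Ck k D (fun q : (R * V) * (R * V) => q.2.1).
  exact: (Ck_compT oD' (Ck_snd k _) (Ck_fst k _)).
apply: (Ck_eq oD' _ (Ck_addf oD' (Ck_mulf oD' C3 C1) C2)).
by move=> [p w] [[_ Ep] _]; rewrite /tangent; have [_ ->] := wext_is_diff n oE vc Ep.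
Qed.

End SmoothExtension.

(** * Whitney's theorem with parameters *)

Section Whitney.
Context {R : realType}.
Implicit Types U V W : normedModType R.

(** The extension requires a function vanishing beyond K, while [w] is only a germ. The cut-off,
    flat at K^2 - t^2 = 0, is itself a smooth function of t^2, so after the extension it can be
    divided out as a function of tau = t^2, being positive near tau = 0. *)
Lemma whitney_even V (w : R * V -> R) (x0 : V) : smg (0, x0) w ->
  (\forall p \near ((0 : R), x0), w (- p.1, p.2) = w p) ->
  exists2 f : R * V -> R, smg (0, x0) f &
    \forall p \near ((0 : R), x0), w p = f (p.1 ^+ 2, p.2).
Proof.
move=> ws we; have [s [s_val s_step]] := @seeley_poly R.
have /near_norm[r r0 Hr] := near_and (smg_near ws) we.
pose E := [set x : V | `|x - x0| < r].
have oE : open E.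
  rewrite (_ : E = ball x0 r); first exact: ball_open.
  by apply/seteqP; split=> x; rewrite -ball_normE /E /= distrC.
have Ex0 : E x0 by rewrite /E /= subrr normr0.
pose K := r / 2; have K0 : 0 < K by rewrite divr_gt0.
have Kr : K < r by rewrite ltr_pdivrMr// ltr_pMr// ltr1n.
(* For K <= |t| < r the flat factor is already 0, so the truncation at r, beyond which nothing is
   known of [w], remains smooth. *)
pose v (p : R * V) := if `|p.1| < r then w p * eflat 0 (K ^+ 2 - p.1 ^+ 2) else 0.
have inr t x : `|t| < r -> E x -> smg (t, x) w /\ w (- t, x) = w (t, x).
  by move=> tr xr; apply: (Hr (t, x)); rewrite num_gt_max /= subr0 tr.
have v0 t x : K < `|t| -> v (t, x) = 0.
  move=> Kt; rewrite /v /=; case: ifP => // _.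
  rewrite /eflat subr_gt0 ltNge -(real_normK (num_real t)).
  by rewrite lerXn2r ?nnegrE ?(ltW K0) ?(ltW Kt)//= mulr0.
have vc : even_cutoff K E v.
  split=> [[t x] /= Ex|[t x] /= _ Kt|t x Ex].
  - have [tr|rt] := ltP `|t| r; last first.
      have := near_outside oE Ex (lt_le_trans Kr rt).
      move=> no; apply: (@smg_eq _ _ _ _ (fun=> 0)); last exact: smg_cst.
      by apply: filterS no => -[t' x'] [_ Kt']; rewrite v0.
    have : smg (t, x) (fun p : R * V => w p * eflat 0 (K ^+ 2 - p.1 ^+ 2)).
      apply: smg_mul; first by have [] := inr t x tr Ex.
      apply: (@smg_comp _ _ _ _ _ _ (fun p : R * V => K ^+ 2 - p.1 ^+ 2) (eflat 0) erefl).
        apply: smg_sub; first exact: smg_cst.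
        by apply: smg_exp; smg.
      exact: smg_eflat.
    apply: smg_eq; apply/near_norm; exists (r - `|t|); first by rewrite subr_gt0.
    move=> [t' x']; rewrite num_gt_max /= => /andP[tt' _]; rewrite /v /= ifT//.
    have := lerB_dist t' t; move: tt'; move: `|t'| `|t| `|t' - t| => a b c; lra.
  - exact: v0.
  - rewrite /v /= normrN; case: ifP => // tr; rewrite sqrrN.
    by have [_ ->] := inr t x tr Ex.
pose f (p : R * V) := wext s K 0 v p / eflat 0 (K ^+ 2 - p.1).
exists f.
  apply: smg_mul.
    have oD : open ([set: R] `*` E).
      rewrite !openE => -[t x] [_ /= Ex].
      exists (setT, E) => //; split; first exact: filterT.
      exact: open_nbhs_nbhs.
    exists ([set: R] `*` E); first by split.
    by move=> n; exact: (wext_Ck s_val s_step K0 n 0 oE vc).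
  apply: smg_inv; first by rewrite /= subr0 gt_eqF// eflat_gt0// exprn_gt0.
  apply: (@smg_comp _ _ _ _ _ _ (fun p : R * V => K ^+ 2 - p.1) (eflat 0) erefl).
    apply: smg_sub; first exact: smg_cst.
    by smg.
  exact: smg_eflat.
apply/near_norm; exists K => // -[t x]; rewrite num_gt_max /= subr0 => /andP[tK xK].
have Ex : E x by exact: lt_trans Kr.
have tr : `|t| < r by exact: lt_trans Kr.
rewrite /f /wext /= sqr_ge0 sqrtr_sqr /v /= normr_id tr real_normK ?num_real// mulfK.
  have [t0|t0] := leP 0 t; first by rewrite ger0_norm.
  by rewrite ltr0_norm//; have [_ ->] := inr t x tr Ex.
rewrite gt_eqF// eflat_gt0// subr_gt0 -(real_normK (num_real t)).
by rewrite ltr_pXn2r ?nnegrE// ltW.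
Qed.

(** The odd part divided by t is even, so the even case applies to it as well as to the even
    part. *)
Lemma whitney V (w : R * V -> R) (x0 : V) : smg (0, x0) w ->
  exists f g : R * V -> R, [/\ smg (0, x0) f, smg (0, x0) g &
    \forall p \near ((0 : R), x0),
      w p = f (p.1 ^+ 2, p.2) + p.1 * g (p.1 ^+ 2, p.2)].
Proof.
move=> ws.
have wN : smg (0, x0) (fun p : R * V => w (- p.1, p.2)).
  apply: (@smg_comp _ _ _ _ _ (0, x0) (fun p : R * V => (- p.1, p.2)) w) => //.
    by rewrite /= oppr0.
  apply: smg_pair; last by smg.
  by apply: smg_opp; smg.
have [f fs fE] : exists2 f : R * V -> R, smg (0, x0) f &
    \forall p \near ((0 : R), x0), (w p + w (- p.1, p.2)) / 2 = f (p.1 ^+ 2, p.2).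
  apply: whitney_even; first by apply: smg_mul; [exact: smg_add|exact: smg_cst].
  by apply/near_norm; exists 1 => // -[t x] _ /=; rewrite opprK addrC.
have [|q [qs qE _]] := smg_division (h := fun p : R * V => (w p - w (- p.1, p.2)) / 2)
    (smg_mul (smg_sub ws wN) (smg_cst _ _)).
  by apply/near_norm; exists 1 => // x _ /=; rewrite oppr0 subrr mul0r.
have /near_norm[d d0 Hd] := qE.
have [g gs gE] : exists2 g : R * V -> R, smg (0, x0) g &
    \forall p \near ((0 : R), x0), q p = g (p.1 ^+ 2, p.2).
  apply: whitney_even => //; apply/near_norm; exists d => // -[t x] tx /=.
  have [->|t0] := eqVneq t 0; first by rewrite oppr0.
  have := Hd _ tx; have := Hd (- t, x); rewrite !num_gt_max /= !subr0 normrN in tx *.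
  move=> /(_ tx); rewrite opprK => H1 H2.
  apply: (mulfI t0); rewrite -H2 -[LHS]opprK -mulNr -H1; ring.
exists f, g; split => //.
have := near_and qE (near_and fE gE); apply: filterS => -[t x] /= [H1 [H2 H3]].
by rewrite -H2 -H3 -H1; field.
Qed.

End Whitney.

(** * Implicit functions *)

Section ImplicitFunction.
Context {R : realType}.
Implicit Types U V W : normedModType R.

Lemma ds_gt0_lt V (F : R * V -> R) (x : V) (a b : R) : a < b ->
  (forall z, a <= z <= b -> smg (z, x) F /\ 0 < ds F (z, x)) ->
  F (a, x) < F (b, x).
Proof.
move=> ab H; have [c cab E] : exists2 c, c \in `]a, b[%R &
    F (b, x) - F (a, x) = ds F (c, x) * (b - a).
  apply: (@MVT R (fun z => F (z, x)) (fun z => ds F (z, x)) a b ab).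
    move=> z /subset_itv_oo_cc; rewrite in_itv /= => /H[Fs _].
    exact: is_derive_ds.
  apply: continuous_in_subspaceT => z /set_mem; rewrite /= in_itv /= => /H[Fs _].
  have [D _] := is_derive_ds Fs.
  by apply/differentiable_continuous/derivable1_diffP.
rewrite -subr_gt0 E mulr_gt0 ?subr_gt0//.
by move: cab => /subset_itv_oo_cc; rewrite in_itv /= => /H[].
Qed.

(** Continuity of [phi] permits expanding [F] at (phi x, x). This gives first a Lipschitz bound for
    the increment k of [phi], its share e1 |k| of the error being absorbed by a |k|, and then the
    expansion of k itself. *)
Lemma implicit_is_diff V (F : R * V -> R) (phi : V -> R) (x : V) :
  {for x, continuous phi} -> (\forall y \near x, F (phi y, y) = 0) ->
  smg (phi x, x) F -> 0 < ds F (phi x, x) ->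
  is_diff x phi (fun v => - ('d F (phi x, x) (0, v) / ds F (phi x, x))).
Proof.
move=> pc F0 Fs a0; set a := ds F _ in a0 *; set z := (phi x, x).
have Fd := smg_differentiable Fs.
have dFc : continuous ('d F z) by exact: diff_continuous.
have ls : smg (0 : V) (fun v : V => 'd F z (0, v)).
  apply: (@smg_comp _ _ _ _ _ _ (fun v : V => ((0 : R), v)) ('d F z) erefl).
    by apply: smg_pair; [exact: smg_cst|exact: smg_id].
  exact: smg_linear.
have lin : linear (fun v : V => 'd F z (0, v)).
  move=> c u v; rewrite -linearZ -linearD; congr ('d F z _).
  by rewrite -[RHS]/(c * 0 + 0, c *: u + v) mulr0 addr0.
have [C C0 CL] : exists2 C : R, 0 < C & forall v, `|'d F z (0, v)| <= C * `|v|.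
  have lc : continuous ('d F z : {linear _ -> _}) by [].
  have [C C0 H] := linear_lipschitz lc; exists C => // v.
  apply: (le_trans (H _)); rewrite ler_wpM2l ?(ltW C0)//.
  by rewrite prod_normE /= normr0 ge_max normr_ge0 lexx.
apply: is_diff_eps.
- move=> c u v; rewrite lin -[c *: _]/(c * _) -[c *: _]/(c * _) mulrDl opprD mulrN mulrA.
  by [].
- move=> v; apply: smg_continuous; apply: smg_opp; apply: smg_mul; last exact: smg_cst.
  apply: (@smg_comp _ _ _ _ _ _ (fun v : V => ((0 : R), v)) ('d F z) erefl).
    by apply: smg_pair; [exact: smg_cst|exact: smg_id].
  exact: smg_linear.
move=> e e0.
(* C' comes from (a/2) |k| <= (C + a/2) |h|; the second entry of e1 brings the final error e1 (C' +
   1) |h| below e a |h|. *)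
pose C' := 2 * (C + a / 2) / a.
have C'0 : 0 < C' by rewrite divr_gt0// mulr_gt0// addr_gt0// divr_gt0.
pose e1 := Num.min (a / 2) (e * a / (C' + 1)).
have e10 : 0 < e1.
  by rewrite lt_min !divr_gt0// ?mulr_gt0// addr_gt0.
have e1a : e1 <= a / 2 by rewrite ge_min lexx.
have e1e : e1 * (C' + 1) <= e * a.
  by rewrite -ler_pdivlMr ?addr_gt0// ge_min lexx orbT.
have /near_norm[d d0 Hd] := diff_eps Fd e10.
move/cvgrPdist_lt : pc => /(_ _ d0)/near_norm[d1 d10 Hd1].
move: F0 => /[dup] /nbhs_singleton F0 /near_norm[d2 d20 Hd2].
apply/near_norm; exists (Num.min d (Num.min d1 d2)); first by rewrite !lt_min d0 d10.
move=> h; rewrite subr0 !lt_min => /andP[hd /andP[hd1 hd2]].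
set k := phi (h + x) - phi x.
have kd : `|k| < d.
  by rewrite distrC; apply: Hd1; rewrite addrK.
have B : `|F (phi (h + x), h + x) - F z - 'd F z (k, h)| <= e1 * `|(k, h)|.
  have := Hd (k, h); rewrite subr0 num_gt_max /= kd hd => /(_ isT).
  by rewrite -[(k, h) + _]/(k + phi x, h + x) subrK.
have Fh : F (phi (h + x), h + x) = 0 by apply: Hd2; rewrite addrK.
have Fz : F z = 0 by [].
move: B; rewrite Fh Fz subr0 sub0r normrN.
have -> : 'd F z (k, h) = a * k + 'd F z (0, h).
  rewrite /a /ds deriveE// mulrC -[k * _]/(k *: _) -linearZ -linearD; congr ('d F z _).
  by rewrite -[RHS]/(k * 1 + 0, k *: (0 : V) + h) mulr1 scaler0 addr0 add0r.
set L := 'd F z (0, h); have LC : `|L| <= C * `|h| by exact: CL.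
rewrite prod_normE /= => H.
have H' : `|a * k + L| <= e1 * (`|k| + `|h|).
  apply: (le_trans H); rewrite ler_wpM2l ?(ltW e10)//.
  by rewrite ge_max lerDl lerDr !normr_ge0.
have kh : `|k| <= C' * `|h|.
  have : a * `|k| <= C * `|h| + e1 * (`|k| + `|h|).
    rewrite -{1}(gtr0_norm a0) -normrM -(addrK L (a * k)).
    apply: (le_trans (ler_normB _ _)); rewrite addrC; exact: lerD.
  have : e1 * (`|k| + `|h|) <= a / 2 * (`|k| + `|h|).
    by rewrite ler_wpM2r// addr_ge0.
  move=> H1 H2; have H3 := le_trans H2 (lerD (lexx _) H1).
  rewrite /C' mulrAC ler_pdivlMr//.
  move: (normr_ge0 k) (normr_ge0 h) H3; move: `|k| `|h| => u w u0 w0 H3.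
  lra.
rewrite opprK (_ : k + L / a = (a * k + L) / a); last by field; rewrite gt_eqF.
rewrite normrM normfV (gtr0_norm a0) ler_pdivrMr//.
apply: (le_trans H'); apply: (@le_trans _ _ (e1 * (C' + 1) * `|h|)).
  rewrite -mulrA ler_wpM2l ?(ltW e10)// mulrDl mul1r lerD2r //.
by rewrite [leRHS]mulrAC ler_wpM2r.
Qed.

(** The unknown is a real number: monotonicity and the intermediate value theorem produce it for
    parameters in any normed space. Smoothness follows by induction, the differential of the
    solution being expressed by the solution and the derivatives of [F]. The last clause, local
    uniqueness, identifies the solution where it is known by other means. *)
Lemma implicit_function V (F : R * V -> R) (z0 : R) (x0 : V) :
  smg (z0, x0) F -> F (z0, x0) = 0 -> 0 < ds F (z0, x0) ->
  exists phi : V -> R, [/\ smg x0 phi, phi x0 = z0,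
    (\forall x \near x0, F (phi x, x) = 0) &
    (\forall p \near (z0, x0), F p = 0 -> p.1 = phi p.2)].
Proof.
move=> Fs F0 dF.
have dpos : \forall p \near (z0, x0), 0 < ds F p.
  have c := smg_continuous (smg_derive ((1 : R), (0 : V)) Fs).
  by apply: (c [set a : R | 0 < a]); apply: open_nbhs_nbhs; split=> //; exact: open_gt.
have /near_norm[d d0 Hd] := near_and (smg_near Fs) dpos.
have Hd' z x : `|z - z0| < d -> `|x - x0| < d -> smg (z, x) F /\ 0 < ds F (z, x).
  by move=> zd xd; apply: Hd; rewrite num_gt_max /= zd.
have mono x a b : `|x - x0| < d -> `|a - z0| < d -> `|b - z0| < d -> a < b ->
    F (a, x) < F (b, x).
  move=> xd ad bd ab; apply: ds_gt0_lt => // z /andP[az zb]; apply: Hd' => //.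
  move: ad bd; rewrite !ltr_norml => /andP[? ?] /andP[? ?].
  by apply/andP; split; lra.
pose eta := d / 2; have eta0 : 0 < eta by rewrite divr_gt0.
have etad : eta < d by rewrite ltr_pdivrMr// ltr_pMr// ltr1n.
(* The change of sign around a zero persists for nearby parameters; this is used at x0 for existence
   and at every x1 for continuity. *)
have sgn x1 z1 e1 : `|x1 - x0| < d -> F (z1, x1) = 0 -> 0 < e1 ->
    `|z1 - e1 - z0| < d -> `|z1 + e1 - z0| < d -> `|z1 - z0| < d ->
    \forall x \near x1, F (z1 - e1, x) < 0 /\ 0 < F (z1 + e1, x).
  move=> xd Fz e10 m1 m2 m3.
  have c (z : R) : `|z - z0| < d -> {for x1, continuous (fun x => F (z, x))}.
    move=> zd; apply: smg_continuous.
    apply: (@smg_comp _ _ _ _ _ (z, x1) (fun x : V => (z, x)) F) => //.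
      by apply: smg_pair; [exact: smg_cst|exact: smg_id].
    by have [] := Hd' z x1 zd xd.
  have N1 : F (z1 - e1, x1) < 0.
    by rewrite -Fz; apply: mono => //; rewrite ltrBlDr ltrDl.
  have N2 : 0 < F (z1 + e1, x1).
    by rewrite -[ltLHS]Fz; apply: mono => //; rewrite ltrDl.
  apply: near_and.
    apply: (c _ m1 [set a : R | a < 0]); apply: open_nbhs_nbhs; split=> //; exact: open_lt.
  apply: (c _ m2 [set a : R | 0 < a]); apply: open_nbhs_nbhs; split=> //; exact: open_gt.
have x0d : `|x0 - x0| < d by rewrite subrr normr0.
have z0d : `|z0 - z0| < d by rewrite subrr normr0.
have /near_norm[d1 d10 Hd1] : \forall x \near x0, F (z0 - eta, x) < 0 /\ 0 < F (z0 + eta, x).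
  apply: sgn => //.
    by rewrite addrAC subrr add0r normrN gtr0_norm.
  by rewrite addrAC subrr add0r gtr0_norm.
pose rr := Num.min d d1; have rr0 : 0 < rr by rewrite lt_min d0.
have ex x : exists z, `|x - x0| < rr -> `|z - z0| < eta /\ F (z, x) = 0.
  have [xr|] := ltP `|x - x0| rr; last by exists 0.
  move: xr; rewrite lt_min => /andP[xd /Hd1[F1 F2]].
  have le : z0 - eta <= z0 + eta by rewrite lerD2l; lra.
  have ce : {within `[z0 - eta, z0 + eta], continuous (fun z => F (z, x))}.
    apply: continuous_in_subspaceT => z /set_mem; rewrite /= in_itv /= => /andP[z1 z2].
    have zd : `|z - z0| < d by rewrite ltr_norml; apply/andP; split; lra.
    have [D _] := is_derive_ds (Hd' z x zd xd).1.
    by apply/differentiable_continuous/derivable1_diffP.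
  have [|z] := IVT le ce (v := 0).
    by rewrite ge_min le_max (ltW F1) (ltW F2) orbT.
  rewrite in_itv /= => /andP[z1 z2] Fz; exists z => _; split=> //.
  have z1' : z0 - eta < z.
    by rewrite lt_neqAle z1 andbT; apply: contraTneq F1 => ->; rewrite Fz ltxx.
  have z2' : z < z0 + eta.
    by rewrite lt_neqAle z2 andbT; apply: contraTneq F2 => <-; rewrite Fz ltxx.
  rewrite ltr_norml; apply/andP; split; lra.
have [phi phiP] := choice ex.
have inj x a b : `|x - x0| < d -> `|a - z0| < d -> `|b - z0| < d ->
    F (a, x) = 0 -> F (b, x) = 0 -> a = b.
  move=> xd ad bd Fa Fb; have [ab|ba|//] := ltgtP a b.
    by have := mono x a b xd ad bd ab; rewrite Fa Fb ltxx.
  by have := mono x b a xd bd ad ba; rewrite Fa Fb ltxx.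
have rrd x : `|x - x0| < rr -> `|x - x0| < d by rewrite lt_min => /andP[].
have phid x : `|x - x0| < rr -> `|phi x - z0| < d.
  by move=> /phiP[H _]; exact: lt_trans etad.
pose W := [set x : V | `|x - x0| < rr].
have oW : open W.
  rewrite (_ : W = ball x0 rr); first exact: ball_open.
  by apply/seteqP; split=> x; rewrite -ball_normE /W /= distrC.
have phi_eq x z : `|x - x0| < rr -> `|z - z0| < d -> F (z, x) = 0 -> z = phi x.
  move=> xr zd Fz; apply: (inj x) => //; [exact: rrd|exact: phid|].
  by have [] := phiP x xr.
have phic x1 : W x1 -> {for x1, continuous phi}.
  move=> Wx1; have [p1 p2] := phiP x1 Wx1; apply/cvgrPdist_lt => e e0.
  pose e1 := Num.min (e / 2) (d / 2).
  have e10 : 0 < e1 by rewrite lt_min !divr_gt0.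
  have e1e : e1 < e by rewrite gt_min; apply/orP; left; rewrite ltr_pdivrMr// ltr_pMr// ltr1n.
  have e1d : e1 <= d / 2 by rewrite ge_min lexx orbT.
  have := p1; rewrite /eta ltr_norml => /andP[q1 q2].
  have m1 : `|phi x1 - e1 - z0| < d by rewrite ltr_norml; apply/andP; split; lra.
  have m2 : `|phi x1 + e1 - z0| < d by rewrite ltr_norml; apply/andP; split; lra.
  have nW : \forall x \near x1, W x by exact: open_nbhs_nbhs.
  have := near_and nW (sgn x1 (phi x1) e1 (rrd _ Wx1) p2 e10 m1 m2 (phid _ Wx1)).
  apply: filterS => x [Wx [F1 F2]]; have [r1 r2] := phiP x Wx.
  have xd := rrd _ Wx; have pd := phid _ Wx.
  rewrite ltr_norml; apply/andP; split.
    have [H|H] := leP (phi x1 + e1) (phi x); last by lra.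
    have : F (phi x1 + e1, x) <= F (phi x, x).
      by move: H; rewrite le_eqVlt => /predU1P[->//|H]; apply/ltW/mono.
    by rewrite r2 leNgt F2.
  have [H|H] := leP (phi x) (phi x1 - e1); last by lra.
  have : F (phi x, x) <= F (phi x1 - e1, x).
    by move: H; rewrite le_eqVlt => /predU1P[->//|H]; apply/ltW/mono.
  by rewrite r2 leNgt F1.
have Wx0 : W x0 by rewrite /W /= subrr normr0.
pose D := [set p : R * V | `|p - (z0, x0)| < d].
have oD : open D.
  rewrite (_ : D = ball (z0, x0) d); first exact: ball_open.
  by apply/seteqP; split=> x; rewrite -ball_normE /D /= distrC.
have FC := smg_Ck (fun p Dp => (Hd p Dp).1 : smg p F).
have dFC := smg_Ck (fun p Dp => smg_derive ((1 : R), (0 : V)) (Hd p Dp).1).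
have inD x : W x -> D (phi x, x).
  by move=> Wx; rewrite /D /= num_gt_max /= phid// rrd.
have phi_diff x : W x ->
    is_diff x phi (fun v => - ('d F (phi x, x) (0, v) / ds F (phi x, x))).
  move=> Wx; have [s1 s2] := Hd _ (inD x Wx).
  apply: implicit_is_diff => //; first exact: phic.
  have : \forall y \near x, W y by exact: open_nbhs_nbhs.
  by apply: filterS => y /phiP[].
exists phi; split.
- exists W; first by split.
  elim=> [|n IH]; first exact: phic.
  split=> [x /phi_diff[]//|].
  have oW' : open (W `*` [set: V]) by exact: openX_setT.
  have oD' : open (D `*` [set: (R * V)%type]) by exact: openX_setT.
  have G : Ck n (W `*` [set: V]) (fun p : V * V => (phi p.1, p.1)).
    apply: (@Ck_comp _ n _ _ _ _ W fst (fun x => (phi x, x))) => //.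
    - by move=> p [].
    - exact: Ck_fst.
    - apply: Ck_pair => //; apply: (@Ck_linear _ _ _ _ _ idfun) => x; exact: cvg_id.
  have T : Ck n (W `*` [set: V]) (fun p : V * V => tangent F ((phi p.1, p.1), ((0 : R), p.2))).
    apply: (@Ck_comp _ n _ _ _ _ (D `*` [set: (R * V)%type])
      (fun p : V * V => ((phi p.1, p.1), ((0 : R), p.2))) (tangent F)) => //.
    - by move=> p [Wp _]; split => //; exact: inD.
    - apply: Ck_pair => //; apply: Ck_pair => //; first exact: Ck_cst.
      exact: Ck_snd.
    - by have [] := FC n.+1.
  have I : Ck n (W `*` [set: V]) (fun p : V * V => (ds F (phi p.1, p.1))^-1).
    apply: (@Ck_comp _ n _ _ _ _ [set a : R | a != 0] (fun p : V * V => ds F (phi p.1, p.1)) GRing.inv) => //.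
    - by move=> p [Wp _] /=; rewrite gt_eqF//; have [] := Hd _ (inD _ Wp).
    - apply: (@Ck_comp _ n _ _ _ _ D (fun p : V * V => (phi p.1, p.1)) (ds F)) => //.
      by move=> p [Wp _]; exact: inD.
    - exact: Ck_inv.
  apply: (Ck_eq oW' _ (Ck_oppf oW' (Ck_mulf oW' T I))).
  by move=> [x v] [Wx _]; rewrite /tangent /=; have [_ ->] := phi_diff x Wx.
- by apply/esym; apply: phi_eq => //; rewrite subrr normr0.
- have : \forall y \near x0, W y by exact: open_nbhs_nbhs.
  by apply: filterS => y /phiP[].
- apply/near_norm; exists rr => // -[z x]; rewrite num_gt_max /= => /andP[zr xr] Fz.
  apply: phi_eq => //; apply: lt_le_trans zr _; rewrite ge_min lexx //.
Qed.

End ImplicitFunction.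

(** * Normal form of an unfolded cubic *)

Section GermCalculus.
Context {R : realType}.
Implicit Types U V W : normedModType R.

Lemma smg_app V V1 V2 W (F : V1 * V2 -> W) (a : V -> V1) (b : V -> V2) x p :
  (a x, b x) = p -> smg p F -> smg x a -> smg x b -> smg x (fun z => F (a z, b z)).
Proof.
move=> ab Fs sa sb.
exact: (@smg_comp _ _ _ _ x p (fun z => (a z, b z)) F ab (smg_pair sa sb) Fs).
Qed.

Lemma near_smg V W (x : V) (y : W) (g : V -> W) (P : W -> Prop) :
  g x = y -> smg x g -> (\forall z \near y, P z) -> \forall z \near x, P (g z).
Proof. by move=> <- /smg_continuous gc; exact: gc. Qed.

Lemma near_all V (x : V) (P : V -> Prop) : (forall z, P z) -> \forall z \near x, P z.
Proof. by move=> H; apply/near_norm; exists 1. Qed.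

Lemma near_self V (x : V) (P : V -> Prop) : (\forall z \near x, P z) -> P x.
Proof. by move=> /nbhs_singleton. Qed.

Lemma near_near V (x : V) (P : V -> Prop) : (\forall z \near x, P z) ->
  \forall z \near x, \forall w \near z, P w.
Proof.
move=> /near_norm[d d0 Hd]; apply/near_norm; exists (d / 2); first by rewrite divr_gt0.
move=> z zx; apply/near_norm; exists (d / 2); first by rewrite divr_gt0.
move=> w wz; apply: Hd; rewrite -(subrK z w) -addrA.
by apply: (le_lt_trans (ler_normD _ _)); rewrite [d]splitr; exact: ltrD.
Qed.

Lemma near_ds_eq V (p : R * V) (f g : R * V -> R) :
  (\forall q \near p, f q = g q) -> ds f p = ds g p.
Proof. exact: near_eq_derive. Qed.

Lemma ds_comp V (psi g : R * V -> R) (p : R * V) : smg p g -> smg (g p, p.2) psi ->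
  ds (fun q => psi (g q, q.2)) p = ds g p * ds psi (g p, p.2).
Proof.
case: p => s x gs ps.
have cs : smg (s, x) (fun q => psi (g q, q.2)) by apply: (smg_app erefl ps) => //; smg.
have [_ <-] := is_derive_ds cs.
have [_] := is_derive1_comp (f := fun u => psi (u, x)) (g := fun t => g (t, x))
  (is_derive_ds ps) (is_derive_ds gs).
by rewrite mulrC => <-.
Qed.

Lemma ds_mul V (f g : R * V -> R) (p : R * V) : smg p f -> smg p g ->
  ds (fun q => f q * g q) p = ds f p * g p + f p * ds g p.
Proof.
move=> fs gs; rewrite addrC [ds f p * _]mulrC.
exact: (deriveM (smg_derivable fs) (smg_derivable gs)).
Qed.

Lemma ds_add V (f g : R * V -> R) (p : R * V) : smg p f -> smg p g ->
  ds (fun q => f q + g q) p = ds f p + ds g p.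
Proof.
by move=> fs gs; exact: (deriveD (smg_derivable fs) (smg_derivable gs)).
Qed.

Lemma ds_opp V (f : R * V -> R) (p : R * V) : smg p f ->
  ds (fun q => - f q) p = - ds f p.
Proof. by move=> fs; exact: (deriveN (smg_derivable fs)). Qed.

Lemma ds_fst V (p : R * V) : ds (fun q : R * V => q.1) p = 1.
Proof. by have [_] := is_derive_fst p ((1 : R), (0 : V)). Qed.

Lemma ds_par V (f : V -> R) (p : R * V) : smg p.2 f ->
  ds (fun q : R * V => f q.2) p = 0.
Proof.
case: p => s x fs; have cs : smg (s, x) (fun q : R * V => f q.2).
  apply: (@smg_comp _ _ _ _ _ x (fun q : R * V => q.2) f) => //; smg.
by have [_ <-] := is_derive_ds cs; exact: (derive_cst (f x)).
Qed.

Lemma ds_cst V (c : R) (p : R * V) : ds (fun=> c) p = 0.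
Proof. exact: (derive_cst c). Qed.

Lemma ds_sqr V (f : R * V -> R) (p : R * V) : smg p f ->
  ds (fun q => f q ^+ 2) p = 2 * f p * ds f p.
Proof.
move=> fs; rewrite (_ : (fun q => _) = fun q => f q * f q).
  by rewrite ds_mul//; ring.
by apply/funext => q; rewrite expr2.
Qed.

Lemma ds_mulfst V (f g : R * V -> R) (p : R * V) : smg p g ->
  (\forall q \near p, f q = q.1 * g q) -> ds f p = g p + p.1 * ds g p.
Proof.
move=> gs fg; rewrite (near_ds_eq fg) (ds_mul (f := fun q => q.1))//; last by smg.
by rewrite ds_fst mul1r.
Qed.

Lemma near_snd V (x : V) (P : R * V -> Prop) :
  (\forall p \near ((0 : R), x), P p) -> \forall y \near x, P (0, y).
Proof. by apply: (@near_smg _ _ x (0, x) (fun y => ((0 : R), y))) => //; smg. Qed.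

(** Off the slice the factor cancels; on it both sides are differentiated in the first
    coordinate. *)
Lemma mulfst_cancel V (f g : R * V -> R) (x0 : V) : smg (0, x0) f -> smg (0, x0) g ->
  (\forall p \near ((0 : R), x0), p.1 * f p = p.1 * g p) ->
  \forall p \near ((0 : R), x0), f p = g p.
Proof.
move=> fs gs fg.
have := near_and (near_near fg) (near_and (smg_near fs) (smg_near gs)).
apply: filterS => -[t x] [H [ft gt]].
have [t0|t0] := eqVneq t 0; last first.
  by have /= := near_self H => /(mulfI t0).
subst t; have := near_ds_eq H.
have E (k : R * V -> R) : smg (0, x) k -> ds (fun q => q.1 * k q) (0, x) = k (0, x).
  by move=> ks; rewrite (ds_mulfst ks (near_all _ (fun=> erefl))) mul0r addr0.
by rewrite !E.
Qed.

(** Two divisions by the increment, with the base point as a parameter. The base point has to vary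
    because the expansion will be taken at s^2. *)
Lemma taylor2 V (G : R * V -> R) (x0 : V) : smg (0, x0) G ->
  exists2 B : R * (R * V) -> R, smg (0, (0, x0)) B &
    \forall q \near ((0 : R), ((0 : R), x0)),
      G q.2 = G (q.1, q.2.2) + (q.2.1 - q.1) * ds G (q.1, q.2.2)
        + (q.2.1 - q.1) ^+ 2 * B q.
Proof.
move=> Gs.
pose h (q : R * (R * V)) := G (q.1 + q.2.1, q.2.2) - G q.2.
have snd_s : smg (0, (0, x0)) (fun q : R * (R * V) => G q.2).
  by apply: (@smg_comp _ _ _ _ _ (0, x0) (fun q : R * (R * V) => q.2) G) => //; smg.
have sh_s : smg (0, (0, x0)) (fun q : R * (R * V) => G (q.1 + q.2.1, q.2.2)).
  by apply: (@smg_app _ _ _ _ G _ _ _ (0, x0)) => //; [rewrite /= addr0|smg|smg].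
have [|q1 [q1s q1E q10]] := smg_division (h := h) (smg_sub sh_s snd_s).
  by apply: near_all => -[t x]; rewrite /h /= add0r subrr.
have q1ps : smg (0, (0, x0)) (fun q : R * (R * V) => q1 (0, q.2)).
  by apply: (@smg_app _ _ _ _ q1 _ _ _ (0, (0, x0))) => //; smg.
have [|q2 [q2s q2E _]] := smg_division (h := fun q => q1 q - q1 (0, q.2)) (smg_sub q1s q1ps).
  by apply: near_all => -[t x] /=; rewrite subrr.
have h1 : \forall x \near (0, x0), q1 (0, x) = ds G x.
  have := near_and q10 (smg_near Gs); apply: filterS => -[t x] [-> Gtx].
  have gs : smg (0, (t, x)) (fun q : R * (R * V) => q.1 + q.2.1) by smg.
  have Gs1 : smg (0, (t, x)) (fun q : R * (R * V) => G (q.1 + q.2.1, q.2.2)).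
    by apply: (@smg_app _ _ _ _ G _ _ _ (t, x)) => //; [rewrite /= add0r|smg].
  have Gs2 : smg (0, (t, x)) (fun q : R * (R * V) => G q.2).
    by apply: (@smg_comp _ _ _ _ _ (t, x) (fun q : R * (R * V) => q.2) G) => //; smg.
  have hs : smg (0, (t, x)) h by exact: smg_sub.
  have [_ <-] := is_derive_ds hs.
  have D1 : is_derive (0 : R) (1 : R) (fun u : R => u + t) 1.
    have [D E] := is_deriveD (is_derive_id (0 : R) (1 : R)) (is_derive_cst t (0 : R) (1 : R)).
    by split => //; rewrite [LHS]E addr0.
  have D2 : is_derive (0 + t : R) (1 : R) (fun u : R => G (u, x)) (ds G (t, x)).
    by rewrite add0r; exact: is_derive_ds.
  have D3 := @is_derive1_comp _ (fun u => G (u, x)) (fun u => u + t) 0 _ _ D2 D1.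
  have [_] := is_deriveB D3 (is_derive_cst (G (t, x)) (0 : R) (1 : R)).
  by rewrite mulr1 subr0.
exists (fun q => q2 (q.2.1 - q.1, (q.1, q.2.2))).
  by apply: (@smg_app _ _ _ _ q2 _ _ _ (0, (0, x0))) => //; [rewrite /= subr0|smg|smg].
pose g (q : R * (R * V)) := (q.2.1 - q.1, (q.1, q.2.2)).
have gs : smg (0, (0, x0)) g by smg.
have g0 : g (0, (0, x0)) = (0, (0, x0)) by rewrite /g /= subr0.
pose g' (q : R * (R * V)) := (q.1, q.2.2).
have gs' : smg (0, (0, x0)) g' by smg.
have := near_and (near_smg g0 gs q1E) (near_and (near_smg g0 gs q2E)
   (near_smg (erefl : g' (0, (0, x0)) = (0, x0)) gs' h1)).
apply: filterS => -[t [e x]]; rewrite /g /g' /h /= => -[H1 [H2 H3]].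
rewrite subrK in H1; rewrite -H3.
have -> : G (e, x) = G (t, x) + (e - t) * q1 (e - t, (t, x)) by rewrite -H1; ring.
have -> : q1 (e - t, (t, x)) = q1 (0, (t, x)) + (e - t) * q2 (e - t, (t, x)).
  by rewrite -H2; ring.
ring.
Qed.

End GermCalculus.

(** * Morse coordinate with parameters *)

Section MorseCoordinate.
Opaque ds.
Context {R : realType}.
Implicit Types U V W : normedModType R.

Lemma ds_at V (f : R * V -> R) (s : R) (x : V) (d : R) : smg (s, x) f ->
  is_derive s (1 : R) (fun t => f (t, x)) d -> ds f (s, x) = d.
Proof. by move=> fs [_ <-]; have [_ <-] := is_derive_ds fs. Qed.

(** The function [ds phi] has a nondegenerate minimum in y at m(c), about which it is - e(c) + t^2
    r(t, c) with r > 0. Setting t = s tau gives s^2 - e(c) provided that tau^2 r(s tau, c) = 1; the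
    implicit function theorem solves this for tau, and no inversion of t sqrt r is needed. *)
Lemma morse_coordinate V (phi : R * V -> R) : smg (0, 0) phi ->
  ds phi (0, 0) = 0 -> ds (ds phi) (0, 0) = 0 -> 0 < ds (ds (ds phi)) (0, 0) ->
  exists (e : V -> R) (y : R * V -> R),
    [/\ smg 0 e, e 0 = 0, smg (0, 0) y, y (0, 0) = 0 /\ 0 < ds y (0, 0) &
      \forall p \near ((0 : R), (0 : V)), ds phi (y p, p.2) = p.1 ^+ 2 - e p.2].
Proof.
move=> ps p1 p2 p3.
have p1s : smg (0, 0) (ds phi) by exact: smg_derive.
have p2s : smg (0, 0) (ds (ds phi)) by exact: smg_derive.
have [m [ms m0 mE _]] := implicit_function p2s p2 p3.
pose h (p : R * V) := ds phi (m p.2 + p.1, p.2).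
have gs : smg (0, 0) (fun p : R * V => m p.2 + p.1).
  apply: smg_add; last by smg.
  by apply: (@smg_comp _ _ _ _ _ 0 (fun p : R * V => p.2) m) => //; smg.
have hs : smg (0, 0) h.
  by apply: (@smg_app _ _ _ _ _ (ds phi) _ _ _ (0, 0)) => //; [rewrite /= m0 addr0|smg].
have h0s : smg (0, 0) (fun p : R * V => h (0, p.2)).
  by apply: (@smg_app _ _ _ _ _ h _ _ _ (0, 0)) => //; smg.
have [|h1 [h1s h1E h10]] := smg_division (h := fun p => h p - h (0, p.2)) (smg_sub hs h0s).
  by apply: near_all => x; rewrite subrr.
have near_gs : \forall x \near (0 : V), smg (0, x) (fun p : R * V => m p.2 + p.1).
  exact: (near_snd (smg_near gs)).
have near_h : \forall x \near (0 : V), smg (m x, x) (ds phi).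
  apply: (@near_smg _ _ _ 0 (0, 0) (fun x => (m x, x)) (fun p => smg p (ds phi))).
  - by rewrite m0.
  - by smg.
  - exact: smg_near.
have ds_g p : smg p (fun p : R * V => m p.2 + p.1) -> smg p.2 m ->
    ds (fun p : R * V => m p.2 + p.1) p = 1.
  move=> gp mp; rewrite ds_add; [|by apply: (@smg_comp _ _ _ _ _ p.2 (fun p : R * V => p.2) m) => //; smg|smg].
  by rewrite ds_par// ds_fst add0r.
have h1z : \forall x \near (0 : V), h1 (0, x) = 0.
  have := near_and h10 (near_and mE (near_and near_gs (near_and near_h (smg_near ms)))).
  apply: filterS => x [-> [mx [gx [hx mx']]]].
  have hxs : smg (0, x) h.
    by apply: (@smg_app _ _ _ _ _ (ds phi) _ _ _ (m x, x)) => //; [rewrite /= addr0|smg].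
  have h0xs : smg (0, x) (fun p : R * V => h (0, p.2)).
    by apply: (@smg_app _ _ _ _ _ h _ _ _ (0, x)) => //; smg.
  rewrite ds_add//; last exact: smg_opp.
  rewrite ds_opp// (ds_par (f := fun y => h (0, y))); last first.
    by apply: (@smg_app _ _ _ _ _ h _ _ _ (0, x)) => //; smg.
  rewrite subr0 /h (ds_comp (psi := ds phi) (g := fun p : R * V => m p.2 + p.1))//=.
    by rewrite addr0 ds_g// mul1r.
  by rewrite addr0.
have [r [rs rE _]] := smg_division h1s h1z.
have hE : \forall p \near ((0 : R), (0 : V)), h p = h (0, p.2) + p.1 ^+ 2 * r p.
  have := near_and h1E rE; apply: filterS => p [H1 H2].
  by rewrite expr2 -mulrA -H2 -H1 addrC subrK.
have hsh : smg (0, 0) (ds h) by exact: smg_derive.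
have r00 : ds (ds (ds phi)) (0, 0) = 2 * r (0, 0).
  have dhE : \forall p \near ((0 : R), (0 : V)), ds h p = ds (ds phi) (m p.2 + p.1, p.2).
    have sn : smg ((0 : R), (0 : V)) (fun p : R * V => p.2) by smg.
    have n1 := near_smg (erefl : (fun p : R * V => p.2) (0, 0) = 0) sn (smg_near ms).
    have n2 : \forall p \near ((0 : R), (0 : V)), smg (m p.2 + p.1, p.2) (ds phi).
      apply: (@near_smg _ _ _ (0, 0) (0, 0) (fun p : R * V => (m p.2 + p.1, p.2)) (fun p => smg p (ds phi))).
      - by rewrite /= m0 addr0.
      - by smg.
      - exact: smg_near.
    have := near_and n1 (near_and n2 (smg_near gs)); apply: filterS => p [mp [hp gp]].
    by rewrite /h (ds_comp (psi := ds phi) (g := fun p : R * V => m p.2 + p.1))// ds_g// mul1r.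
  have dhE2 : \forall p \near ((0 : R), (0 : V)), ds h p = p.1 * (2 * r p + p.1 * ds r p).
    have := near_and (near_near hE) (near_and (smg_near rs) (smg_near h0s)).
    apply: filterS => p [H [rp hp]]; rewrite (near_ds_eq H) ds_add//; last first.
      by apply: smg_mul => //; smg.
    have -> : ds (fun q : R * V => h (0, q.2)) p = 0.
      case: p hp {H rp} => t x hp.
      exact: (ds_at hp (is_derive_cst (h (0, x)) t (1 : R))).
    rewrite add0r ds_mul//; last by smg.
    by rewrite ds_sqr; [rewrite ds_fst; ring|smg].
  have rs2 : smg (0, 0) (fun p : R * V => 2 * r p + p.1 * ds r p).
    have drs : smg (0, 0) (ds r) by exact: smg_derive.
    by smg.
  have E1 : ds (ds h) (0, 0) = 2 * r (0, 0).
    by rewrite (ds_mulfst rs2 dhE2) mul0r mul0r !addr0.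
  have gs0 : smg (m 0 + 0, 0) (ds (ds phi)) by rewrite m0 addr0; exact: p2s.
  have E2 : ds (fun p : R * V => ds (ds phi) (m p.2 + p.1, p.2)) (0, 0)
      = ds (fun p : R * V => m p.2 + p.1) (0, 0) * ds (ds (ds phi)) (m 0 + 0, 0).
    exact: (ds_comp gs gs0).
  have E3 : ds (fun p : R * V => m p.2 + p.1) (0, 0) = 1 by exact: ds_g.
  have E4 : ds (ds h) (0, 0) = ds (fun p : R * V => ds (ds phi) (m p.2 + p.1, p.2)) (0, 0).
    exact: near_ds_eq.
  have M : (m 0 + 0, 0) = (0, 0) :> R * V by rewrite m0 addr0.
  have key (a b c d f k : R) : a = b -> a = c -> c = d * f -> d = 1 -> f = k -> k = b.
    by move=> -> -> -> -> ->; rewrite mul1r.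
  exact: (key _ _ _ _ _ _ E1 E4 E2 E3 (congr1 (ds (ds (ds phi))) M)).
have r0 : 0 < r (0, 0).
  by move: p3; rewrite r00 pmulr_rgt0.
pose r_ := r (0, 0).
(* The value of tau at the origin, where the equation reads tau^2 r(0, 0) = 1. *)
pose t0 := (Num.sqrt r_)^-1.
have t00 : 0 < t0 by rewrite invr_gt0 sqrtr_gt0.
have t0r : t0 ^+ 2 * r_ = 1.
  by rewrite /t0 exprVn sqr_sqrtr ?(ltW r0)// mulVf// gt_eqF.
pose F (q : R * (R * V)) := q.1 ^+ 2 * r (q.2.1 * q.1, q.2.2) - 1.
have Fs : smg (t0, (0, 0)) F.
  apply: smg_add; last by smg.
  apply: smg_mul; first by smg.
  by apply: (@smg_app _ _ _ _ _ r _ _ _ (0, 0)) => //; [rewrite /= mul0r|smg|smg].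
have F0 : F (t0, (0, 0)) = 0 by rewrite /F /= mul0r -/r_ t0r subrr.
have dF : ds F (t0, (0, 0)) = 2 * t0 * r_.
  apply: ds_at => //; rewrite /F /=.
  rewrite (_ : (fun t => _) = fun t : R => r_ * t ^+ 2 - 1); last first.
    by apply/funext => t; rewrite mul0r -/r_ mulrC.
  have [D1 D2] := is_deriveX 2 (is_derive_id t0 (1 : R)).
  have D : is_derive t0 (1 : R) (fun t : R => t ^+ 2) (2 * t0).
    by split; [exact: exprn_derivable|rewrite exp_derive /= [_ *: 1]mulr1 expr1].
  have [E1 E2] := is_deriveB (is_deriveZ r_ D) (is_derive_cst (1 : R) t0 (1 : R)).
  by split => //; rewrite [LHS]E2 subr0; exact: mulrC.
have dF0 : 0 < ds F (t0, (0, 0)) by rewrite dF !mulr_gt0.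
have [tau [taus tau0 tauE _]] := implicit_function Fs F0 dF0.
pose y (p : R * V) := m p.2 + p.1 * tau p.
have mss : smg ((0 : R), (0 : V)) (fun p : R * V => m p.2).
  by apply: (@smg_comp _ _ _ _ _ 0 (fun p : R * V => p.2) m) => //; smg.
have ys : smg (0, 0) y by rewrite /y; smg.
have es : smg (0 : V) (fun x => - h (0, x)).
  by apply: smg_opp; apply: (@smg_app _ _ _ _ _ h _ _ _ (0, 0)) => //; smg.
exists (fun x => - h (0, x)), y; split => //.
- by rewrite /h /= m0 addr0 p1 oppr0.
- split; first by rewrite /y /= m0 mul0r addr0.
  have ss : smg ((0 : R), (0 : V)) (fun p : R * V => p.1 * tau p) by smg.
  have Y1 : ds y (0, 0) = ds (fun p : R * V => m p.2) (0, 0)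
      + ds (fun p : R * V => p.1 * tau p) (0, 0) := ds_add mss ss.
  have Y2 : ds (fun p : R * V => m p.2) (0, 0) = 0 := ds_par (p := (0, 0)) ms.
  have Y3 : ds (fun p : R * V => p.1 * tau p) (0, 0) = tau (0, 0) + 0 * ds tau (0, 0).
    exact: (ds_mulfst taus (near_all _ (fun=> erefl))).
  by rewrite Y1 Y2 Y3 mul0r addr0 add0r tau0.
pose g (p : R * V) := (p.1 * tau p, p.2).
have g_s : smg (0, 0) g by rewrite /g; smg.
have g0 : g (0, 0) = (0, 0) by rewrite /g /= mul0r.
have := near_and tauE (near_smg g0 g_s hE); apply: filterS => -[s x] /=.
rewrite /g /F /h /y /= => -[H1 H2]; rewrite H2 opprK [RHS]addrC; congr (_ + _).
move/eqP : H1; rewrite subr_eq0 => /eqP H1.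
by rewrite exprMn -mulrA H1 mulr1.
Qed.

End MorseCoordinate.

(** * Legendre transform and reduction to a cubic *)

Section CubicReduction.
Context {R : realType}.
Implicit Types U V W : normedModType R.

(** The Legendre transform y A - phi has differential y dA: the terms in the derivative of [y]
    cancel, as [phi] has slope [A] at [y]. *)
Lemma ds_legendre V (y phi A : R * V -> R) (p : R * V) :
  smg p y -> smg (y p, p.2) phi -> smg p A -> ds phi (y p, p.2) = A p ->
  ds A p = 2 * p.1 ->
  ds (fun q => (y q * A q - phi (y q, q.2)) * 2^-1) p = p.1 * y p.
Proof.
move=> ys ps As pA dA.
have cs : smg p (fun q => phi (y q, q.2)) by apply: (smg_app erefl ps ys); smg.
have ms : smg p (fun q => y q * A q) by exact: smg_mul.
have E1 := ds_comp ys ps.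
have E2 := ds_mul ys As.
have E3 := ds_add ms (smg_opp cs).
have E4 := ds_opp cs.
have E5 := ds_mul (smg_add ms (smg_opp cs)) (smg_cst p (2^-1 : R)).
have E6 := ds_cst (2^-1 : R) p.
by rewrite [LHS]E5 E3 E4 E2 E1 E6 dA pA mulr0 addr0; field.
Qed.

Lemma ds_square V (f : R * V -> R) (p : R * V) : smg (p.1 ^+ 2, p.2) f ->
  ds (fun q => f (q.1 ^+ 2, q.2)) p = 2 * p.1 * ds f (p.1 ^+ 2, p.2).
Proof.
move=> fs; have s1 : smg p (fun q : R * V => q.1) by smg.
rewrite (@ds_comp _ _ f (fun q : R * V => q.1 ^+ 2) p (smg_exp 2 s1) fs).
by rewrite (ds_sqr s1) ds_fst mulr1.
Qed.

Lemma smg_square V (f : R * V -> R) (x : V) : smg (0, x) f ->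
  smg (0, x) (fun q : R * V => f (q.1 ^+ 2, q.2)).
Proof.
by move=> fs; apply: (@smg_app _ _ _ _ _ f _ _ _ (0, x)) => //; [rewrite /= expr0n|smg|smg].
Qed.

Lemma near_square V (x : V) (P : R * V -> Prop) :
  (\forall p \near ((0 : R), x), P p) ->
  \forall p \near ((0 : R), x), P (p.1 ^+ 2, p.2).
Proof.
apply: (@near_smg _ _ _ (0, x) (0, x) (fun p : R * V => (p.1 ^+ 2, p.2))) => //; last by smg.
by rewrite /= expr0n.
Qed.

(** Write Om = f(s^2) + s g(s^2). The relation Om_s = s y at s = 0 gives g = 0 at 0, hence g(t) = t
    H(t) and y = 2 f'(s^2) + s (3 H + 2 s^2 H')(s^2). In (s^2 - a) y - 2 Om the even part is -2
    times the first-order Taylor polynomial of f at s^2, evaluated at a; the odd part is s (s^2 - 3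
    a) H(a) up to a multiple of (s^2 - a)^2. Hence the coefficient 3 H of the cubic. *)
Lemma legendre_cubic V (y Om : R * V -> R) (x0 : V) : smg (0, x0) y -> smg (0, x0) Om ->
  (\forall p \near ((0 : R), x0), ds Om p = p.1 * y p) ->
  exists (f k : R * V -> R) (B : R * (R * V) -> R),
    [/\ smg (0, x0) f, smg (0, x0) k, smg (0, (0, x0)) B, k (0, x0) = ds y (0, x0) &
      \forall q \near ((0 : R), ((0 : R), x0)),
        (q.1 ^+ 2 - q.2.1) * y (q.1, q.2.2) - 2 * Om (q.1, q.2.2)
        = f q.2 + k q.2 * (q.1 ^+ 3 / 3 - q.2.1 * q.1)
          + (q.1 ^+ 2 - q.2.1) ^+ 2 * B q].
Proof.
move=> ys Oms dOm; have [f [g [fs gs OmE]]] := whitney Oms.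
have fqs := smg_square fs; have gqs := smg_square gs.
have Ds (h : R * V -> R) : smg (0, x0) h -> \forall p \near ((0 : R), x0),
    ds (fun q : R * V => h (q.1 ^+ 2, q.2)) p = 2 * p.1 * ds h (p.1 ^+ 2, p.2).
  move=> hs; have := near_square (smg_near hs).
  by apply: filterS => p hp; exact: ds_square.
have g0 : \forall x \near x0, g (0, x) = 0.
  have := near_snd (near_and (near_near OmE) (near_and dOm (near_and (Ds f fs)
    (near_and (smg_near fqs) (smg_near gqs))))).
  apply: filterS => x [H [dx [Dfx [fx gx]]]].
  have s1 : smg (0, x) (fun q : R * V => q.1) by smg.
  have E1 := near_ds_eq H.
  have E2 := ds_add fx (smg_mul s1 gx).
  have E3 := ds_mulfst gx (near_all _ (fun=> erefl)).
  have E4 : 0 * y (0, x) = 2 * 0 * ds f (0 ^+ 2, x) + (g (0 ^+ 2, x) + 0 * ds (fun q : R * V => g (q.1 ^+ 2, q.2)) (0, x)).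
    by rewrite -[LHS]dx E1 E2 [X in X + _]Dfx E3.
  by move: E4; rewrite !(mul0r, mulr0) expr0n !(addr0, add0r) => <-.
have [H [Hs HE _]] := smg_division gs g0.
have Hqs := smg_square Hs.
have fds : smg (0, x0) (ds f) by exact: smg_derive.
have Hds : smg (0, x0) (ds H) by exact: smg_derive.
have fdqs := smg_square fds; have Hdqs := smg_square Hds.
pose u (p : R * V) := 3 * H (p.1 ^+ 2, p.2) + 2 * p.1 ^+ 2 * ds H (p.1 ^+ 2, p.2).
have us : smg (0, x0) u by rewrite /u; smg.
have OmE2 : \forall p \near ((0 : R), x0),
    Om p = f (p.1 ^+ 2, p.2) + p.1 * (p.1 ^+ 2 * H (p.1 ^+ 2, p.2)).
  have := near_and OmE (near_square HE); apply: filterS => p [-> /= ->].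
  by rewrite mulrA.
have yE : \forall p \near ((0 : R), x0), y p = 2 * ds f (p.1 ^+ 2, p.2) + p.1 * u p.
  apply: mulfst_cancel => //; first by smg.
  have := near_and (near_near OmE2) (near_and dOm (near_and (near_and (Ds f fs) (Ds H Hs))
    (near_and (smg_near fqs) (smg_near Hqs)))).
  apply: filterS => p [HO [dx [[Dfp DHp] [fp Hp]]]].
  have s1 : smg p (fun q : R * V => q.1) by smg.
  have s2 : smg p (fun q : R * V => q.1 ^+ 2) by smg.
  have E1 := near_ds_eq HO.
  have s3 := smg_mul s2 Hp.
  have E2 := ds_add fp (smg_mul s1 s3).
  have E3 := ds_mulfst s3 (near_all _ (fun=> erefl)).
  have E4 := ds_mul s2 Hp.
  have E5 := ds_sqr s1.
  rewrite -[LHS]dx E1 E2 [X in X + _]Dfp E3 E4 E5 ds_fst DHp /u; ring.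
have dy0 : 3 * H (0, x0) = ds y (0, x0).
  have E1 := near_ds_eq yE.
  have s1 : smg (0, x0) (fun q : R * V => q.1) by smg.
  have c2 : smg (0, x0) (fun q : R * V => 2 : R) by smg.
  have E2 := ds_add (smg_mul c2 fdqs) (smg_mul s1 us).
  have E3 := ds_mulfst us (near_all _ (fun=> erefl)).
  have E4 := ds_mul c2 fdqs.
  have fd0 : smg ((0 : R) ^+ 2, x0) (ds f) by rewrite expr0n.
  have E5 := @ds_square _ (ds f) (0, x0) fd0.
  by rewrite [RHS]E1 E2 E3 E4 E5 ds_cst /u /= expr0n /=; ring.
have [B0 B0s B0E] := taylor2 fs.
have [B1 B1s B1E] := taylor2 Hs.
pose sq (q : R * (R * V)) := (q.1 ^+ 2, q.2).
pose sc (q : R * (R * V)) := (q.1, q.2.2).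
have sqs : smg (0, (0, x0)) sq by smg.
have scs : smg (0, (0, x0)) sc by smg.
have sq0 : sq (0, (0, x0)) = (0, (0, x0)) by rewrite /sq /= expr0n.
have sc0 : sc (0, (0, x0)) = (0, x0) by [].
have B0q := smg_square B0s; have B1q := smg_square B1s.
exists (fun x => -2 * f x), (fun x => 3 * H x),
  (fun q => 2 * B0 (q.1 ^+ 2, q.2)
     + q.1 * (3 * ds H (q.1 ^+ 2, q.2.2) - (q.1 ^+ 2 - 3 * q.2.1) * B1 (q.1 ^+ 2, q.2))).
split=> //; [by smg|by smg| |].
  have dHq : smg (0, (0, x0)) (fun q : R * (R * V) => ds H (q.1 ^+ 2, q.2.2)).
    by apply: (@smg_app _ _ _ _ _ (ds H) _ _ _ (0, x0)) => //; [rewrite /= expr0n|smg|smg].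
  by smg.
have := near_and (near_smg sc0 scs (near_and yE OmE2)) (near_and (near_smg sq0 sqs B0E) (near_smg sq0 sqs B1E)).
apply: filterS => -[s [e x]]; rewrite /sc /sq /u /= => -[[-> ->] [-> ->]].
move: (f _) (ds f _) (B0 _) (H _) (ds H _) (B1 _) => f0 f1 b0 h0 h1 b1.
by field.
Qed.

(** With Z = s + (s^2 - a) zeta the cubic changes by (s^2 - a)^2 (zeta + s zeta^2 + (s^2 - a) zeta^3
    / 3). At s = a = 0 the last factor is zeta, so the implicit function theorem makes k times it
    equal to [B]. *)
Lemma cubic_absorb V (k : R * V -> R) (B : R * (R * V) -> R) (x0 : V) :
  smg (0, x0) k -> 0 < k (0, x0) -> smg (0, (0, x0)) B ->
  exists Z : R * (R * V) -> R, [/\ smg (0, (0, x0)) Z, Z (0, (0, x0)) = 0,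
    ds Z (0, (0, x0)) = 1 &
    \forall q \near ((0 : R), ((0 : R), x0)),
      k q.2 * (q.1 ^+ 3 / 3 - q.2.1 * q.1) + (q.1 ^+ 2 - q.2.1) ^+ 2 * B q
      = k q.2 * (Z q ^+ 3 / 3 - q.2.1 * Z q)].
Proof.
move=> ks k0 Bs; set o := (0, (0, x0)) in Bs *.
pose F (q : R * (R * (R * V))) :=
  k q.2.2 * (q.1 + q.2.1 * q.1 ^+ 2 + (q.2.1 ^+ 2 - q.2.2.1) * q.1 ^+ 3 * 3^-1) - B q.2.
pose z0 := B o / k (0, x0).
have kqs : smg (z0, o) (fun q : R * (R * (R * V)) => k q.2.2).
  by apply: (@smg_comp _ _ _ _ _ (0, x0) (fun q : R * (R * (R * V)) => q.2.2) k) => //; smg.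
have Bqs : smg (z0, o) (fun q : R * (R * (R * V)) => B q.2).
  by apply: (@smg_comp _ _ _ _ _ o (fun q : R * (R * (R * V)) => q.2) B) => //; smg.
have Fs : smg (z0, o) F by rewrite /F; smg.
have FE (t : R) : F (t, o) = k (0, x0) * t - B o.
  by rewrite /F /= expr0n /= !(mul0r, subr0, addr0).
have F0 : F (z0, o) = 0.
  by rewrite FE /z0 mulrC divfK ?subrr// gt_eqF.
have dF : ds F (z0, o) = k (0, x0).
  apply: ds_at => //; rewrite (funext FE).
  have [D1 D2] := is_deriveB (is_deriveZ (k (0, x0)) (is_derive_id z0 (1 : R)))
    (is_derive_cst (B o) z0 (1 : R)).
  by split => //; rewrite [LHS]D2 subr0; exact: mulr1.
have dF0 : 0 < ds F (z0, o) by rewrite dF.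
have [zeta [zs zeta0 zE _]] := implicit_function Fs F0 dF0.
exists (fun q => q.1 + (q.1 ^+ 2 - q.2.1) * zeta q).
have s1 : smg o (fun q : R * (R * V) => q.1) by smg.
have s2 : smg o (fun q : R * (R * V) => q.1 ^+ 2) by smg.
have s3 : smg o (fun q : R * (R * V) => q.2.1) by smg.
have s3' : smg (0, x0) (fun q : R * V => q.1) by smg.
have s4 := smg_add s2 (smg_opp s3).
split.
- by smg.
- by rewrite /= expr0n /= subrr mul0r addr0.
- have E1 := ds_add s1 (smg_mul s4 zs).
  have E2 := ds_mul s4 zs.
  have E3 := ds_add s2 (smg_opp s3).
  have E4 := ds_opp s3.
  have E5 := ds_sqr s1.
  have E6 := ds_par (p := o) s3'.
  rewrite [LHS]E1 E2 E3 E4 E5 E6 ds_fst /= expr0n /=; ring.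
apply: filterS zE => -[s [e x]]; rewrite /F /= => /eqP; rewrite subr_eq0 => /eqP <-.
by move: (k _) (zeta _) => a b; field.
Qed.

End CubicReduction.

Section NormalForm.
Context {R : realType}.
Implicit Types U V W : normedModType R.

(** The reduction takes place in the coordinate s; the inverse S of s |-> y(s, c) carries it back to
    the output, and z is Z at s = S. The sign of k at the origin is that of the derivative of y. *)
Lemma normal_form V (phi : R * V -> R) : smg (0, 0) phi ->
  ds phi (0, 0) = 0 -> ds (ds phi) (0, 0) = 0 -> 0 < ds (ds (ds phi)) (0, 0) ->
  exists (e : V -> R) (f k : R * V -> R) (z : R * (R * V) -> R),
    [/\ smg 0 e /\ e 0 = 0, smg (0, 0) f, smg (0, 0) k /\ 0 < k (0, 0),
        [/\ smg (0, (0, 0)) z, z (0, (0, 0)) = 0 & 0 < ds z (0, (0, 0))] &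
      \forall q \near ((0 : R), ((0 : R), (0 : V))),
        phi (q.1, q.2.2) + (e q.2.2 - q.2.1) * q.1
        = f q.2 + k q.2 * (z q ^+ 3 / 3 - q.2.1 * z q)].
Proof.
move=> ps p1 p2 p3.
have [e [y [es e0 ys [y0 dy0] yE]]] := morse_coordinate ps p1 p2 p3.
pose A (p : R * V) := p.1 ^+ 2 - e p.2.
pose Om (p : R * V) := (y p * A p - phi (y p, p.2)) * 2^-1.
have s1 (p : R * V) : smg p (fun q : R * V => q.1) by smg.
have s2 (p : R * V) : smg p (fun q : R * V => q.1 ^+ 2) by smg.
have eps (p : R * V) : smg p.2 e -> smg p (fun q : R * V => e q.2).
  by move=> H; apply: (@smg_comp _ _ _ _ _ p.2 (fun q : R * V => q.2) e) => //; smg.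
have es0 := eps (0, 0) es.
have As : smg (0, 0) A by rewrite /A; smg.
have cs : smg (0, 0) (fun q => phi (y q, q.2)).
  by apply: (@smg_app _ _ _ _ _ phi _ _ _ (0, 0)) => //; [rewrite /= y0|smg].
have Oms : smg (0, 0) Om by rewrite /Om; smg.
have sn : smg ((0 : R), (0 : V)) (fun p : R * V => p.2) by smg.
have yps : smg (0, 0) (fun p : R * V => (y p, p.2)) by smg.
have yp0 : (fun p : R * V => (y p, p.2)) (0, 0) = (0, 0) by rewrite /= y0.
have dOm : \forall p \near ((0 : R), (0 : V)), ds Om p = p.1 * y p.
  have n1 := near_smg (erefl : (fun p : R * V => p.2) (0, 0) = 0) sn (smg_near es).
  have n2 := near_smg yp0 yps (smg_near ps).
  have := near_and yE (near_and (smg_near ys) (near_and n1 (near_and n2 (smg_near As)))).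
  apply: filterS => p [H1 [H2 [H3 [H4 H5]]]].
  apply: ds_legendre => //.
  have E1 := ds_add (s2 p) (smg_opp (eps p H3)).
  have E2 := ds_opp (eps p H3).
  have E3 := ds_par (p := p) H3.
  have E4 := ds_sqr (s1 p).
  by rewrite [LHS]E1 E2 E3 E4 ds_fst subr0 mulr1.
have [f [k [B [fs ks Bs k0 LE]]]] := legendre_cubic ys Oms dOm.
have kpos : 0 < k (0, 0) by rewrite k0.
have [Z [Zs Z0 dZ0 ZE]] := cubic_absorb ks kpos Bs.
pose F (q : R * (R * V)) := y (q.1, q.2.2) - q.2.1.
have scs : smg (0, (0, 0)) (fun q : R * (R * V) => (q.1, q.2.2)) by smg.
have yqs : smg (0, (0, 0)) (fun q : R * (R * V) => y (q.1, q.2.2)).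
  by apply: (@smg_app _ _ _ _ _ y _ _ _ (0, 0)) => //; smg.
have Fs : smg (0, (0, 0)) F by rewrite /F; smg.
have F0 : F (0, (0, 0)) = 0 by rewrite /F /= y0 subrr.
have dF : ds F (0, (0, 0)) = ds y (0, 0).
  apply: ds_at => //; rewrite /F /=.
  have [D1 D2] := is_deriveB (is_derive_ds ys) (is_derive_cst (0 : R) (0 : R) (1 : R)).
  by split => //; rewrite [LHS]D2 subr0.
have dF0 : 0 < ds F (0, (0, 0)) by rewrite dF.
have [S [Ss S0 SE _]] := implicit_function Fs F0 dF0.
have SE' : \forall p \near ((0 : R), (0 : V)), y (S p, p.2) = p.1.
  by apply: filterS SE => p /eqP; rewrite /F /= subr_eq0 => /eqP.
have dS : 0 < ds S (0, 0).
  have ys0 : smg (S (0, 0), (0 : V)) y by rewrite S0.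
  have E1 := near_ds_eq SE'.
  have E2 : ds (fun p : R * V => y (S p, p.2)) (0, 0) = ds S (0, 0) * ds y (S (0, 0), 0).
    exact: (ds_comp Ss ys0).
  have E3 : ds (fun p : R * V => p.1) (0, 0) = 1 by exact: ds_fst.
  have E4 : ds y (S (0, 0), 0) = ds y (0, 0) by rewrite S0.
  have E5 : ds S (0, 0) * ds y (0, 0) = 1 by rewrite -E3 -E1 E2 E4.
  by rewrite -(pmulr_lgt0 _ dy0) E5.
pose g (q : R * (R * V)) := S (q.1, q.2.2).
have gs : smg (0, (0, 0)) g.
  by apply: (@smg_app _ _ _ _ _ S _ _ _ (0, 0)) => //; smg.
have g0 : g (0, (0, 0)) = 0 by rewrite /g.
have zs : smg (0, (0, 0)) (fun q => Z (g q, q.2)).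
  by apply: (@smg_app _ _ _ _ _ Z _ _ _ (0, (0, 0))) => //; [rewrite g0|smg].
exists e, f, k, (fun q => Z (g q, q.2)); split => //.
- split => //; first by rewrite g0.
  have Zs0 : smg (g (0, (0, 0)), ((0 : R), (0 : V))) Z by rewrite g0.
  have E1 : ds (fun q => Z (g q, q.2)) (0, (0, 0))
     = ds g (0, (0, 0)) * ds Z (g (0, (0, 0)), (0, 0)) by exact: (ds_comp gs Zs0).
  have E2 : ds g (0, (0, 0)) = ds S (0, 0) := ds_at gs (is_derive_ds Ss).
  have E3 : ds Z (g (0, (0, 0)), (0, 0)) = 1 by rewrite g0.
  by rewrite E1 E2 E3 mulr1.
have gqs : smg (0, (0, 0)) (fun q : R * (R * V) => (g q, q.2)) by smg.
have gq0 : (fun q : R * (R * V) => (g q, q.2)) (0, (0, 0)) = (0, (0, 0)) by rewrite g0.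
have := near_and (near_smg gq0 gqs (near_and LE ZE))
   (near_smg (erefl : (fun q : R * (R * V) => (q.1, q.2.2)) (0, (0, 0)) = (0, 0)) scs SE').
apply: filterS => -[t [a c]]; rewrite /g /= => -[[H1 H2] H3].
by rewrite -H2 addrA -H1 /Om /A /= H3; field.
Qed.

End NormalForm.

(** * Sigmoids *)

Local Notation "f ^` ()" := (derive1 f) : ring_scope.
Local Notation "f ^` ( n )" := (derive1n n f) : ring_scope.

Section SigmoidDerivatives.
Context {R : realType} (S : R -> R).
Hypothesis Sb : sigmoid_base S.

Lemma sigmoid_smg (x : R) : smg x S.
Proof.
case: Sb => Ss _ _ _ _; exists setT; first by split=> //; exact: openT.
exact: (smooth_on_Ck openT).
Qed.

Lemma sigmoid_smgn n (x : R) : smg x S^`(n).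
Proof.
elim: n x => [|n IH] x; first exact: sigmoid_smg.
rewrite derive1nS (_ : _^`() = 'D_1 S^`(n)); first exact: smg_derive.
by apply/funext => z; rewrite derive1E.
Qed.

Lemma sigmoid_is_derive n (x : R) : is_derive x (1 : R) S^`(n) (S^`(n.+1) x).
Proof.
rewrite derive1nS derive1E; apply: derivableP; exact: smg_derivable (sigmoid_smgn n x).
Qed.

Lemma sigmoid_mvt n (a b : R) : a < b ->
  exists2 c, a < c < b & S^`(n) b - S^`(n) a = S^`(n.+1) c * (b - a).
Proof.
move=> ab; have [||c] := @MVT R S^`(n) S^`(n.+1) a b ab.
- by move=> x _; exact: sigmoid_is_derive.
- apply: continuous_subspaceT => x; exact: smg_continuous (sigmoid_smgn n x).
by rewrite in_itv /= => cab E; exists c.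
Qed.

Lemma sigmoid_parity n (x : R) : S^`(n) (- x) = (-1) ^+ n.+1 * S^`(n) x.
Proof.
elim: n x => [|n IH] x; first by case: Sb => _ So *; rewrite derive1n0 expr1 mulN1r So.
have H1 : is_derive x (1 : R) (fun u : R => S^`(n) (- u)) (- S^`(n.+1) (- x)).
  rewrite -mulrN1; have N : is_derive x (1 : R) (fun u : R => - u) (-1).
    exact: (is_deriveN (is_derive_id x (1 : R))).
  exact: (@is_derive1_comp _ S^`(n) (fun u => - u) x _ _ (sigmoid_is_derive n (- x)) N).
have H2 : is_derive x (1 : R) (fun u : R => (-1) ^+ n.+1 * S^`(n) u) ((-1) ^+ n.+1 * S^`(n.+1) x).
  exact: (is_deriveZ ((-1) ^+ n.+1) (sigmoid_is_derive n x)).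
have E : (fun u : R => S^`(n) (- u)) = (fun u : R => (-1) ^+ n.+1 * S^`(n) u).
  by apply/funext.
rewrite E in H1; apply: oppr_inj; have := @derive_val _ _ _ _ _ _ _ H1; rewrite (@derive_val _ _ _ _ _ _ _ H2).
by move=> E2; rewrite exprS mulN1r mulNr opprK -E2.
Qed.

Lemma sigmoid0 : S 0 = 0.
Proof. have := sigmoid_parity 0 0; rewrite oppr0 derive1n0 expr1; lra. Qed.

Lemma sigmoid2_0 : S^`(2) 0 = 0.
Proof. have := sigmoid_parity 2 0; rewrite oppr0 !exprS expr0; lra. Qed.

Lemma sigmoid1_even (x : R) : S^`(1) (- x) = S^`(1) x.
Proof. by rewrite sigmoid_parity exprS expr1; ring. Qed.

Hypothesis S2 : even_derivative_sign S 1.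

Lemma sigmoid2_neg (x : R) : 0 < x -> S^`(2) x < 0.
Proof.
move=> x0; have := S2 (lt0r_neq0 x0); rewrite (gtr0_sg x0) -sgr_lt0 => ->.
by rewrite oppr_lt0 ltr01.
Qed.

(** A positive value would make the second derivative positive just to the right of 0, against the
    sign condition; the value 0 is excluded by [sigmoid_base]. *)
Lemma sigmoid3_0 : S^`(3) 0 < 0.
Proof.
have n0 : S^`(3) 0 != 0 by case: Sb => _ _ _ _ [/(_ 1%N)].
rewrite lt_neqAle n0 /= leNgt; apply/negP => p0.
have : \forall x \near (0 : R), 0 < S^`(3) x.
  exact: cvgr_gt (smg_continuous (sigmoid_smgn 3 0)) _ p0.
move=> /near_norm[d d0 Hd].
have d2 : 0 < d / 2 by rewrite divr_gt0.
have [c /andP[c0 cd]] := sigmoid_mvt 2 d2.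
rewrite sigmoid2_0 !subr0 => E.
have cd' : `|c - 0| < d.
  by rewrite subr0 gtr0_norm//; apply: lt_trans cd _; rewrite ltr_pdivrMr// ltr_pMr// ltr1n.
have Hc := Hd c cd'.
have := sigmoid2_neg d2; rewrite E ltNge => /negP; apply.
exact: ltW (mulr_gt0 Hc d2).
Qed.

End SigmoidDerivatives.

(** The functions stand for four consecutive derivatives, linked only by the mean value property. *)
Lemma decreasing_slope_absurd (R : realType) (h1 h2 h3 h4 : R -> R) :
  (forall a b, a < b -> exists2 c, a < c < b & h1 b - h1 a = h2 c * (b - a)) ->
  (forall a b, a < b -> exists2 c, a < c < b & h2 b - h2 a = h3 c * (b - a)) ->
  (forall a b, a < b -> exists2 c, a < c < b & h3 b - h3 a = h4 c * (b - a)) ->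
  (forall x, 0 < h1 x) -> h2 0 = 0 -> h3 0 < 0 -> ~ (forall x, 0 < x -> h4 x < 0).
Proof.
move=> M1 M2 M3 h1p h20 h30 h4n.
have h3x x : 0 < x -> h3 x < h3 0.
  move=> x0; have [c /andP[c0 _] E] := M3 _ _ x0.
  by rewrite -subr_lt0 E subr0 nmulr_rlt0// h4n.
have h2x x : 1 <= x -> h2 x < h3 0.
  move=> x1; have x0 : 0 < x by lra.
  have [c /andP[c0 _]] := M2 _ _ x0.
  rewrite h20 !subr0 => ->; have := h3x c c0 => H.
  have : h3 c * x <= h3 c by rewrite -[leRHS]mulr1 ler_wnM2l//; lra.
  lra.
(* The length after 1 on which a slope equal to h3 0 would bring h1 down to 0. *)
pose t := h1 1 / - h3 0; have t0 : 0 < t by rewrite divr_gt0// oppr_gt0.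
have t1 : 1 < 1 + t by rewrite ltrDl.
have [c /andP[c1 _]] := M1 _ _ t1.
rewrite [1 + t]addrC addrK => E; have := h2x c (ltW c1); rewrite -(ltr_pM2r t0) -E.
have -> : h3 0 * t = - h1 1 by rewrite /t; field; rewrite lt_eqF.
have := h1p (t + 1); lra.
Qed.

Lemma sigmoidal_absurd (R : realType) (S : R -> R) : ~ sigmoidal S.
Proof.
move=> [Sb Sn]; have S3 := sigmoid3_0 Sb (Sn 1%N isT).
have Sp : forall x, 0 < S^`(1) x by case: (Sb).
apply: (decreasing_slope_absurd (sigmoid_mvt Sb 1) (sigmoid_mvt Sb 2) (sigmoid_mvt Sb 3)
  Sp (sigmoid2_0 Sb) S3).
move=> x x0; have := Sn 2%N isT _ (lt0r_neq0 x0); rewrite (gtr0_sg x0) => H.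
by rewrite -sgr_lt0 H oppr_lt0 ltr01.
Qed.

Lemma smg_is_derive (R : realType) (x : R) (f : R -> R) : smg x f ->
  is_derive x (1 : R) f ('D_1 f x).
Proof. by move=> fs; apply: derivableP; exact: smg_derivable. Qed.

Lemma derive_lift (R : realType) (V : normedModType R) (p : R * V) (f : R -> R) :
  smg p.1 f -> ds (fun q : R * V => f q.1) p = 'D_1 f p.1.
Proof.
case: p => y x fs; have cs : smg (y, x) (fun q : R * V => f q.1).
  by apply: (@smg_comp _ _ _ _ _ y (fun q : R * V => q.1) f) => //; smg.
by have [_ <-] := is_derive_ds cs.
Qed.

Lemma is_derive_near_eq (R : realType) (x a b : R) (f g : R -> R) :
  (\forall z \near x, f z = g z) -> is_derive x (1 : R) f a -> is_derive x (1 : R) g b -> a = b.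
Proof. by move=> fg [_ <-] [_ <-]; exact: near_eq_derive. Qed.

Lemma is_derive_mulR (R : realType) (x a b : R) (f g : R -> R) :
  is_derive x (1 : R) f a -> is_derive x (1 : R) g b ->
  is_derive x (1 : R) (fun z => f z * g z) (a * g x + f x * b).
Proof. by move=> fa gb; rewrite addrC [a * _]mulrC; exact: is_deriveM fa gb. Qed.

Lemma is_derive_compR (R : realType) (x a b : R) (f g : R -> R) :
  is_derive (g x) (1 : R) f a -> is_derive x (1 : R) g b ->
  is_derive x (1 : R) (fun z => f (g z)) (a * b).
Proof. by move=> fa gb; exact: is_derive1_comp fa gb. Qed.

Section ThirdDerivativeOfInverse.
Context {R : realType} (s0 s1 s2 s3 t : R -> R).
Hypotheses (s01 : forall x : R, is_derive x (1 : R) s0 (s1 x))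
  (s12 : forall x : R, is_derive x (1 : R) s1 (s2 x))
  (s23 : forall x : R, is_derive x (1 : R) s2 (s3 x)).
Hypotheses (ts : smg (0 : R) t) (t0 : t 0 = 0) (st : \forall x \near (0 : R), s0 (t x) = x).
Hypotheses (s10 : s1 0 = 1) (s20 : s2 0 = 0).

Let t1 := 'D_(1 : R) t.
Let t2 := 'D_(1 : R) t1.
Let t3 := 'D_(1 : R) t2.

(** The identity s0 (t x) = x is differentiated three times; as the second derivatives vanish at 0,
    the last one reduces to s3 0 + t3 0 = 0. *)
Lemma inverse_derivatives : [/\ t1 0 = 1, t2 0 = 0 & t3 0 = - s3 0].
Proof.
have t1s : smg (0 : R) t1 := smg_derive _ ts.
have t2s : smg (0 : R) t2 := smg_derive _ t1s.
have E1 : \forall x \near (0 : R), s1 (t x) * t1 x = 1.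
  have := near_and (near_near st) (smg_near ts); apply: filterS => x [Hx tx].
  apply: (is_derive_near_eq Hx _ (is_derive_id x (1 : R))).
  exact: (is_derive1_comp (s01 (t x)) (smg_is_derive tx)).
have E2 : \forall x \near (0 : R), (s2 (t x) * t1 x) * t1 x + s1 (t x) * t2 x = 0.
  have := near_and (near_near E1) (near_and (smg_near ts) (smg_near t1s)).
  apply: filterS => x [Hx [tx t1x]].
  have H := is_derive_mulR (is_derive_compR (s12 (t x)) (smg_is_derive tx)) (smg_is_derive t1x).
  exact: is_derive_near_eq Hx H (is_derive_cst (1 : R) x (1 : R)).
have E3 : ((s3 (t 0) * t1 0 * t1 0 + s2 (t 0) * t2 0) * t1 0 + (s2 (t 0) * t1 0) * t2 0)
    + (s2 (t 0) * t1 0 * t2 0 + s1 (t 0) * t3 0) = 0.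
  have D2 := is_derive_compR (s23 (t 0)) (smg_is_derive ts).
  have D1 := is_derive_compR (s12 (t 0)) (smg_is_derive ts).
  have Da := is_derive_mulR D2 (smg_is_derive t1s).
  have Db := is_derive_mulR Da (smg_is_derive t1s).
  have Dc := is_derive_mulR D1 (smg_is_derive t2s).
  exact: is_derive_near_eq E2 (is_deriveD Db Dc) (is_derive_cst (0 : R) (0 : R) (1 : R)).
rewrite t0 in E3; have := near_self E2; have := near_self E1; rewrite t0 s10 s20 !mul1r !mul0r add0r => e1 e2.
by split=> //; move: E3; rewrite e1 e2 s10 s20; lra.
Qed.

End ThirdDerivativeOfInverse.

Lemma slice_derive (R : realType) (V : normedModType R) (phi : R * V -> R) (f : R -> R) :
  smg (0, 0) phi -> (\forall y \near (0 : R), phi (y, 0) = f y) ->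
  smg (0, 0) (ds phi) /\ (\forall y \near (0 : R), ds phi (y, 0) = 'D_(1 : R) f y).
Proof.
move=> ps pf; split; first exact: smg_derive.
have sl : smg (0 : R) (fun y : R => (y, (0 : V))) by smg.
have := near_and (near_near pf) (near_smg erefl sl (smg_near ps)).
apply: filterS => y [H psy]; have [_ <-] := is_derive_ds psy.
exact: near_eq_derive H.
Qed.

(** * The loop solved for the input *)

Section SigmoidGap.
Context {R : realType} (S : R -> R).
Hypothesis Sb : sigmoid_base S.
Hypothesis S2 : even_derivative_sign S 1.

(* [S x - S x'] is divided by [x - x'], where [x' = f y + y] solves [S x' = y]. *)
Lemma feedback_loop_solved : exists (m : R * R * R -> R) (f : R -> R),
  [/\ smg (0, 0, 0) m /\ 0 < m (0, 0, 0), smg (0 : R) f /\ f 0 = 0,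
    'D_(1 : R) f 0 = 0 /\ 'D_(1 : R) ('D_(1 : R) f) 0 = 0,
    0 < 'D_(1 : R) ('D_(1 : R) ('D_(1 : R) f)) 0 &
    \forall w \near (0, 0, 0),
      feedback_loop S w.1.1 w.1.2 w.2 = m w * (w.1.2 - (f w.1.1 - w.2 * w.1.1))].
Proof.
have S1 : S^`(1) 0 = 1 by case: Sb => _ _ _ _ [_].
pose F (p : R * R) := S p.1 - p.2.
have Ss x p : smg (p : R * R) x -> smg p (fun q => S (x q)).
  by move=> xs; apply: (smg_comp erefl xs); exact: (sigmoid_smg Sb).
have Fs p : smg p F by apply: smg_sub; [apply: Ss; smg|smg].
have dF : ds F (0, 0) = 1.
  have [_ <-] := is_derive_ds (Fs (0, 0)).
  have [_ E] := is_deriveB (sigmoid_is_derive Sb 0 (0 : R)) (is_derive_cst (0 : R) (0 : R) (1 : R)).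
  by apply: (etrans E); rewrite subr0.
have [||t [ts t0 St _]] := implicit_function (Fs (0, 0)).
- by rewrite /F /= (sigmoid0 Sb) subrr.
- by rewrite dF.
have {}St : \forall y \near (0 : R), S (t y) = y.
  by apply: filterS St => y; rewrite /F /= => /eqP; rewrite subr_eq0 => /eqP.
have [t1 t2 t3] := inverse_derivatives (sigmoid_is_derive Sb 0) (sigmoid_is_derive Sb 1)
  (sigmoid_is_derive Sb 2) ts t0 St S1 (sigmoid2_0 Sb).
pose h (p : R * R) := S (p.2 + p.1) - S p.2.
have hs : smg (0, 0) h by apply: smg_sub; apply: Ss; smg.
have [|q [qs qE q0]] := smg_division hs.
  by apply: near_all => x; rewrite /h /= addr0 subrr.
have q00 : q (0, 0) = 1.
  rewrite (near_self q0); have [_ <-] := is_derive_ds hs.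
  have D1 : is_derive (0 : R) (1 : R) (fun z : R => 0 + z) 1.
    rewrite -[X in is_derive _ _ _ X]add0r.
    exact: is_deriveD (is_derive_cst (0 : R) (0 : R) (1 : R)) (is_derive_id (0 : R) (1 : R)).
  have D2 : is_derive (0 + 0 : R) (1 : R) S (S^`(1) 0).
    by rewrite addr0; exact: (sigmoid_is_derive Sb 0).
  have D3 := is_derive_compR (g := fun z : R => 0 + z) D2 D1.
  have [_ E] := is_deriveB D3 (is_derive_cst (S 0) (0 : R) (1 : R)).
  by apply: (etrans E); rewrite S1 mulr1 subr0.
pose f (y : R) := t y - y.
have fs : smg (0 : R) f by apply: smg_sub; smg.
(* The first entry is the argument y + u + a y of [S] minus [t y], the second is the base point of
   that increment. *)
pose g (w : R * R * R) := (w.1.2 - (f w.1.1 - w.2 * w.1.1), t w.1.1).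
have cs (k : R -> R) : smg (0 : R) k -> smg (0, 0, 0) (fun w : R * R * R => k w.1.1).
  by move=> ks; apply: (@smg_comp _ _ _ _ _ (0 : R) (fun w : R * R * R => w.1.1) k) => //; smg.
have gs : smg (0, 0, 0) g.
  apply: smg_pair; last exact: cs.
  by apply: smg_sub; [smg|apply: smg_sub; [exact: cs|smg]].
have g0 : g (0, 0, 0) = (0, 0) by rewrite /g /f /= t0 mul0r !subr0.
have f1 : \forall y \near (0 : R), 'D_(1 : R) f y = 'D_(1 : R) t y - 1.
  have := smg_near ts; apply: filterS => y ty.
  by have [_] := is_deriveB (smg_is_derive ty) (is_derive_id y (1 : R)).
have ts1 : smg (0 : R) ('D_(1 : R) t) := smg_derive _ ts.
have ts2 : smg (0 : R) ('D_(1 : R) ('D_(1 : R) t)) := smg_derive _ ts1.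
have f2 : \forall y \near (0 : R), 'D_(1 : R) ('D_(1 : R) f) y = 'D_(1 : R) ('D_(1 : R) t) y.
  have := near_and (near_near f1) (smg_near ts1); apply: filterS => y [Hy ty].
  rewrite (near_eq_derive _ Hy).
  have [_ E] := is_deriveB (smg_is_derive ty) (is_derive_cst (1 : R) y (1 : R)).
  by apply: (etrans E); rewrite subr0.
have f3 := near_eq_derive (1 : R) f2.
exists (fun w => q (g w)), f; split.
- by split; [exact: smg_comp g0 gs qs|rewrite g0 q00].
- by split; [exact: fs|rewrite /f t0 subrr].
- by split; [rewrite (near_self f1) t1 subrr|rewrite (near_self f2) t2].
- by rewrite f3 t3 oppr_gt0 sigmoid3_0.
- have E1 := near_smg g0 gs qE.
  have p1 : smg (0, 0, 0) (fun w : R * R * R => w.1.1) by smg.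
  have E2 := near_smg erefl p1 St.
  have := near_and E1 E2; apply: filterS => -[[y u] a]; rewrite /g /h /f /= => -[H1 H2].
  rewrite mulrC -H1 /feedback_loop H2 [RHS]addrC; congr (- _ + S _); ring.
Qed.

End SigmoidGap.

(** * Universal unfolding *)

Lemma ds_reparam (R : realType) (V W : normedModType R) (z : R * W -> R) (k : V -> W) y x :
  smg (y, k x) z -> smg x k ->
  smg (y, x) (fun p => z (p.1, k p.2)) /\ ds (fun p => z (p.1, k p.2)) (y, x) = ds z (y, k x).
Proof.
move=> zs ks; have ss : smg (y, x) (fun p : R * V => k p.2).
  by apply: (@smg_comp _ _ _ _ _ x (fun p : R * V => p.2) k) => //; smg.
have s1 : smg (y, x) (fun p : R * V => p.1) by smg.
have zks := smg_app (erefl (y, k x)) zs s1 ss; split; first exact: zks.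
by have [_ E] := is_derive_ds zks; have [_ E'] := is_derive_ds zs; rewrite -E E'.
Qed.

Lemma near_gt0 (R : realType) (V : normedModType R) (g : V -> R) x :
  smg x g -> 0 < g x -> \forall y \near x, 0 < g y.
Proof. by move=> gs g0; exact: cvgr_gt (smg_continuous gs) _ g0. Qed.

Lemma near_ds_gt0 (R : realType) (V : normedModType R) (z : R * V -> R) p :
  smg p z -> 0 < ds z p -> \forall q \near p, smg q z /\ 0 < ds z q.
Proof.
move=> zs dz; apply: near_and (smg_near zs) _.
exact: near_gt0 (smg_derive _ zs) dz.
Qed.

Section SlicedNormalForm.
Context {R : realType} (f : R -> R).
Hypotheses (f1 : 'D_(1 : R) f 0 = 0) (f2 : 'D_(1 : R) ('D_(1 : R) f) 0 = 0).
Hypothesis f3 : 0 < 'D_(1 : R) ('D_(1 : R) ('D_(1 : R) f)) 0.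

(** The conditions of [normal_form] are on derivatives along the first axis at the origin, hence on
    the slice at parameter 0 alone. *)
Lemma sliced_normal_form (V : normedModType R) (phi : R * V -> R) :
  smg (0, 0) phi -> (\forall y \near (0 : R), phi (y, 0) = f y) ->
  exists (e : V -> R) (h k : R * V -> R) (z : R * (R * V) -> R),
    [/\ smg 0 e /\ e 0 = 0, smg (0, 0) h, smg (0, 0) k /\ 0 < k (0, 0),
        [/\ smg (0, (0, 0)) z, z (0, (0, 0)) = 0 & 0 < ds z (0, (0, 0))] &
      \forall q \near ((0 : R), ((0 : R), (0 : V))),
        phi (q.1, q.2.2) + (e q.2.2 - q.2.1) * q.1
          = h q.2 + k q.2 * (z q ^+ 3 / 3 - q.2.1 * z q)].
Proof.
move=> ps p0; have [p1s p1] := slice_derive ps p0.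
have [p2s p2] := slice_derive p1s p1.
have [p3s p3] := slice_derive p2s p2.
have E1 : ds phi (0, 0) = 0 := etrans (near_self p1) f1.
have E2 : ds (ds phi) (0, 0) = 0 := etrans (near_self p2) f2.
have E3 : 0 < ds (ds (ds phi)) (0, 0) by rewrite (near_self p3).
exact: normal_form ps E1 E2 E3.
Qed.

Hypotheses (fs : smg (0 : R) f) (f0 : f 0 = 0).

(** The normal form of a family constant in its parameter, read at parameter 0, where e vanishes. *)
Lemma parametrized_cubic : exists (h k : R -> R) (z : R * R -> R),
  [/\ smg (0 : R) h /\ h 0 = 0, smg (0 : R) k /\ 0 < k 0,
      [/\ smg (0, 0) z, z (0, 0) = 0 & 0 < ds z (0, 0)] &
    \forall q \near ((0 : R), (0 : R)),
      f q.1 - q.2 * q.1 = h q.2 + k q.2 * (z q ^+ 3 / 3 - q.2 * z q)].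
Proof.
have ls : smg ((0 : R), (0 : R)) (fun q : R * R => f q.1).
  by apply: (@smg_comp _ _ _ _ _ (0 : R) (fun q : R * R => q.1) f) => //; smg.
have [e [h [k [z [[es e0] hs [ks k0] [zs z0 dz] H]]]]] :=
  sliced_normal_form ls (near_all _ (fun=> erefl)).
have as_ : smg (0 : R) (fun a : R => (a, (0 : R))) by smg.
have qs : smg ((0 : R), (0 : R)) (fun q : R * R => (q.1, (q.2, (0 : R)))) by smg.
have {}H := near_smg (erefl : (fun q : R * R => (q.1, (q.2, (0 : R)))) (0, 0) = _) qs H.
have [zs' dz'] := ds_reparam zs as_.
have h0 : h (0, 0) = 0.
  by have := near_self H; rewrite /= z0 f0 e0 subrr mul0r !addr0 exprS !mul0r subrr mulr0 addr0.
exists (fun a => h (a, 0)), (fun a => k (a, 0)), (fun q => z (q.1, (q.2, 0))); split.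
- by split; [exact: smg_comp as_ hs|].
- by split; [exact: smg_comp as_ ks|].
- split; [exact: zs'|exact: z0|by rewrite dz'].
- by apply: filterS H => q /= <-; rewrite e0 sub0r mulNr.
Qed.

End SlicedNormalForm.

Lemma cube_root (R : realType) (x : R) : 0 < x -> exists2 r : R, 0 < r & r ^+ 3 = x.
Proof.
move=> x0; exists (expR (ln x / 3)); first exact: expR_gt0.
by rewrite -expRM_natl -mulr_natl mulrCA divff ?mulr1 ?lnK.
Qed.

Section Family.
Context {R : realType} (G : R -> R -> R -> R) (m : R * R * R -> R) (f : R -> R).
Hypotheses (ms : smg (0, 0, 0) m) (m0 : 0 < m (0, 0, 0)).
Hypotheses (fs : smg (0 : R) f) (f0 : f 0 = 0).
Hypotheses (f1 : 'D_(1 : R) f 0 = 0) (f2 : 'D_(1 : R) ('D_(1 : R) f) 0 = 0).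
Hypothesis f3 : 0 < 'D_(1 : R) ('D_(1 : R) ('D_(1 : R) f)) 0.
Hypothesis GE : \forall w \near (0, 0, 0),
  G w.1.1 w.1.2 w.2 = m w * (w.1.2 - (f w.1.1 - w.2 * w.1.1)).

Lemma family_strongly_equivalent : strongly_equivalent (fun y u => G y u 0) g_hy_rev.
Proof.
have [h [k [z [[hs h0] [ks k0] [zs z0 dz] H]]]] := parametrized_cubic f1 f2 f3 fs f0.
(* At a = 0 the normal form reads f = k(0) z^3 / 3, that is (r z)^3. *)
have [r r0 r3] := cube_root (divr_gt0 k0 (ltr0Sn R 2)).
have cs : smg (0 : R) (fun=> (0 : R)) by smg.
have [zys dzy] := ds_reparam zs cs.
have ws : smg ((0 : R), (0 : R)) (fun p : R * R => (p.1, p.2, (0 : R))) by smg.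
have mws := @smg_comp _ _ _ _ _ _ _ m erefl ws ms.
have rzs : smg ((0 : R), (0 : R)) (fun p : R * R => r * z (p.1, 0)) by smg.
have drz : 0 < ds (fun p : R * R => r * z (p.1, 0)) (0, 0).
  rewrite (ds_mul (smg_cst _ r) zys) ds_cst mul0r add0r dzy; exact: mulr_gt0.
exists (fun y _ => r * z (y, 0)), (fun y u => m (y, u, 0)); split.
- exact: smg_smooth_near rzs.
- apply: (@smg_smooth_near _ _ (0 : R * R) (fun p : R * R => m (p.1, p.2, 0))); exact: mws.
- by rewrite z0 mulr0.
have ys : smg ((0 : R), (0 : R)) (fun p : R * R => (p.1, (0 : R))) by smg.
have n1 := near_ds_gt0 rzs drz.
have n2 : \forall p \near (0, 0), 0 < m (p.1, p.2, 0) := near_gt0 mws m0.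
have n3 := near_smg erefl ws GE.
have n4 := near_smg erefl ys H.
have := near_and n1 (near_and n2 (near_and n3 n4)).
apply: filterS => -[y u] /= [[sy dy] [my [gy fy]]]; split.
- by rewrite derive1E; have [_ ->] := is_derive_ds sy.
- exact: my.
have h00 : h 0 = 0 by [].
rewrite gy; congr (_ * _); rewrite /g_hy_rev /g_hy exprMn r3.
rewrite -[f y - _]/(f y - 0 * y) fy h0; ring.
Qed.
End Family.

Section UniversalUnfolding.
Context {R : realType} (G : R -> R -> R -> R) (m : R * R * R -> R) (f : R -> R).
Hypotheses (ms : smg (0, 0, 0) m) (m0 : 0 < m (0, 0, 0)).
Hypotheses (fs : smg (0 : R) f) (f0 : f 0 = 0).
Hypotheses (f1 : 'D_(1 : R) f 0 = 0) (f2 : 'D_(1 : R) ('D_(1 : R) f) 0 = 0).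
Hypothesis f3 : 0 < 'D_(1 : R) ('D_(1 : R) ('D_(1 : R) f)) 0.
Hypothesis GE : \forall w \near (0, 0, 0),
  G w.1.1 w.1.2 w.2 = m w * (w.1.2 - (f w.1.1 - w.2 * w.1.1)).

Section Perturbation.
Variable p : R * R -> R.
Hypothesis ps : smg (0, 0) p.

(* Input is the unknown; coordinates are (u, (y, c)). *)
Let F (q : R * (R * R)) := m (q.2.1, q.1, 0) * (q.1 - f q.2.1) + q.2.2 * p (q.2.1, q.1).

Lemma perturbed_family_smg : smg (0, (0, 0)) F.
Proof.
have s1 : smg ((0 : R), ((0 : R), (0 : R))) (fun q : R * (R * R) => (q.2.1, q.1, (0 : R))) by smg.
have s2 : smg ((0 : R), ((0 : R), (0 : R))) (fun q : R * (R * R) => (q.2.1, q.1)) by smg.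
have s3 : smg ((0 : R), ((0 : R), (0 : R))) (fun q : R * (R * R) => q.2.1) by smg.
have ms' := @smg_comp _ _ _ _ _ _ _ m erefl s1 ms.
have ps' := @smg_comp _ _ _ _ _ _ _ p erefl s2 ps.
have fs' := @smg_comp _ _ _ _ _ _ _ f erefl s3 fs.
apply: smg_add; last by apply: smg_mul; [smg|exact: ps'].
by apply: smg_mul; [exact: ms'|apply: smg_sub; [smg|exact: fs']].
Qed.

Lemma perturbed_family_ds : ds F (0, (0, 0)) = m (0, 0, 0).
Proof.
have [_ <-] := is_derive_ds perturbed_family_smg.
have ss : smg (0 : R) (fun u : R => ((0 : R), u, (0 : R))) by smg.
have D1 := smg_is_derive (@smg_comp _ _ _ _ _ _ _ m erefl ss ms).
have [_ E] := is_derive_mulR D1 (is_derive_id (0 : R) (1 : R)).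
rewrite mulr0 add0r mulr1 in E; apply: (etrans _ E); congr ('D_(1 : R) _ (0 : R)).
by apply/funext => u; rewrite /F /= f0 subr0 mul0r addr0.
Qed.

(** The cofactor m1 matters as much as the solution phi: its reduction to m at c = 0 will make Q
    equal to 1 there. On the zero set itself this reduction needs the cancellation
    [mulfst_cancel]. *)
Lemma perturbed_family_solved : exists (phi : R * R -> R) (m1 : R * (R * R) -> R),
  [/\ smg (0, 0) phi /\ (\forall y \near (0 : R), phi (y, 0) = f y),
      smg (0, (0, 0)) m1,
      \forall q \near (0, (0, 0)), F q = m1 q * (q.1 - phi q.2) &
      \forall q \near ((0 : R), (0 : R)), m1 (q.1, (q.2, 0)) = m (q.2, q.1, 0)].
Proof.
have Fs := perturbed_family_smg.
have F0 : F (0, (0, 0)) = 0 by rewrite /F /= f0 subrr mulr0 mul0r addr0.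
have dF : 0 < ds F (0, (0, 0)) by rewrite perturbed_family_ds.
have [phi [phs ph0 Fphi Funiq]] := implicit_function Fs F0 dF.
have cs : smg (0 : R) (fun y : R => (y, (0 : R))) by smg.
have phf : \forall y \near (0 : R), phi (y, 0) = f y.
  have gs : smg (0 : R) (fun y : R => (f y, (y, (0 : R)))) by apply: smg_pair; smg.
  have g0 : (f 0, (0, 0)) = (0, (0, 0)) :> R * (R * R) by rewrite f0.
  apply: filterS (near_smg g0 gs Funiq) => y; rewrite /F /= subrr mulr0 mul0r addr0.
  by move=> /(_ erefl).
pose h (q : R * (R * R)) := F (phi q.2 + q.1, q.2).
have hs : smg (0, (0, 0)) h.
  have s1 : smg (0, (0, 0)) (fun q : R * (R * R) => phi q.2 + q.1).
    apply: smg_add; last by smg.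
    by apply: (@smg_comp _ _ _ _ _ (0, 0) (fun q : R * (R * R) => q.2) phi) => //; smg.
  have s2 : smg (0, (0, 0)) (fun q : R * (R * R) => q.2) by smg.
  have E0 : (phi (0, 0) + 0, (0, 0)) = (0, (0, 0)) :> R * (R * R) by rewrite ph0 addr0.
  exact: (@smg_comp R _ _ _ (0, (0, 0)) (0, (0, 0)) (fun q : R * (R * R) => (phi q.2 + q.1, q.2)) F E0 (smg_pair s1 s2) Fs).
have [|q [qs qE _]] := smg_division hs.
  by apply: filterS Fphi => x; rewrite /h /= addr0.
have ss : smg (0, (0, 0)) (fun q : R * (R * R) => (q.1 - phi q.2, q.2)).
  apply: smg_pair; last by smg.
  apply: smg_sub; first by smg.
  by apply: (@smg_comp _ _ _ _ _ (0, 0) (fun q : R * (R * R) => q.2) phi) => //; smg.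
have s0 : (0 - phi (0, 0), (0, 0)) = (0, (0, 0)) :> R * (R * R) by rewrite ph0 subrr.
exists phi, (fun x => q (x.1 - phi x.2, x.2)); split.
- by split; [exact: phs|exact: phf].
- exact: smg_comp s0 ss qs.
- have := near_smg s0 ss qE; apply: filterS => -[u x] /=.
  by rewrite /h /= addrC subrK mulrC.
have rs : smg ((0 : R), (0 : R)) (fun x : R * R => (x.1, (x.2, (0 : R)))) by smg.
have ms1 : smg ((0 : R), (0 : R)) (fun x : R * R => m (x.2, f x.2 + x.1, 0)).
  have s1 : smg ((0 : R), (0 : R)) (fun x : R * R => (x.2, f x.2 + x.1, (0 : R))).
    apply: smg_pair; last by smg.
    apply: smg_pair; first by smg.
    apply: smg_add; last by smg.
    by apply: (@smg_comp _ _ _ _ _ (0 : R) (fun q : R * R => q.2) f) => //; smg.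
  by apply: (@smg_comp _ _ _ _ _ _ _ m _ s1 ms); rewrite /= f0 addr0.
have qs1 : smg ((0 : R), (0 : R)) (fun x : R * R => q (x.1, (x.2, 0))).
  exact: (@smg_comp _ _ _ _ _ _ _ q erefl rs qs).
have ys : smg ((0 : R), (0 : R)) (fun x : R * R => x.2) by smg.
have n1 : \forall x \near ((0 : R), (0 : R)),
    x.1 * q (x.1, (x.2, 0)) = x.1 * m (x.2, f x.2 + x.1, 0).
  have := near_and (near_smg erefl rs qE) (near_smg erefl ys phf).
  apply: filterS => -[t y] /= [<- E].
  by rewrite /h /F /= E [f y + t]addrC addrK mul0r addr0 mulrC.
have n2 := mulfst_cancel qs1 ms1 n1.
have ts : smg ((0 : R), (0 : R)) (fun x : R * R => (x.1 - f x.2, x.2)).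
  apply: smg_pair; last by smg.
  apply: smg_sub; first by smg.
  by apply: (@smg_comp _ _ _ _ _ (0 : R) (fun q : R * R => q.2) f) => //; smg.
have t0 : (0 - f 0, 0) = (0, 0) :> R * R by rewrite f0 subrr.
have := near_and (near_smg t0 ts n2) (near_smg erefl ys phf).
by apply: filterS => -[u y] /= [E ->]; rewrite E addrC subrK.
Qed.

End Perturbation.

(** At the common value a = e(c) the slices c and 0 are affine images of the same cubic in z.
    Equality of the two values of z defines Y, the affine map between the images defines U, and A =
    e. Then U - (f Y - e(c) Y) is [kap c] times u - phi(y, c), and Q is the quotient of the
    remaining factors. *)
Lemma family_universal_unfolding : universal_unfolding (fun y u => G y u 0) G.
Proof.
split.
- have sG : smg (0, 0, 0) (fun w : R * R * R => G w.1.1 w.1.2 w.2).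
    have fs1 : smg ((0 : R), (0 : R), (0 : R)) (fun w : R * R * R => f w.1.1).
      by apply: (@smg_comp _ _ _ _ _ (0 : R) (fun w : R * R * R => w.1.1) f) => //; smg.
    apply: (@smg_eq _ _ _ _ (fun w => m w * (w.1.2 - (f w.1.1 - w.2 * w.1.1)))).
      by apply: filterS GE => w ->.
    apply: smg_mul; first exact: ms.
    by apply: smg_sub; [smg|apply: smg_sub; [exact: fs1|smg]].
  exact: smg_smooth_near sG.
- by apply: near_all.
move=> p /smooth_near_smg2 ps.
have [phi [m1 [[phs phf] m1s m1E m10]]] := perturbed_family_solved ps.
have [e [h [k [z [[es e0] hs [ks k0] [zs z0 dz] H]]]]] := sliced_normal_form f1 f2 f3 phs phf.
have es2 : smg ((0 : R), (0 : R)) (fun q : R * R => e q.2).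
  by apply: (@smg_comp _ _ _ _ _ (0 : R) (fun q : R * R => q.2) e) => //; smg.
have es3 : smg ((0 : R), (0 : R), (0 : R)) (fun w : R * R * R => e w.2).
  by apply: (@smg_comp _ _ _ _ _ (0 : R) (fun w : R * R * R => w.2) e) => //; smg.
have ec0s : smg (0 : R) (fun c : R => (e c, (0 : R))) by smg.
have ecs : smg (0 : R) (fun c : R => (e c, c)) by smg.
have E0 : (e 0, 0) = (0, 0) :> R * R by rewrite e0.
have h0s : smg (0 : R) (fun c => h (e c, 0)) := smg_comp E0 ec0s hs.
have hcs : smg (0 : R) (fun c => h (e c, c)) := smg_comp E0 ecs hs.
have k0s : smg (0 : R) (fun c => k (e c, 0)) := smg_comp E0 ec0s ks.
have kcs : smg (0 : R) (fun c => k (e c, c)) := smg_comp E0 ecs ks.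
pose kap c := k (e c, 0) / k (e c, c).
have kap0 : kap 0 = 1 by rewrite /kap E0 divff// gt_eqF.
have kaps : smg (0 : R) kap.
  by apply: smg_mul; [exact: k0s|apply: smg_inv; [rewrite E0 gt_eqF|exact: kcs]].
(* Y solves z(Y, e(c), 0) = z(y, e(c), c); local uniqueness gives Y(y, 0) = y. *)
pose F2 (q : R * (R * R)) := z (q.1, (e q.2.2, 0)) - z (q.2.1, (e q.2.2, q.2.2)).
have [F2s dF2] : smg ((0 : R), ((0 : R), (0 : R))) F2 /\ 0 < ds F2 (0, (0, 0)).
  have as_ : smg ((0 : R), (0 : R)) (fun x : R * R => (e x.2, (0 : R))) by smg.
  have zE : smg ((0 : R), (e 0, (0 : R))) z by rewrite E0.
  have [s1 d1] := ds_reparam (k := fun x : R * R => (e x.2, (0 : R))) (y := 0) (x := (0, 0)) zE as_.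
  have bs : smg ((0 : R), (0 : R)) (fun x : R * R => (x.1, (e x.2, x.2))) by smg.
  have b0 : (0, (e 0, 0)) = (0, (0, 0)) :> R * (R * R) by rewrite e0.
  have s2 := @smg_comp R _ _ _ (0, 0) (0, (0, 0)) (fun x : R * R => (x.1, (e x.2, x.2))) z b0 bs zs.
  have s3 : smg ((0 : R), ((0 : R), (0 : R))) (fun q : R * (R * R) => z (q.2.1, (e q.2.2, q.2.2))).
    have s4 : smg ((0 : R), ((0 : R), (0 : R))) (fun q : R * (R * R) => q.2) by smg.
    exact: (@smg_comp R _ _ _ _ _ (fun q : R * (R * R) => q.2)
      (fun x : R * R => z (x.1, (e x.2, x.2))) erefl s4 s2).
  split; first exact: smg_sub s1 s3.
  rewrite /F2 (ds_add s1 (smg_opp s3)) d1 /= E0.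
  have s5 := smg_opp s2.
  by rewrite (@ds_par _ _ (fun x : R * R => - z (x.1, (e x.2, x.2))) (0, (0, 0)) s5) addr0.
have F20 : F2 (0, (0, 0)) = 0 by rewrite /F2 /= subrr.
have [Y [Ys Y0 F2Y F2uniq]] := implicit_function F2s F20 dF2.
have YE : \forall y \near (0 : R), Y (y, 0) = y.
  have gs : smg (0 : R) (fun y : R => (y, (y, (0 : R)))) by smg.
  apply: filterS (near_smg erefl gs F2uniq) => y; rewrite /F2 /= subrr.
  by move=> /(_ erefl).
pose U (q : R * R) := h (e q.2, 0) + kap q.2 * (q.1 - h (e q.2, q.2)).
have U0 u : U (u, 0) = u by rewrite /U /= kap0 mul1r addrC subrK.
have s2 : smg ((0 : R), (0 : R)) (fun q : R * R => q.2) by smg.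
have Us : smg ((0 : R), (0 : R)) U.
  apply: smg_add; first exact: (@smg_comp _ _ _ _ _ _ _ _ erefl s2 h0s).
  apply: smg_mul; first exact: (@smg_comp _ _ _ _ _ _ _ _ erefl s2 kaps).
  apply: smg_sub; first by smg.
  exact: (@smg_comp _ _ _ _ _ _ _ _ erefl s2 hcs).
have uys : smg ((0 : R), (0 : R), (0 : R)) (fun w : R * R * R => (w.1.2, (w.1.1, w.2))) by smg.
have ycs : smg ((0 : R), (0 : R), (0 : R)) (fun w : R * R * R => (w.1.1, w.2)) by smg.
have ucs : smg ((0 : R), (0 : R), (0 : R)) (fun w : R * R * R => (w.1.2, w.2)) by smg.
have Yws : smg ((0 : R), (0 : R), (0 : R)) (fun w : R * R * R => Y (w.1.1, w.2)).
  exact: (@smg_comp _ _ _ _ _ _ _ Y erefl ycs Ys).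
have Uws : smg ((0 : R), (0 : R), (0 : R)) (fun w : R * R * R => U (w.1.2, w.2)).
  exact: (@smg_comp _ _ _ _ _ _ _ U erefl ucs Us).
pose mu (w : R * R * R) := m (Y (w.1.1, w.2), U (w.1.2, w.2), e w.2).
have gs := smg_pair (smg_pair Yws Uws) es3.
have g0 : (Y (0, 0), U (0, 0), e 0) = (0, 0, 0) by rewrite Y0 U0 e0.
have mus : smg (0, 0, 0) mu.
  exact: (@smg_comp R _ _ _ (0, 0, 0) (0, 0, 0)
    (fun w : R * R * R => (Y (w.1.1, w.2), U (w.1.2, w.2), e w.2)) m g0 gs ms).
have mu0 : 0 < mu (0, 0, 0) by rewrite /mu /= g0.
have cs : smg ((0 : R), (0 : R), (0 : R)) (fun w : R * R * R => w.2) by smg.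
have kapw : smg ((0 : R), (0 : R), (0 : R)) (fun w : R * R * R => kap w.2).
  exact: (@smg_comp _ _ _ _ _ _ _ kap erefl cs kaps).
pose Q (w : R * R * R) := m1 (w.1.2, (w.1.1, w.2)) / (kap w.2 * mu w).
have Qs : smg (0, 0, 0) Q.
  apply: smg_mul; first exact: (@smg_comp _ _ _ _ _ _ _ m1 erefl uys m1s).
  apply: smg_inv; last exact: smg_mul kapw mus.
  by rewrite /= kap0 mul1r gt_eqF.
exists (fun y u c => Q (y, u, c)), (fun y u c => Y (y, c)), (fun u c => U (u, c)), e; split.
- split.
  + apply: (@smg_smooth_near _ _ (0, 0, 0) (fun w : R * R * R => Q (w.1.1, w.1.2, w.2))).
    apply: smg_eq Qs; by apply: near_all => -[[y u] c].
  + exact: smg_smooth_near Yws.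
  + apply: (@smg_smooth_near _ _ (0, 0) (fun w : R * R => U (w.1, w.2))).
    apply: smg_eq Us; by apply: near_all => -[u c].
  + exact: smg_smooth_near es.
- have ys : smg ((0 : R), (0 : R)) (fun x : R * R => x.1) by smg.
  have sws : smg ((0 : R), (0 : R)) (fun x : R * R => (x.2, x.1)) by smg.
  have n1 := near_smg erefl ys YE.
  have n2 := near_smg erefl sws m10.
  have cs0 : smg ((0 : R), (0 : R)) (fun x : R * R => (x.1, x.2, (0 : R))) by smg.
  have n3 := near_smg erefl cs0 (near_gt0 ms m0).
  have := near_and n1 (near_and n2 n3); apply: filterS => -[y u] /= [Hy [Hm Hp]].
  split; last exact: Hy.
  by rewrite /Q /mu /= Hm kap0 mul1r Hy U0 e0 divff// gt_eqF.
- exact: near_all U0.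
- exact: e0.
have g1s : smg ((0 : R), (0 : R), (0 : R)) (fun w : R * R * R => (w.1.1, w.1.2, (0 : R))) by smg.
have n1 := near_smg erefl g1s GE.
have n2 := near_smg g0 gs GE.
have n3 := near_smg erefl uys m1E.
have H1s : smg ((0 : R), (0 : R), (0 : R)) (fun w : R * R * R => (w.1.1, (e w.2, w.2))) by smg.
have H2s : smg ((0 : R), (0 : R), (0 : R)) (fun w : R * R * R => (Y (w.1.1, w.2), (e w.2, (0 : R)))).
  by smg.
have H10 : (0, (e 0, 0)) = (0, (0, 0)) :> R * (R * R) by rewrite e0.
have H20 : (Y (0, 0), (e 0, 0)) = (0, (0, 0)) :> R * (R * R) by rewrite e0 Y0.
have n4 := near_smg H10 H1s H.
have n5 := near_smg H20 H2s H.
have n6 := near_smg erefl ycs F2Y.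
have n7 := near_smg Y0 Yws phf.
have n8 := near_gt0 mus mu0.
have kc0 : 0 < k (e 0, 0) by rewrite E0.
have n9 := near_smg erefl cs (near_gt0 kcs kc0).
have n10 := near_smg erefl cs (near_gt0 k0s kc0).
have := near_and n1 (near_and n2 (near_and n3 (near_and n4 (near_and n5
  (near_and n6 (near_and n7 (near_and n8 (near_and n9 n10)))))))).
apply: filterS => -[[y u] c] /= [K1 [K2 [K3 [K4 [K5 [K6 [K7 [K8 [K9 K10]]]]]]]]] _.
rewrite K1 K2 /Q /mu /=.
have -> : m (y, u, 0) * (u - (f y - 0 * y)) + c * p y u = m1 (u, (y, c)) * (u - phi (y, c)).
  by rewrite -K3 /= mul0r subr0.
have -> : phi (y, c) = h (e c, c) + k (e c, c) * (z (y, (e c, c)) ^+ 3 / 3 - e c * z (y, (e c, c))).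
  by rewrite -K4 subrr mul0r addr0.
have -> : f (Y (y, c)) - e c * Y (y, c)
    = h (e c, 0) + k (e c, 0) * (z (y, (e c, c)) ^+ 3 / 3 - e c * z (y, (e c, c))).
  have <- : z (Y (y, c), (e c, 0)) = z (y, (e c, c)).
    by move/eqP: K6; rewrite /F2 /= subr_eq0 => /eqP.
  by rewrite -K5 K7 e0 sub0r mulNr.
have kn := lt0r_neq0 K9; have kn0 := lt0r_neq0 K10; have mn := lt0r_neq0 K8.
rewrite /mu /= in mn.
rewrite /U /kap /=.
rewrite /U /kap /= in mn.
set M := m _ in mn *.
by move: M mn => M mn; move: kn kn0; set kc := k (e c, c); set k00 := k (e c, 0) => kn kn0; field; rewrite mn kn kn0.
Qed.

End UniversalUnfolding.

(** * Persistent diagrams *)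

Section IntervalDiffeo.
Context {R : realType}.
Implicit Types (Z W : R -> R) (a b c d : R).

(** The inverse belongs to the data, which makes the relation symmetric. *)
Definition interval_diffeo a b c d Z W : Prop :=
  (forall x, a < x < b -> [/\ smg x Z, 0 < Z^`() x, c < Z x < d & W (Z x) = x]) /\
  (forall y, c < y < d -> [/\ smg y W, 0 < W^`() y, a < W y < b & Z (W y) = y]).

Lemma interval_diffeo_sym a b c d Z W :
  interval_diffeo a b c d Z W -> interval_diffeo c d a b W Z.
Proof. by case. Qed.

Lemma derive_gt0_lt a b Z x y : (forall x, a <= x <= b -> smg x Z /\ 0 < Z^`() x) ->
  a <= x -> x < y -> y <= b -> Z x < Z y.
Proof.
move=> ZP ax xy yb; have D t : t \in `]x, y[%R -> is_derive t (1 : R) Z (Z^`() t).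
  rewrite in_itv /= => /andP[xt ty]; have [|st _] := ZP t.
    by rewrite (le_trans ax (ltW xt)) (le_trans (ltW ty) yb).
  by rewrite derive1E; exact: smg_is_derive.
have C : {within `[x, y], continuous Z}.
  apply: derivable_within_continuous => t; rewrite in_itv /= => /andP[xt ty].
  have [|st _] := ZP t; first by rewrite (le_trans ax xt) (le_trans ty yb).
  exact: smg_derivable.
have [c cxy E] := MVT xy D C.
rewrite -subr_gt0 E mulr_gt0 ?subr_gt0//.
move: cxy; rewrite in_itv /= => /andP[xc cy].
by have [|_ ->] := ZP c; first by rewrite (le_trans ax (ltW xc)) (le_trans (ltW cy) yb).
Qed.

(** The intermediate value theorem gives the inverse; by injectivity it agrees near each point with
    a local implicit function, whence its smoothness. *)
Lemma interval_diffeo_exists a b Z : a < b ->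
  (forall x, a <= x <= b -> smg x Z /\ 0 < Z^`() x) ->
  exists W, interval_diffeo a b (Z a) (Z b) Z W.
Proof.
move=> ab ZP; have inc := derive_gt0_lt ZP.
have lt_itv x : a < x < b -> Z a < Z x < Z b.
  by move=> /andP[ax xb]; rewrite (inc a x (lexx a) ax (ltW xb)) (inc x b (ltW ax) xb (lexx b)).
have inj x y : a < x < b -> a < y < b -> Z x = Z y -> x = y.
  move=> /andP[ax xb] /andP[ay yb] E; have [xy|yx|//] := ltgtP x y.
    by have := inc x y (ltW ax) xy (ltW yb); rewrite E ltxx.
  by have := inc y x (ltW ay) yx (ltW xb); rewrite E ltxx.
have ivt y : Z a < y < Z b -> exists x, a < x < b /\ Z x = y.
  move=> /andP[ay yb].
  have C : {within `[a, b], continuous Z}.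
    apply: derivable_within_continuous => t; rewrite in_itv /= => tab.
    have [|st _] := ZP t; first exact: tab.
    exact: smg_derivable.
  have [|c] := @IVT R Z a b y (ltW ab) C.
    by rewrite ge_min le_max (ltW ay) (ltW yb) orbT.
  rewrite in_itv /= => /andP[ac cb] E; exists c; split=> //.
  rewrite !lt_neqAle ac cb !andbT; apply/andP; split; apply/eqP => H.
    by move: ay; rewrite -E H ltxx.
  by move: yb; rewrite -E H ltxx.
have /choice[W WP] : forall y, exists x, Z a < y < Z b -> a < x < b /\ Z x = y.
  move=> y; have [/ivt[x xP]|_] := boolP (Z a < y < Z b); first by exists x.
  by exists 0.
have WZ x : a < x < b -> W (Z x) = x.
  by move=> xab; have [w1 w2] := WP _ (lt_itv x xab); exact: inj.
have sW y : Z a < y < Z b -> smg y W.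
  move=> yab; have [wab ZW] := WP y yab.
  have [sZ dZ] : smg (W y) Z /\ 0 < Z^`() (W y).
    by apply: ZP; case/andP: wab => /ltW-> /ltW->.
  pose F (p : R * R) := Z p.1 - p.2.
  have Zs : smg (W y, y) (fun p : R * R => Z p.1).
    by apply: (@smg_comp _ _ _ _ _ (W y) (fun p : R * R => p.1) Z) => //; smg.
  have Fs : smg (W y, y) F by apply: smg_sub; [exact: Zs|smg].
  have dF : 0 < ds F (W y, y).
    have ss : smg (W y, y) (fun p : R * R => - p.2) by smg.
    rewrite /F (ds_add Zs ss) (derive_lift (p := (W y, y)) sZ).
    have s' : smg y (fun t : R => - t) by smg.
    by rewrite (@ds_par _ _ (fun t : R => - t) (W y, y) s') addr0 -derive1E.
  have F0 : F (W y, y) = 0 by rewrite /F /= ZW subrr.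
  have [phi [phs phW Fphi _]] := implicit_function Fs F0 dF.
  have o1 : \forall p \near y, Z a < p < Z b.
    have : `]Z a, Z b[%classic y by rewrite /= in_itv.
    by move=> Iy; have := open_nbhs_nbhs (conj (itv_open (Z a) (Z b)) Iy);
      apply: filterS => p; rewrite /= in_itv.
  have o2 : \forall p \near W y, a < p < b.
    have : `]a, b[%classic (W y) by rewrite /= in_itv.
    by move=> Iy; have := open_nbhs_nbhs (conj (itv_open a b) Iy);
      apply: filterS => p; rewrite /= in_itv.
  have o3 := near_smg phW phs o2.
  apply: smg_eq phs; have := near_and o1 (near_and o3 Fphi).
  apply: filterS => t [tab [pab]]; rewrite /F /= => /eqP; rewrite subr_eq0 => /eqP E.
  by have [w1 w2] := WP t tab; apply: inj => //; rewrite w2.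
exists W; split=> [x xab|y yab].
  have [|sZ dZ] := ZP x; first by case/andP: xab => /ltW-> /ltW->.
  by split=> //; [exact: lt_itv|exact: WZ].
have [wab ZW] := WP y yab; split=> //; first exact: sW.
have [sZ dZ] : smg (W y) Z /\ 0 < Z^`() (W y).
  by apply: ZP; case/andP: wab => /ltW-> /ltW->.
have D := is_derive_compR (smg_is_derive sZ) (smg_is_derive (sW y yab)).
have o1 : \forall p \near y, Z (W p) = p.
  have : `]Z a, Z b[%classic y by rewrite /= in_itv.
  move=> Iy; have := open_nbhs_nbhs (conj (itv_open (Z a) (Z b)) Iy).
  by apply: filterS => p; rewrite /= in_itv => /= /WP[].
have E := is_derive_near_eq o1 D (is_derive_id y (1 : R)).
by rewrite derive1E -(pmulr_rgt0 _ dZ) derive1E E.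
Qed.

End IntervalDiffeo.

Lemma smg_smooth_on (R : realType) (V : normedModType R) (D : set V) (f : V -> R) :
  (forall x, D x -> smg x f) -> smooth_on D f.
Proof. by move=> Df vs x /Df/smg_smooth_near[W [_ Wx]]; exact. Qed.

Section Boxes.
Context {R : realType}.
Implicit Types (a b c d : R) (Z W U V : R -> R).

Definition box a b c d : set (R * R) := [set p | a < p.1 < b /\ c < p.2 < d].

Lemma box_open a b c d : open (box a b c d).
Proof.
have -> : box a b c d = fst @^-1` `]a, b[%classic `&` snd @^-1` `]c, d[%classic.
  by apply/seteqP; split=> -[y u]; rewrite /box /= !in_itv.
by apply: openI; apply: open_comp; do ?exact: itv_open; move=> p _; [exact: cvg_fst|exact: cvg_snd].
Qed.

Lemma box_diagram_equivalent a b c d a' b' c' d' Z W U V (Q : R * R -> R) h g :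
  interval_diffeo a b a' b' Z W -> interval_diffeo c d c' d' U V ->
  (forall p, box a b c d p -> [/\ smg p Q, 0 < Q p & h p.1 p.2 = Q p * g (Z p.1) (U p.2)]) ->
  diagram_equivalent (box a b c d) (box a' b' c' d') h g.
Proof.
move=> [Z1 W1] [U1 V1] QP.
exists (fun y _ => Z y), (fun y u => Q (y, u)), U; split.
- split; apply: smg_smooth_on => p pB.
    have [zs _ _ _] := Z1 _ pB.1.
    by apply: (@smg_comp _ _ _ _ _ p.1 (fun p : R * R => p.1) Z) => //; smg.
  have [qs _ _] := QP _ pB.
  by apply: smg_eq qs; apply: near_all => -[].
- apply: smg_smooth_on => u [y [_ /= ucd]].
  by have [] := U1 u ucd.
- split.
  + move=> [y u] [/= yab ucd]; split=> /=.
      by have [] := Z1 _ yab.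
    by have [] := U1 _ ucd.
  + move=> [y u] [y' u'] /set_mem[/= yab ucd] /set_mem[/= yab' ucd'] [EZ EU].
    have [_ _ _ <-] := Z1 _ yab; have [_ _ _ <-] := U1 _ ucd.
    by rewrite EZ EU; have [_ _ _ ->] := Z1 _ yab'; have [_ _ _ ->] := U1 _ ucd'.
  + move=> [y u] [/= yab ucd]; have [_ _ w1 w2] := W1 _ yab; have [_ _ v1 v2] := V1 _ ucd.
    by exists (W y, V u) => //=; rewrite w2 v2.
- move=> y u yuB; have [_ q0 E] := QP _ yuB; case: yuB => /= yab ucd.
  have [_ z0 _ _] := Z1 _ yab; have [_ u0 _ _] := U1 _ ucd.
  by split.
Qed.

(** Both directions are recorded, one for each half of [same_persistent_diagrams]. *)
Lemma box_diagram_equivalent2 a b c d a' b' c' d' Z W U V (Q : R * R -> R) h g :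
  interval_diffeo a b a' b' Z W -> interval_diffeo c d c' d' U V ->
  (forall p, box a b c d p -> [/\ smg p Q, 0 < Q p & h p.1 p.2 = Q p * g (Z p.1) (U p.2)]) ->
  diagram_equivalent (box a b c d) (box a' b' c' d') h g /\
  diagram_equivalent (box a' b' c' d') (box a b c d) g h.
Proof.
move=> ZW UV QP; split; first exact: box_diagram_equivalent ZW UV QP.
apply: (@box_diagram_equivalent _ _ _ _ _ _ _ _ W Z V U (fun p => (Q (W p.1, V p.2))^-1)).
- exact: interval_diffeo_sym.
- exact: interval_diffeo_sym.
move=> p [pab pcd]; have [ws _ wab zw] := ZW.2 _ pab; have [vs _ vcd uv] := UV.2 _ pcd.
have [qs q0 E] : [/\ smg (W p.1, V p.2) Q, 0 < Q (W p.1, V p.2) &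
    h (W p.1) (V p.2) = Q (W p.1, V p.2) * g (Z (W p.1)) (U (V p.2))] by exact: QP.
split; last by rewrite E zw uv mulKf// gt_eqF.
  apply: smg_inv; first by rewrite gt_eqF.
  have s1 : smg p (fun p : R * R => W p.1).
    by apply: (@smg_comp _ _ _ _ _ p.1 (fun p : R * R => p.1) W) => //; smg.
  have s2 : smg p (fun p : R * R => V p.2).
    by apply: (@smg_comp _ _ _ _ _ p.2 (fun p : R * R => p.2) V) => //; smg.
  exact: (@smg_comp _ _ _ _ _ _ (fun p : R * R => (W p.1, V p.2)) Q erefl (smg_pair s1 s2) qs).
by rewrite invr_gt0.
Qed.

End Boxes.

(** * Transition varieties *)

Section PersistentCubic.
Context {R : realType}.
Implicit Types (W : set (R * R)) (a y u : R).

Lemma is_derive_cubic (b c y : R) :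
  is_derive y (1 : R) (fun y' : R => - y' ^+ 3 - c + b * y') (b - 3 * y ^+ 2).
Proof.
have I := is_derive_id y (1 : R).
have D3 := is_derive_mulR (is_derive_mulR I I) I.
have D := is_deriveD (is_deriveB (is_deriveN D3) (is_derive_cst c y (1 : R)))
  (is_derive_mulR (is_derive_cst b y (1 : R)) I).
have -> : (fun y' : R => - y' ^+ 3 - c + b * y') =
  (fun y' => - (y' * y' * y')) \- (fun=> c) \+ (fun y' => b * y').
  by apply/funext => t /=; rewrite !exprS; ring.
apply: is_derive_eq D _ => /=; ring.
Qed.

Lemma G_hy_rev_dy (b c y : R) : (fun y' => G_hy_rev y' c b)^`() y = b - 3 * y ^+ 2.
Proof. by rewrite derive1E; have [_] := is_derive_cubic b (- c) y. Qed.

Lemma G_hy_rev_dyy (b c y : R) : (fun y' => G_hy_rev y' c b)^`(2) y = - (6 * y).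
Proof.
rewrite derive1nS (_ : _^`(1) = fun y' : R => b - 3 * (y' * y')); last first.
  by apply/funext => t; rewrite [LHS]G_hy_rev_dy expr2.
have I := is_derive_id y (1 : R).
have [_ E] := is_deriveB (is_derive_cst b y (1 : R))
  (is_derive_mulR (is_derive_cst (3 : R) y (1 : R)) (is_derive_mulR I I)).
rewrite derive1E; apply: (etrans E); rewrite mul0r; ring.
Qed.

Lemma G_hy_rev_du (b y u : R) : (fun u' => G_hy_rev y u' b)^`() u = 1.
Proof.
have I := is_derive_id u (1 : R).
have D := is_deriveD (is_derive_cst (- y ^+ 3 + b * y) u (1 : R)) I.
rewrite derive1E (_ : (fun u' => _) = (fun=> - y ^+ 3 + b * y) \+ (fun u' => u')).
  by have [_ E] := D; apply: (etrans E); rewrite add0r.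
by apply/funext => t /=; rewrite /G_hy_rev /G_hy; ring.
Qed.

(** For a double limit point, equal slopes force y2 = - y1; then a y1 = y1^3 and a = 3 y1^2 give y1
    = 0. *)
Lemma G_hy_rev_persistent W a : a != 0 -> ~ transition_variety W G_hy_rev a.
Proof.
move=> a0 [|[]].
- by move=> [y [u [_ _ _]]]; rewrite G_hy_rev_du => /eqP; rewrite oner_eq0.
- move=> [y [u [_ _]]]; rewrite G_hy_rev_dy G_hy_rev_dyy => E1 E2.
  have y0 : y = 0 by lra.
  by move: E1 a0; rewrite y0 expr0n /= mulr0 subr0 => ->; rewrite eqxx.
- move=> [y1 [y2 [u [y12 _ _ []]]]]; rewrite !G_hy_rev_dy /G_hy_rev /G_hy => e1 d1 [e2 d2].
  have : (y1 - y2) * (y1 + y2) = 0 by lra.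
  move=> /eqP; rewrite mulf_eq0 subr_eq0 (negbTE y12) /= => /eqP y21.
  have {}y21 : y2 = - y1 by lra.
  have : y1 ^+ 3 = 0 by move: d1 e1 e2; rewrite y21; nra.
  move=> /eqP; rewrite expf_eq0 /= => /eqP y10.
  by move: y12; rewrite y21 y10 oppr0 eqxx.
Qed.

Lemma G_hy_rev_transition0 W : W (0, 0) -> transition_variety W G_hy_rev 0.
Proof.
move=> W0; right; left; exists 0, 0; split=> //.
- by rewrite /G_hy_rev /G_hy; ring.
- by rewrite G_hy_rev_dy; ring.
- by rewrite G_hy_rev_dyy; ring.
Qed.

End PersistentCubic.

Section FeedbackTransition.
Context {R : realType} (S : R -> R).
Hypothesis Sb : sigmoid_base S.
Hypothesis S2 : even_derivative_sign S 1.
Implicit Types (a c y u : R).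

Let is_derive_arg c a y : is_derive y (1 : R) (fun y' : R => y' + c + a * y') (1 + a).
Proof.
have I := is_derive_id y (1 : R).
have D := is_deriveD (is_deriveD I (is_derive_cst c y (1 : R)))
  (is_derive_mulR (is_derive_cst a y (1 : R)) I).
by apply: is_derive_eq D _ => /=; ring.
Qed.

Lemma feedback_loop_dy c a y :
  (fun y' => feedback_loop S y' c a)^`() y = - 1 + S^`(1) (y + c + a * y) * (1 + a).
Proof.
have I := is_derive_id y (1 : R).
have [_ E] := is_deriveD (is_deriveN I)
  (is_derive_compR (g := fun y' : R => y' + c + a * y')
    (sigmoid_is_derive Sb 0 (y + c + a * y)) (is_derive_arg c a y)).
by rewrite derive1E; exact: E.
Qed.

Lemma feedback_loop_dyy c a y :
  (fun y' => feedback_loop S y' c a)^`(2) y = S^`(2) (y + c + a * y) * (1 + a) * (1 + a).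
Proof.
rewrite derive1nS (_ : _^`(1) = fun y' : R => - 1 + S^`(1) (y' + c + a * y') * (1 + a)); last first.
  by apply/funext => t; exact: feedback_loop_dy.
have D1 := is_derive_compR (g := fun y' : R => y' + c + a * y')
  (sigmoid_is_derive Sb 1 (y + c + a * y)) (is_derive_arg c a y).
have [_ E] := is_deriveD (is_derive_cst (- 1 : R) y (1 : R))
  (is_derive_mulR D1 (is_derive_cst (1 + a) y (1 : R))).
by rewrite derive1E; apply: (etrans E); rewrite mulr0 addr0 add0r.
Qed.

Lemma feedback_loop_du a y u :
  (fun u' => feedback_loop S y u' a)^`() u = S^`(1) (y + u + a * y).
Proof.
have I := is_derive_id u (1 : R).
have A : is_derive u (1 : R) (fun u' : R => y + u' + a * y) 1.
  have D := is_deriveD (is_deriveD (is_derive_cst y u (1 : R)) I) (is_derive_cst (a * y) u (1 : R)).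
  by apply: is_derive_eq D _ => /=; ring.
have [_ E] := is_deriveD (is_derive_cst (- y) u (1 : R))
  (is_derive_compR (g := fun u' : R => y + u' + a * y)
    (sigmoid_is_derive Sb 0 (y + u + a * y)) A).
by rewrite derive1E; apply: (etrans E); rewrite mulr1 add0r.
Qed.

Lemma feedback_loop_transition0 (W : set (R * R)) :
  W (0, 0) -> transition_variety W (feedback_loop S) 0.
Proof.
have S1 : S^`(1) 0 = 1 by case: Sb => _ _ _ _ [_].
have E0 : 0 + 0 + 0 * 0 = 0 :> R by ring.
move=> W0; right; left; exists 0, 0; split=> //.
- by rewrite /feedback_loop E0 (sigmoid0 Sb) oppr0 addr0.
- by rewrite feedback_loop_dy E0 S1 addr0 mulr1 addNr.
- by rewrite feedback_loop_dyy E0 (sigmoid2_0 Sb) !mul0r.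
Qed.

Lemma sigmoid1_decreasing (x y : R) : 0 <= x -> x < y -> S^`(1) y < S^`(1) x.
Proof.
move=> x0 xy; have [c /andP[xc _] E] := sigmoid_mvt Sb 1 xy.
rewrite -subr_lt0 E nmulr_rlt0 ?subr_gt0//.
exact: (sigmoid2_neg S2 (le_lt_trans x0 xc)).
Qed.

Lemma sigmoid1_inj (x y : R) : 0 <= x -> 0 <= y -> S^`(1) x = S^`(1) y -> x = y.
Proof.
move=> x0 y0 E; have [xy|yx|//] := ltgtP x y.
  by have := sigmoid1_decreasing x0 xy; rewrite E ltxx.
by have := sigmoid1_decreasing y0 yx; rewrite E ltxx.
Qed.

Lemma sigmoid1_norm (x : R) : S^`(1) `|x| = S^`(1) x.
Proof. by case: ger0P => // _; rewrite sigmoid1_even. Qed.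

(** Strict concavity to the right of 0: the mean slope S x / x is attained before x, where the slope
    is larger than at x. *)
Lemma sigmoid_above_tangent (x : R) : 0 < x -> x * S^`(1) x < S x.
Proof.
move=> x0; have [c /andP[c0 cx] E] := sigmoid_mvt Sb 0 x0.
have := sigmoid1_decreasing (ltW c0) cx; rewrite -(ltr_pM2l x0) => /lt_le_trans; apply.
by move: E; rewrite !derive1n0 (sigmoid0 Sb) !subr0 mulrC => ->.
Qed.

(** The first condition contradicts S' > 0. In the second, S'' vanishes only at the argument 0,
    where S' = 1 forces a = 0. In the third, S' is equal at the two arguments; being even and
    strictly decreasing on the right, it makes them opposite, so u = 0 and S x = x S'(x) for a
    nonzero x, against [sigmoid_above_tangent]. *)
Lemma feedback_loop_persistent (W : set (R * R)) a :
  a != 0 -> ~ transition_variety W (feedback_loop S) a.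
Proof.
have Sp x : 0 < S^`(1) x by case: Sb => _ _ + _ _; apply.
move=> a0 [|[]].
- move=> [y [u [_ _ _]]]; rewrite feedback_loop_du => H.
  by have := Sp (y + u + a * y); rewrite H ltxx.
- move=> [y [u [_ g0]]]; rewrite feedback_loop_dy feedback_loop_dyy.
  move: g0; rewrite /feedback_loop; set x := y + u + a * y => g0 d1 /eqP.
  have a1 : 1 + a != 0.
    by apply/eqP => H; move: d1; rewrite H mulr0 addr0 => /eqP; rewrite oppr_eq0 oner_eq0.
  rewrite !mulf_eq0 (negbTE a1) !orbF => /eqP x2.
  have x0 : x = 0.
    apply/eqP; apply: contraT => xn; have := S2 xn; rewrite x2 sgr0 => /eqP.
    by rewrite eq_sym oppr_eq0 sgr_eq0 (negbTE xn).
  have S1 : S^`(1) 0 = 1 by case: Sb => _ _ _ _ [_].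
  by move: d1 a0; rewrite x0 S1 mul1r addKr => ->; rewrite eqxx.
- move=> [y1 [y2 [u [y12 _ _ []]]]]; rewrite !feedback_loop_dy /feedback_loop.
  set x1 := y1 + u + a * y1; set x2 := y2 + u + a * y2 => e1 d1 [e2 d2].
  have a1 : 1 + a != 0.
    by apply/eqP => H; move: d1; rewrite H mulr0 addr0 => /eqP; rewrite oppr_eq0 oner_eq0.
  have Sy1 : S x1 = y1 by move: e1 => /eqP; rewrite addrC subr_eq0 => /eqP.
  have Sy2 : S x2 = y2 by move: e2 => /eqP; rewrite addrC subr_eq0 => /eqP.
  have E : S^`(1) x1 = S^`(1) x2.
    by apply: (mulIf a1); apply: (addrI (- 1)); rewrite d1 d2.
  have N : `|x1| = `|x2| by apply: sigmoid1_inj; rewrite ?sigmoid1_norm.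
  have x12 : x1 != x2 by apply: contra_neq y12 => x12; rewrite -Sy1 -Sy2 x12.
  have x21 : x2 = - x1.
    by move/eqP: N; rewrite eqr_norm2 (negbTE x12) /= => /eqP->; rewrite opprK.
  have So x : S (- x) = - S x by case: Sb => _ H _ _ _; exact: H.
  have y21 : y2 = - y1 by rewrite -Sy1 -Sy2 x21 So.
  have u0 : u = 0 by move: x21; rewrite /x1 /x2 y21; lra.
  have T1 : x1 * S^`(1) x1 = S x1.
    have x1E : x1 = y1 * (1 + a) by rewrite /x1 u0; ring.
    rewrite {1}x1E Sy1 -mulrA [(1 + a) * _]mulrC.
    have -> : S^`(1) x1 * (1 + a) = 1 by apply: (addrI (- 1)); rewrite d1 addNr.
    by rewrite mulr1.
  have [x0|x0|x0] := ltgtP x1 0.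
  + have := @sigmoid_above_tangent (- x1); rewrite oppr_gt0 => /(_ x0).
    by rewrite (sigmoid1_even Sb) mulNr T1 So ltxx.
  + by have := sigmoid_above_tangent x0; rewrite T1 ltxx.
  + by move: x12; rewrite x21 x0 oppr0 eqxx.
Qed.

End FeedbackTransition.

Lemma norm_pair_lt (R : realType) (V W : normedModType R) (p : V * W) (d : R) :
  (`|p| < d) = (`|p.1| < d) && (`|p.2| < d).
Proof. by rewrite prod_normE gt_max. Qed.

Lemma ball_pair (R : realType) (r : R) (p : R * R) :
  ball (0 : R * R) r p <-> `|p.1| < r /\ `|p.2| < r.
Proof.
rewrite -ball_normE /= sub0r normrN norm_pair_lt; split; first by case/andP.
by move=> [-> ->].
Qed.

Lemma near_between (R : realType) (V : normedModType R) (g : V -> R) (x : V) (l v : R) :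
  smg x g -> l < g x -> g x < v -> \forall y \near x, l < g y < v.
Proof.
move=> gs lg gv.
have l1 : 0 < g x - l by rewrite subr_gt0.
have l2 : 0 < v - g x by rewrite subr_gt0.
have s1 : smg x (fun y => g y - l) by apply: smg_sub; [exact: gs|exact: smg_cst].
have s2 : smg x (fun y => v - g y) by apply: smg_sub; [exact: smg_cst|exact: gs].
have := near_and (near_gt0 s1 l1) (near_gt0 s2 l2).
by apply: filterS => y; rewrite !subr_gt0 => -[-> ->].
Qed.

(** * Equivalence of the persistent diagrams *)

Section SamePersistentDiagrams.
Context {R : realType} (G : R -> R -> R -> R) (m : R * R * R -> R) (f : R -> R).
Hypotheses (ms : smg (0, 0, 0) m) (m0 : 0 < m (0, 0, 0)).
Hypotheses (fs : smg (0 : R) f) (f0 : f 0 = 0).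
Hypotheses (f1 : 'D_(1 : R) f 0 = 0) (f2 : 'D_(1 : R) ('D_(1 : R) f) 0 = 0).
Hypothesis f3 : 0 < 'D_(1 : R) ('D_(1 : R) ('D_(1 : R) f)) 0.
Hypothesis GE : \forall w \near (0, 0, 0),
  G w.1.1 w.1.2 w.2 = m w * (w.1.2 - (f w.1.1 - w.2 * w.1.1)).

(** The sizes are settled on the slice a = 0 by strict inequalities at the ends of the boxes, which
    persist for a near 0; this is how r comes out independent of a. *)
Lemma family_box_equivalences : exists2 rho0 : R, 0 < rho0 &
  forall rho, 0 < rho < rho0 -> exists2 r : R, 0 < r & \forall a \near (0 : R),
    exists N1 N2 : set (R * R),
      [/\ open N1 /\ open N2,
          ball (0 : R * R) r `<=` N1 /\ N1 `<=` ball (0 : R * R) rho,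
          ball (0 : R * R) r `<=` N2 /\ N2 `<=` ball (0 : R * R) rho &
          diagram_equivalent N1 N2 (fun y u => G y u a) (fun y u => G_hy_rev y u (3 * a)) /\
          diagram_equivalent N2 N1 (fun y u => G_hy_rev y u (3 * a)) (fun y u => G y u a)].
Proof.
have [h [k [z [[hs h0] [ks k0] [zs z0 dz] H]]]] := parametrized_cubic f1 f2 f3 fs f0.
have n1 := near_and GE (near_and (smg_near ms) (near_gt0 ms m0)).
have n2 := near_and H (near_ds_gt0 zs dz).
have [d1 d10 D1] := (near_norm _ _).1 n1.
have [d2 d20 D2] := (near_norm _ _).1 n2.
pose rho0 := Num.min d1 d2; have rho00 : 0 < rho0 by rewrite lt_min d10.
have P1 y u a : `|y| < rho0 -> `|u| < rho0 -> `|a| < rho0 ->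
    [/\ G y u a = m (y, u, a) * (u - (f y - a * y)), smg (y, u, a) m & 0 < m (y, u, a)].
  rewrite !lt_min => /andP[hy _] /andP[hu _] /andP[ha _].
  have [|e [e1 e2]] := D1 (y, u, a); last by split.
  by rewrite subr0 !norm_pair_lt /= hy hu.
have P2 y a : `|y| < rho0 -> `|a| < rho0 ->
    [/\ f y - a * y = h a + k a * (z (y, a) ^+ 3 / 3 - a * z (y, a)), smg (y, a) z & 0 < ds z (y, a)].
  rewrite !lt_min => /andP[_ hy] /andP[_ ha].
  have [|e [e1 e2]] := D2 (y, a); last by split.
  by rewrite subr0 norm_pair_lt /= hy.
have P3 y a : `|y| < rho0 -> `|a| < rho0 ->
    smg y (fun y' => z (y', a)) /\ 0 < (fun y' => z (y', a))^`() y.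
  move=> hy ha; have [_ sz dsz] := P2 y a hy ha; split.
    have ss : smg y (fun y' : R => (y', a)) by smg.
    exact: (@smg_comp _ _ _ _ _ (y, a) (fun y' : R => (y', a)) z erefl ss sz).
  by rewrite derive1E; have [_ ->] := is_derive_ds sz.
exists rho0 => // rho /andP[rho_gt0 rho_lt].
have K0 : 0 < 3 / k 0 by rewrite divr_gt0.
(* eta is the half-side of the first box, so small that this box and its image at a = 0 lie within
   rho. *)
have [eta eta0 [zr zl ur er]] : exists2 eta, 0 < eta &
    [/\ z (eta, 0) < rho, - rho < z (- eta, 0), 3 / k 0 * eta < rho & eta < rho].
  have s1 : smg (0 : R) (fun t : R => (t, (0 : R))) by smg.
  have s2 : smg (0 : R) (fun t : R => (- t, (0 : R))) by apply: smg_pair; smg.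
  have o2 : (- 0, 0) = (0, 0) :> R * R by rewrite oppr0.
  have c1 := smg_comp (erefl (0, 0)) s1 zs.
  have c2 := @smg_comp _ _ _ _ _ (0, 0) (fun t : R => (- t, (0 : R))) z o2 s2 zs.
  have c3 : smg (0 : R) (fun t : R => 3 / k 0 * t) by smg.
  have r1 : - rho < 0 by rewrite oppr_lt0.
  have n3 : \forall t \near (0 : R), - rho < z (t, 0) < rho.
    by apply: near_between; [exact: c1|rewrite z0|rewrite z0].
  have n4 : \forall t \near (0 : R), - rho < z (- t, 0) < rho.
    by apply: near_between; [exact: c2|rewrite oppr0 z0|rewrite oppr0 z0].
  have n5 : \forall t \near (0 : R), - rho < 3 / k 0 * t < rho.
    by apply: near_between; [exact: c3|rewrite mulr0|rewrite mulr0].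
  have n6 : \forall t \near (0 : R), - rho < t < rho.
    by apply: near_between; [exact: smg_id|exact: r1|exact: rho_gt0].
  have [d d0 D] := (near_norm _ _).1 (near_and n3 (near_and n4 (near_and n5 n6))).
  have d2' : 0 < d / 2 by rewrite divr_gt0.
  exists (d / 2); first exact: d2'.
  have [|/andP[_ a1] [/andP[a2 _] [/andP[_ a3] /andP[_ a4]]]] := D (d / 2); last by split.
  by rewrite subr0 gtr0_norm// ltr_pdivrMr// ltr_pMr// ltr1n.
have er0 := lt_trans er rho_lt.
have itv_norm t : - eta <= t <= eta -> `|t| < rho0.
  by rewrite -ler_norml => /le_lt_trans; apply.
have n00 : `|0 : R| < rho0 by rewrite normr0.
have zinc a : `|a| < rho0 -> forall t, - eta <= t <= eta ->
    smg t (fun y' => z (y', a)) /\ 0 < (fun y' => z (y', a))^`() t.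
  by move=> ha t /itv_norm ht; exact: P3.
have Neta : - eta < 0 by rewrite oppr_lt0.
have zpos : 0 < z (eta, 0).
  by have := derive_gt0_lt (zinc 0 n00) (ltW Neta) eta0 (lexx _); rewrite z0.
have zneg : z (- eta, 0) < 0.
  by have := derive_gt0_lt (zinc 0 n00) (lexx _) Neta (ltW eta0); rewrite z0.
have u0 : 0 < 3 / k 0 * eta by rewrite mulr_gt0.
(* r is below the distance from 0 to every side of both boxes at a = 0, so that both will contain
   the ball of radius r. *)
have [r [r0 r1 r2 r3 r4]] : exists r, [/\ 0 < r, r < z (eta, 0), r < - z (- eta, 0),
    r < 3 / k 0 * eta & r < eta].
  pose M := Num.min (Num.min (z (eta, 0)) (- z (- eta, 0))) (Num.min (3 / k 0 * eta) eta).
  have M0 : 0 < M by rewrite !lt_min zpos oppr_gt0 zneg u0.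
  exists (M / 2); have : M / 2 < M by rewrite ltr_pdivrMr// ltr_pMr// ltr1n.
  by rewrite {2}/M !lt_min => /andP[/andP[a1 a2] /andP[a3 a4]]; split=> //; rewrite divr_gt0.
exists r; first exact: r0.
have eta_itv : - eta <= eta <= eta by rewrite lexx andbT (le_trans (ltW Neta) (ltW eta0)).
have neta_itv : - eta <= - eta <= eta by rewrite lexx /= (le_trans (ltW Neta) (ltW eta0)).
have slice t : - eta <= t <= eta -> smg (0 : R) (fun a => z (t, a)).
  move=> /itv_norm ht; have [_ sz _] := P2 t 0 ht n00.
  have ss : smg (0 : R) (fun a : R => (t, a)) by smg.
  exact: (@smg_comp _ _ _ _ _ (t, 0) (fun a : R => (t, a)) z erefl ss sz).
have ki : smg (0 : R) (fun a => 3 / k a).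
  by apply: smg_mul; [smg|apply: smg_inv; [rewrite gt_eqF|exact: ks]].
have Us t : smg (0 : R) (fun a => 3 / k a * (t - h a)).
  by apply: smg_mul; [exact: ki|apply: smg_sub; [smg|exact: hs]].
have n3 : \forall a \near (0 : R), r < z (eta, a) < rho.
  by apply: near_between => //; exact: slice.
have n4 : \forall a \near (0 : R), - rho < z (- eta, a) < - r.
  by apply: near_between; [exact: slice|exact: zl|rewrite ltrNr].
have n5 : \forall a \near (0 : R), r < 3 / k a * (eta - h a) < rho.
  by apply: near_between; [exact: Us|rewrite h0 subr0|rewrite h0 subr0].
have n6 : \forall a \near (0 : R), - rho < 3 / k a * (- eta - h a) < - r.
  by apply: near_between; [exact: Us|rewrite h0 subr0 mulrN ltrN2|rewrite h0 subr0 mulrN ltrN2].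
have n7 : \forall a \near (0 : R), - rho0 < a < rho0.
  by apply: near_between; [exact: smg_id|rewrite oppr_lt0|exact: rho00].
have := near_and n3 (near_and n4 (near_and n5 (near_and n6 (near_and n7 (near_gt0 ks k0))))).
apply: filterS => a [/andP[b1 b2] [/andP[b3 b4] [/andP[b5 b6] [/andP[b7 b8] [ha ka]]]]].
have {}ha : `|a| < rho0 by rewrite ltr_norml.
pose Z y := z (y, a); pose U u := 3 / k a * (u - h a).
have Ka : 0 < 3 / k a by rewrite divr_gt0.
have Uinc t : smg t U /\ 0 < U^`() t.
  have sU : smg t U by apply: smg_mul; [smg|apply: smg_sub; smg].
  split; first exact: sU.
  have [_ E] := is_derive_mulR (is_derive_cst (3 / k a) t (1 : R))
    (is_deriveB (is_derive_id t (1 : R)) (is_derive_cst (h a) t (1 : R))).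
  rewrite derive1E (_ : 'D_1 U t = 3 / k a); first exact: Ka.
  by apply: (etrans E); rewrite mul0r add0r subr0 mulr1.
have etaN : - eta < eta := lt_trans Neta eta0.
have [W ZW] := interval_diffeo_exists etaN (zinc a ha).
have [V UV] := interval_diffeo_exists etaN (fun t _ => Uinc t).
pose Q (p : R * R) := m (p.1, p.2, a) * (k a / 3).
have QP p : box (- eta) eta (- eta) eta p ->
    [/\ smg p Q, 0 < Q p & G p.1 p.2 a = Q p * G_hy_rev (Z p.1) (U p.2) (3 * a)].
  move=> [/andP[p1 p2] /andP[p3 p4]].
  have hp1 : `|p.1| < rho0 by apply: itv_norm; rewrite !ltW.
  have hp2 : `|p.2| < rho0 by apply: itv_norm; rewrite !ltW.
  have [gE sm mp] := P1 _ _ _ hp1 hp2 ha; have [fE _ _] := P2 _ _ hp1 ha.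
  split.
  - apply: smg_mul; last exact: smg_cst.
    have ss : smg p (fun p : R * R => (p.1, p.2, a)) by smg.
    exact: (@smg_comp _ _ _ _ _ _ _ m erefl ss sm).
  - by rewrite /Q mulr_gt0// divr_gt0.
  - rewrite gE fE /Q /G_hy_rev /G_hy -/(Z p.1) /U.
    by move: (lt0r_neq0 ka) => kn; field.
have [DE1 DE2] := box_diagram_equivalent2 (h := fun y u => G y u a)
  (g := fun y u => G_hy_rev y u (3 * a)) ZW UV QP.
exists (box (- eta) eta (- eta) eta), (box (Z (- eta)) (Z eta) (U (- eta)) (U eta)); split.
- by split; exact: box_open.
- split=> p.
    move=> /ball_pair[q1 q2]; move: q1 q2; rewrite !ltr_norml => /andP[q1 q2] /andP[q3 q4].
    by split; apply/andP; split; [apply: lt_trans q1; rewrite ltrN2|exact: lt_trans q2 r4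
      |apply: lt_trans q3; rewrite ltrN2|exact: lt_trans q4 r4].
  move=> [/andP[q1 q2] /andP[q3 q4]]; apply/ball_pair.
  rewrite !ltr_norml; by split; apply/andP; split; [apply: lt_trans q1; rewrite ltrN2
    |exact: lt_trans q2 er|apply: lt_trans q3; rewrite ltrN2|exact: lt_trans q4 er].
- split=> p.
    move=> /ball_pair[q1 q2]; move: q1 q2; rewrite !ltr_norml => /andP[q1 q2] /andP[q3 q4].
    by split; apply/andP; split; [exact: lt_trans b4 q1|exact: lt_trans q2 b1
      |exact: lt_trans b8 q3|exact: lt_trans q4 b5].
  move=> [/andP[q1 q2] /andP[q3 q4]]; apply/ball_pair.
  rewrite !ltr_norml; by split; apply/andP; split;
    [exact: lt_trans b3 q1|exact: lt_trans q2 b2|exact: lt_trans b7 q3|exact: lt_trans q4 b6].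
- by split; [exact: DE1|exact: DE2].
Qed.

Hypothesis GT0 : forall W : set (R * R), W (0, 0) -> transition_variety W G 0.
Hypothesis GTn : forall (W : set (R * R)) a, a != 0 -> ~ transition_variety W G a.

(** Both transition varieties reduce to the parameter 0, so a |-> 3 a matches the persistent
    parameters, and the box equivalences are read in either direction. *)
Lemma family_same_persistent_diagrams : same_persistent_diagrams G G_hy_rev.
Proof.
have [rho0 rho00 D] := family_box_equivalences.
have ball0 rho : 0 < rho -> ball (0 : R * R) rho (0, 0).
  by move=> rho_gt0; apply/ball_pair; rewrite /= normr0.
have nr : \forall rho \near (0 : R)^'+, 0 < rho < rho0.
  near=> rho; apply/andP; split; first by near: rho; exact: nbhs_right_gt.
  by near: rho; exact: nbhs_right_lt.
have sm (K rho : R) : 0 < rho -> \forall a \near (0 : R), - rho < K * a < rho.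
  by move=> rho_gt0; apply: near_between; [smg|rewrite mulr0 oppr_lt0|rewrite mulr0].
split; apply: filterS nr => rho rhoP; have rho_gt0 : 0 < rho by case/andP: rhoP.
  have [r r0 Hr] := D rho rhoP; exists r; first exact: r0.
  apply: filterS (near_and Hr (sm 3 rho rho_gt0)) => a [[N1 [N2 [oN bN1 bN2 [E1 E2]]]] a3] nT.
  have a0 : a != 0.
    by apply/eqP => a0; apply: nT; rewrite a0; exact/GT0/ball0.
  exists (3 * a); split; first by rewrite ltr_norml.
    by apply: G_hy_rev_persistent; rewrite mulf_neq0.
  by exists N1, N2; split.
have [r r0 Hr] := D rho rhoP; exists r; first exact: r0.
have s3 : smg (0 : R) (fun b : R => 3^-1 * b) by smg.
have s30 : 3^-1 * 0 = 0 :> R by rewrite mulr0.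
apply: filterS (near_and (near_smg s30 s3 Hr) (sm 3^-1 rho rho_gt0)).
move=> b [[N1 [N2 [oN bN1 bN2 [E1 E2]]]] b3] nT.
have b0 : b != 0.
  by apply/eqP => b0; apply: nT; rewrite b0; exact/G_hy_rev_transition0/ball0.
exists (3^-1 * b); split; first by rewrite ltr_norml.
  by apply: GTn; rewrite mulf_neq0// invr_neq0.
exists N2, N1; split; [by case: oN|exact: bN2|exact: bN1|].
by move: E2; rewrite mulrA divff// mul1r.
Unshelve. all: by end_near. Qed.

End SamePersistentDiagrams.

Theorem proposition2 (R : realType) (S : R -> R) :
  (sigmoidal S ->
     universal_unfolding_of_singularity g_hy (feedback_loop S) /\
     same_persistent_diagrams (feedback_loop S) G_hy) /\
  (sigmoidal2 S ->
     universal_unfolding_of_singularity g_hy_rev (feedback_loop S) /\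
     same_persistent_diagrams (feedback_loop S) G_hy_rev).
Proof.
split=> [/sigmoidal_absurd//|[Sb S2]].
have [m [f [[ms m0] [fs f0] [f1 f2] f3 GE]]] := feedback_loop_solved Sb S2.
split; first split.
- exact: family_strongly_equivalent ms m0 fs f0 f1 f2 f3 GE.
- exact: family_universal_unfolding ms m0 fs f0 f1 f2 f3 GE.
- apply: (family_same_persistent_diagrams ms m0 fs f0 f1 f2 f3 GE).
    exact: feedback_loop_transition0.
  exact: feedback_loop_persistent.
Qed.
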